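(* Work in the general setting under Assumption 2, and assume the integrated tail of $\log\max(A_1,B_1)$ is subexponential. Fix $\gamma=(\gamma_1,\gamma_2)$ with $\gamma_1>0$ and $\mathbb E Y_1<0$, and fix an integer $M\ge1$. Then $$\liminf_{x\to\infty}\frac{\mathbb P\big(\tau_\gamma(x)<\infty,\ \Psi_{1:\tau_\gamma(x)}\big(Z'^{(M)}\big)>x\big)}{\mathbb P(T(x)<\infty)}\ge1,$$ where on $\{\tau_\gamma(x)<\infty\}$, $Z'^{(M)}=\Psi_{\tau_\gamma(x)+1:\tau_\gamma(x)+M}(0)$ (so that $\Psi_{1:\tau_\gamma(x)}(Z'^{(M)})=Z^{(\tau_\gamma(x)+M)}$).
   Context: General setting: Let $(\Psi_n,A_n,B_n,D_n)_{n\ge1}$ be i.i.d., each $\Psi_n:\mathbb R\to(0,\infty)$ a random Lipschitz function with $\mathrm{Lip}(\Psi_n)=\sup_{t_1\ne t_2}|\Psi_n(t_1)-\Psi_n(t_2)|/|t_1-t_2|$, and $(A_n,B_n,D_n)$ real random variables with, a.s., $A_nz+B_n-D_n\le\Psi_n(z)\le A_nz^++B_n^++D_n$ for all $z$ ($y^+=\max(y,0)$, $\log^+y=\max(\log y,0)$). Let $\Psi_{k:n}=\Psi_k\circ\cdots\circ\Psi_n$, $Z^{(0)}=0$, $Z^{(n)}=\Psi_{1:n}(0)$, $T(x)=\inf\{n\ge0:Z^{(n)}>x\}$. Assumption 2: $Z^{(n)}$ nondecreasing in $n$ a.s., and (a) $A_1,D_1>0$ a.s., $\mathbb E\log A_1>-\infty$,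 $\mathbb E\log\mathrm{Lip}(\Psi_1)<0$, $\mathbb E\log^+|B_1^++D_1|<\infty$, $\mathbb E\log^+|B_1-D_1|<\infty$; (b) $\mathbb E[(\log^+\max(A_1,B_1))^{1+\eta}]<\infty$ for some $\eta>0$; (c) $\mathbb P(\max(A_1,B_1^++D_1)>x)\sim\mathbb P(\max(A_1,B_1)>x)$, $\mathbb P(\max(A_1,B_1-D_1)>x)\sim\mathbb P(\max(A_1,B_1)>x)$, $\mathbb P(A_1>x,B_1-D_1\le-x)=o(\mathbb P(\max(A_1,B_1)>x))$. Integrated tail $\bar F_I(t)=\int_t^\infty\mathbb P(\log\max(A_1,B_1)>s)ds$; it is subexponential if $\bar F_I(0)\in(0,\infty)$ and the law on $[0,\infty)$ with tail $\bar F_I/\bar F_I(0)$ is subexponential. Walk: $Y_n=\max(\log^+(B_n^++D_n)-\gamma_2,\log A_n)+\gamma_1$, $S_n(\gamma)=\sum_{k=1}^nY_k$, $s(x)=\log x-\gamma_2+\log(1-e^{-\gamma_1})$, $\tau_\gamma(x)=\inf\{n\ge0:S_n(\gamma)>s(x)\}$. *)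

(* Defs.v *)
From HB Require Import structures.
From mathcomp Require Import all_boot all_order all_algebra.
From mathcomp Require Import all_classical all_reals all_analysis.
Set Implicit Arguments. Unset Strict Implicit. Unset Printing Implicit Defensive.
Import Order.TTheory GRing.Theory Num.Theory.
Import numFieldNormedType.Exports.
Local Open Scope classical_set_scope.
Local Open Scope ring_scope.

Section Defs.
Context {R : realType}.

(* log^+ y = max(log y, 0)  (and 0 for y <= 0, where ln is 0 by convention) *)
Definition logp (y : R) : R := Num.max (ln y) 0.

Definition elog (y : R) : \bar R := if y <= 0 then -oo%E else (ln y)%:E.

Definition Lip (f : R -> R) : R :=
  sup [set r | exists t1 t2, t1 != t2 /\ r = `|f t1 - f t2| / `|t1 - t2|].


(* comp_range Psi k m = Psi k \o Psi (k+1) \o ... \o Psi (k+m-1)  (0-based);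
   with Psi i standing for the paper's Psi_{i+1}, comp_range Psi (k-1) (n-k+1)
   is the paper's Psi_{k:n}. *)
Fixpoint comp_range (Psi : nat -> R -> R) (k m : nat) : R -> R :=
  match m with
  | 0 => id
  | m'.+1 => Psi k \o comp_range Psi k.+1 m'
  end.

Definition pr {d} {T : measurableType d} (P : probability T R) (E : set T) : R :=
  fine (P E).

Definition gen_events {d} {T : measurableType d} (Psi : nat -> T -> R -> R)
  (A B D : nat -> T -> R) (n : nat) : set (set T) :=
  [set E | (exists t (C : set R), measurable C /\ E = (fun w => Psi n w t) @^-1` C)
        \/ (exists C : set R, measurable C /\
             (E = A n @^-1` C \/ E = B n @^-1` C \/ E = D n @^-1` C))].

Definition sigma_n {d} {T : measurableType d} (Psi : nat -> T -> R -> R)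
  (A B D : nat -> T -> R) (n : nat) : set (set T) :=
  <<s gen_events Psi A B D n >>.

Definition mutually_indep {d} {T : measurableType d} (P : probability T R)
  (F : nat -> set (set T)) : Prop :=
  forall (s : seq nat) (E : nat -> set T), uniq s ->
    (forall i, i \in s -> F i (E i)) ->
    pr P (\big[setI/setT]_(i <- s) E i) = \prod_(i <- s) pr P (E i).

Definition cyl_event {d} {T : measurableType d} (Psi : nat -> T -> R -> R)
  (A B D : nat -> T -> R) (ts : seq R) (Cs : nat -> set R) (CA CB CD : set R)
  (n : nat) : set T :=
  [set w | (forall j, (j < size ts)%N -> Cs j (Psi n w (nth 0 ts j)))
           /\ CA (A n w) /\ CB (B n w) /\ CD (D n w)].

(* the laws of (Psi_n, A_n, B_n, D_n) (on the product/cylinder sigma-algebra of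
   R^R x R^3) do not depend on n: they agree on all measurable cylinders *)
Definition ident_distr {d} {T : measurableType d} (P : probability T R)
  (Psi : nat -> T -> R -> R) (A B D : nat -> T -> R) : Prop :=
  forall (ts : seq R) (Cs : nat -> set R) (CA CB CD : set R) (n : nat),
    (forall j, measurable (Cs j)) -> measurable CA -> measurable CB -> measurable CD ->
    pr P (cyl_event Psi A B D ts Cs CA CB CD n) = pr P (cyl_event Psi A B D ts Cs CA CB CD 0).

(* (Psi_n, A_n, B_n, D_n)_n i.i.d. (index n here is the paper's n+1) *)
Definition iid_seq {d} {T : measurableType d} (P : probability T R)
  (Psi : nat -> T -> R -> R) (A B D : nat -> T -> R) : Prop :=
  (forall n t, measurable_fun setT (fun w => Psi n w t)) /\
  (forall n, measurable_fun setT (A n)) /\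
  (forall n, measurable_fun setT (B n)) /\
  (forall n, measurable_fun setT (D n)) /\
  mutually_indep P (sigma_n Psi A B D) /\
  ident_distr P Psi A B D.

Definition asym_equiv (f g : R -> R) : Prop :=
  (f x / g x) @[x --> +oo] --> (1 : R).

Definition little_o_infty (f g : R -> R) : Prop :=
  (f x / g x) @[x --> +oo] --> (0 : R).

(* Subexponentiality of the law on [0,oo) with density h / c, c = int_0^oo h,
   i.e. with tail t |-> (int_t^oo h) / (int_0^oo h) for t >= 0.
   Fbar t = P(X > t); conv_tail x = P(X1 + X2 > x) = E[Fbar(x - X2)];
   subexponential: Fbar x > 0 for all x and conv_tail x / Fbar x -> 2. *)
Definition dens_mass (h : R -> R) : \bar R :=
  (\int[lebesgue_measure]_(s in `[0%R, +oo[%classic) (h s)%:E)%E.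

Definition dens_tail (h : R -> R) (t : R) : R :=
  fine (\int[lebesgue_measure]_(s in `[0%R, +oo[%classic `&` `]t, +oo[%classic) (h s)%:E)%E
  / fine (dens_mass h).

Definition dens_conv_tail (h : R -> R) (x : R) : R :=
  fine (\int[lebesgue_measure]_(y in `[0%R, +oo[%classic) (dens_tail h (x - y) * h y)%:E)%E
  / fine (dens_mass h).

Definition subexp_tail_law (h : R -> R) : Prop :=
  [/\ (0 < dens_mass h)%E, (dens_mass h < +oo)%E,
      (forall x, 0 < dens_tail h x) &
      (dens_conv_tail h x / dens_tail h x) @[x --> +oo] --> (2 : R)].

Definition Zproc {T} (Psi : nat -> T -> R -> R) (n : nat) (w : T) : R :=
  comp_range (fun i => Psi i w) 0 n 0.

(* Y_{k+1} = max(log^+(B^+ + D) - gamma2, log A) + gamma1  (0-based index k) *)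
Definition Yvar {T} (A B D : nat -> T -> R) (gamma1 gamma2 : R) (k : nat) (w : T) : R :=
  Num.max (logp (Num.max (B k w) 0 + D k w) - gamma2) (ln (A k w)) + gamma1.

Definition Swalk {T} (A B D : nat -> T -> R) (gamma1 gamma2 : R) (n : nat) (w : T) : R :=
  \sum_(k < n) Yvar A B D gamma1 gamma2 k w.

Definition sthr (gamma1 gamma2 x : R) : R :=
  ln x - gamma2 + ln (1 - expR (- gamma1)).

End Defs.

(* Main.v *)
(** The process exceeds a high level essentially through a single big jump.

    Upper bound for P(T(x) < oo): pathwise, Z^(n) > x forces the walk S(gamma') above
    log x - const, for every gamma' with gamma'_1 > 0. For a walk with negative drift, P(sup S > s)
    is at most (1 + o(1)) / |E Y| times the integrated tail of Y at s: after rounding the steps to a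
    lattice, the tail sums of the solution g of a defective renewal equation g = q + f * g form a
    supersolution of the hitting problem. Its kernel f is a smoothed version of the tail of Y
    divided by the drift, so that g varies slowly, and subexponentiality of the integrated tail
    gives its asymptotics. Letting gamma'_1 -> 0 and gamma'_2 -> oo turns |E Y| into |E log A|.

    Lower bound for the numerator: given that three walks with negative drift stay bounded up to
    time n, a jump of max(A, B - D) above const * x * exp(beta n) at time n + 1, where
    beta > |E log A|, makes tau = n + 1 and Z^(n+2) > x. These events are disjoint in n, and the sum
    of their probabilities is at least (1 - o(1)) / beta times the same integrated tail at log x. *)
Require Import Defs.
From HB Require Import structures.
From mathcomp Require Import all_boot all_order all_algebra.
From mathcomp Require Import all_classical all_reals all_analysis.
From mathcomp Require Import measurable_realfun ring lra zify.
Import Order.TTheory GRing.Theory Num.Theory.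
Import numFieldNormedType.Exports.
Local Open Scope classical_set_scope.
Local Open Scope ring_scope.
Set Implicit Arguments.
Unset Strict Implicit.
Unset Printing Implicit Defensive.

(** * Real sequences *)

Section Sequences.
Context {R : realType}.
Implicit Types (r b e c : R) (f g x : nat -> R).

(** Only the integrated tail is subexponential; the tail of Y itself may drop abruptly. The
    comparison function therefore needs increments g with [r * g n <= g n.+1], which is why the
    kernel is smoothed and the source is geometric. A step of size at most K then costs only a
    factor [r ^ K], while the larger upward steps contribute at most alpha times the convolution of
    f and g, hence at most [alpha * g], alpha being nearly the drift. Two demands on r conflict:
    [r ^ K] near 1, and a small smoothed mass of order [F K / (1 - r)]. The choice [r = 1 - e / K]
    meets both because n * F n tends to 0 for a nonincreasing summable F.

    The three walks of the lower bound are the one defining tau, kept low so that tau is not reached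
    early; one built from |B - D|, which controls the additive terms; and one with steps - log A -
    beta, which keeps the product of the A's above const * exp(- beta * n). The factor exp(beta * n)
    in the jump compensates this product, and tails at log x + beta * n, summed over n, form a
    Riemann sum of mesh beta: hence 1 / beta. *)

Lemma geometric_small r c e : 0 <= r -> r < 1 -> 0 < e ->
  \forall n \near \oo, c * r ^+ n <= e.
Proof.
move=> r0 r1 e0.
have /cvgrPdist_le : (fun n => c * r ^+ n) @ \oo --> (c * 0 : R).
  by apply: cvgMl_tmp; apply: cvg_expr; rewrite ger0_norm.
move=> /(_ _ e0); apply: filterS => n.
rewrite mulr0 sub0r normrN => h; exact: le_trans (ler_norm _) h.
Qed.

Lemma contraction_limsup r b e x : 0 <= r -> r < 1 -> 0 < e ->
  (\forall n \near \oo, x n.+1 <= r * x n + (1 - r) * b) ->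
  \forall n \near \oo, x n <= b + e.
Proof.
move=> r0 r1 e0 [N _ hN].
have key k : x (N + k)%N - b <= (x N - b) * r ^+ k.
  elim: k => [|k IH]; first by rewrite addn0 expr0 mulr1.
  have := hN (N + k)%N (leq_addr _ _); rewrite addnS exprS => h.
  have h2 : r * (x (N + k)%N - b) <= r * ((x N - b) * r ^+ k) by exact: ler_wpM2l.
  lra.
have [M _ hM] := geometric_small (x N - b) r0 r1 e0.
exists (N + M)%N => // n /= hn.
have hn1 : (M <= n - N)%N by lia.
have := hM _ hn1; have := key (n - N)%N; rewrite subnKC; last by lia.
lra.
Qed.

Definition psum (f : nat -> R) (n : nat) : R := \sum_(i < n) f i.
Definition total (f : nat -> R) : R := sup (range (psum f)).
Definition tsum (f : nat -> R) (n : nat) : R := total f - psum f n.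

Lemma psumS f n : psum f n.+1 = psum f n + f n.
Proof. by rewrite /psum big_ord_recr. Qed.

Lemma psum0 f : psum f 0 = 0.
Proof. by rewrite /psum big_ord0. Qed.

Lemma psum_le f m n : (forall i, 0 <= f i) -> (m <= n)%N -> psum f m <= psum f n.
Proof.
move=> f0; elim: n => [|n IH]; first by rewrite leqn0 => /eqP ->.
rewrite leq_eqVlt => /predU1P[->//|/IH h].
by rewrite psumS; have := f0 n; lra.
Qed.

Lemma psum_ge0 f n : (forall i, 0 <= f i) -> 0 <= psum f n.
Proof. by move=> f0; rewrite -(psum0 f); exact: psum_le. Qed.

Section Summable.
Variables (f : nat -> R) (c : R).
Hypotheses (f0 : forall i, 0 <= f i) (fc : forall n, psum f n <= c).

Lemma psum_total n : psum f n <= total f.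
Proof.
apply: ub_le_sup; last by exists n.
by exists c => _ [m _ <-].
Qed.

Lemma total_le b : (forall n, psum f n <= b) -> total f <= b.
Proof.
move=> h; apply: ge_sup; first by exists (psum f 0); exists 0%N.
by move=> _ [m _ <-].
Qed.

Lemma tsum_ge0 n : 0 <= tsum f n.
Proof. by rewrite subr_ge0 psum_total. Qed.

Lemma tsumS n : tsum f n = f n + tsum f n.+1.
Proof. by rewrite /tsum psumS; lra. Qed.

Lemma tsum_noninc m n : (m <= n)%N -> tsum f n <= tsum f m.
Proof. by move=> mn; rewrite /tsum; have := psum_le f0 mn; lra. Qed.

Lemma tsum_le n b : (forall N, (n <= N)%N -> psum f N - psum f n <= b) -> tsum f n <= b.
Proof.
move=> h; rewrite /tsum lerBlDl; apply: total_le => N.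
have [nN|Nn] := leqP n N; first by have := h _ nN; lra.
have := h _ (leqnn n); have := psum_le f0 (ltnW Nn); lra.
Qed.

Lemma tsum_small e : 0 < e -> \forall n \near \oo, tsum f n <= e.
Proof.
move=> e0.
have [|_ [N _ <-] hN] := @sup_adherent R (range (psum f)) e e0.
  by split; [exists (psum f 0); exists 0%N | exists c => _ [m _ <-]].
exists N => // n /= Nn; have := psum_le f0 Nn.
by rewrite /tsum /total; move: hN; set s := sup _; lra.
Qed.

End Summable.

(** By monotonicity (n - N) * f n is below the sum of f from N to n, which is small; n <= 2 * (n -
    N) costs a factor 2. *)
Lemma noninc_summable_small f c e : (forall i, 0 <= f i) ->
  (forall i j, (i <= j)%N -> f j <= f i) ->
  (forall n, psum f n <= c) -> 0 < e ->
  \forall n \near \oo, n%:R * f n <= e.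
Proof.
move=> f0 fm fc e0.
have e20 : 0 < e / 2 by lra.
have [N _ hN] := tsum_small f0 fc e20.
have key m k : k%:R * f (m + k)%N <= psum f (m + k) - psum f m.
  have : forall j, (j <= k)%N -> j%:R * f (m + k)%N <= psum f (m + j) - psum f m.
    elim=> [|j IH] jk; first by rewrite mul0r addn0 subrr.
    rewrite addnS psumS -natr1 mulrDl mul1r.
    have := IH (ltnW jk).
    have : f (m + k)%N <= f (m + j)%N by apply: fm; lia.
    lra.
  by apply.
exists (N + N)%N => // n /= Nn.
have h1 := key N (n - N)%N; rewrite subnKC in h1; last by lia.
have h2 : psum f n - psum f N <= e / 2.
  by have := hN N (leqnn N); have := psum_total fc n; rewrite /= /tsum; lra.
have h3 : n%:R <= 2 * (n - N)%:R :> R.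
  by rewrite -natrM ler_nat; lia.
have h4 : n%:R * f n <= 2 * (n - N)%:R * f n by apply: ler_wpM2r.
lra.
Qed.

Lemma bernoulli (x : R) n : 0 <= x -> x <= 1 -> 1 - n%:R * x <= (1 - x : R) ^+ n.
Proof.
move=> x0 x1; elim: n => [|n IH]; first by rewrite mul0r subr0 expr0.
rewrite exprS -natr1.
have h : (1 - x) * (1 - n%:R * x) <= (1 - x) * (1 - x) ^+ n.
  by apply: ler_wpM2l => //; lra.
apply: le_trans h.
have n0 : 0 <= n%:R :> R by [].
nra.
Qed.

Section Renewal.
Variables (q f : nat -> R).
(** Course-of-values recursion: the list of all earlier values is carried along, as the convolution
    needs each of them. *)
Fixpoint renewal_seq n : seq R :=
  if n is n'.+1 then
    rcons (renewal_seq n')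
      (q n' + \sum_(s < n') f s.+1 * nth 0 (renewal_seq n') (n' - s.+1))
  else [::].
Definition renewal n := nth 0 (renewal_seq n.+1) n.

Lemma size_renewal_seq n : size (renewal_seq n) = n.
Proof. by elim: n => //= n IH; rewrite size_rcons IH. Qed.

Lemma nth_renewal_seq n i : (i < n)%N -> nth 0 (renewal_seq n) i = renewal i.
Proof.
elim: n => // n IH; rewrite ltnS leq_eqVlt => /predU1P[->//|lt_in].
by rewrite /= nth_rcons size_renewal_seq lt_in IH.
Qed.

Lemma renewalE n : f 0%N = 0 ->
  renewal n = q n + \sum_(s < n.+1) f s * renewal (n - s).
Proof.
move=> f0; rewrite /renewal /= nth_rcons size_renewal_seq ltnn eqxx.
rewrite big_ord_recl f0 mul0r add0r; congr (_ + _).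
apply: eq_bigr => s _; rewrite nth_renewal_seq //; have := ltn_ord s; lia.
Qed.

End Renewal.

Lemma psum_conv f g n :
  psum (fun i => \sum_(s < i.+1) f s * g (i - s)%N) n =
  \sum_(s < n) f s * psum g (n - s).
Proof.
elim: n => [|n IH]; first by rewrite psum0 big_ord0.
rewrite psumS IH big_ord_recr /= subnn big_ord_recr /= subSn // subnn.
rewrite psumS psum0 add0r addrA; congr (_ + _); rewrite -big_split /=.
apply: eq_bigr => s _; rewrite -mulrDr -psumS; congr (_ * psum _ _).
have := ltn_ord s; lia.
Qed.

End Sequences.

(** * Supersolutions for lattice walks *)

Section Smoothing.
Context {R : realType}.
Variables (F : nat -> R) (K : nat) (r : R).
Hypotheses (F0 : forall n, 0 <= F n) (Fm : forall m n, (m <= n)%N -> F n <= F m).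
Hypotheses (r0 : 0 <= r) (r1 : r < 1) (K0 : (0 < K)%N).

Local Ltac rlra := move: r0 r1 => ? ?; lra.

(* Exponential moving average of F from K on: unlike F, it cannot drop by more than a factor r
   per step. *)
Fixpoint ema k := if k is k'.+1 then r * ema k' + (1 - r) * F (K + k)%N else F K.
Definition smooth s := if (s < K)%N then 0 else ema (s - K).

Lemma smoothK : smooth K = F K.
Proof. by rewrite /smooth ltnn subnn. Qed.

Lemma smooth_lt s : (s < K)%N -> smooth s = 0.
Proof. by rewrite /smooth => ->. Qed.

Lemma smoothS s : (K <= s)%N -> smooth s.+1 = r * smooth s + (1 - r) * F s.+1.
Proof.
move=> Ks; rewrite /smooth ltnNge (leqW Ks) ltnNge Ks /= subSn //=.
by rewrite addnS subnKC.
Qed.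

Lemma ema_ge0 k : 0 <= ema k.
Proof.
elim: k => [|k IH] /=; first exact: F0.
have ? : 0 <= 1 - r by rlra.
by apply: addr_ge0; apply: mulr_ge0.
Qed.

Lemma smooth_ge0 s : 0 <= smooth s.
Proof. by rewrite /smooth; case: ifP => // _; exact: ema_ge0. Qed.

Lemma smooth_decay s : r * smooth s <= smooth s.+1.
Proof.
have [sK|Ks] := ltnP s K; first by rewrite smooth_lt // mulr0 smooth_ge0.
by rewrite smoothS // lerDl; apply: mulr_ge0 => //; rlra.
Qed.

Lemma le_ema k : F (K + k)%N <= ema k.
Proof.
elim: k => [|k IH] /=; first by rewrite addn0.
have : F (K + k.+1)%N <= F (K + k)%N by apply: Fm; lia.
move=> h; have : r * F (K + k.+1)%N <= r * ema k by apply: ler_wpM2l => //; rlra.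
rlra.
Qed.

Lemma le_smooth s : (K <= s)%N -> F s <= smooth s.
Proof.
by move=> Ks; rewrite /smooth ltnNge Ks /=; have := le_ema (s - K); rewrite subnKC.
Qed.

Lemma psum_smooth_lt n : (n <= K)%N -> psum smooth n = 0.
Proof.
move=> nK; rewrite /psum big1 // => i _; apply: smooth_lt; have := ltn_ord i; lia.
Qed.

(** Summing the averaging recursion telescopes; F K enters as the initial charge of the average. *)
Lemma psum_smoothE n : (K <= n)%N ->
  (1 - r) * psum smooth n.+1 + r * smooth n = F K + (1 - r) * (psum F n.+1 - psum F K.+1).
Proof.
elim: n => [|n IH]; first by move=> Kn; exfalso; lia.
rewrite leq_eqVlt => /predU1P[<-|].
  by rewrite psumS psum_smooth_lt // smoothK; rlra.
rewrite ltnS => Kn; have := IH Kn.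
rewrite (psumS smooth n.+1) (psumS F n.+1) smoothS //; rlra.
Qed.

Variable c : R.
Hypothesis Fc : forall n, psum F n <= c.

Lemma psum_smooth_le n : psum smooth n <= F K / (1 - r) + tsum F K.+1.
Proof.
have h0 : 0 <= F K / (1 - r) by apply: divr_ge0 => //; rlra.
have h1 := tsum_ge0 Fc K.+1.
have [nK|Kn] := leqP n K; first by rewrite psum_smooth_lt //; rlra.
case: n Kn => // n; rewrite ltnS => Kn.
have := psum_smoothE Kn.
have h2 := psum_total Fc n.+1.
have h4 := psum_smoothE Kn.
have h3 : 0 <= r * smooth n by apply: mulr_ge0 => //; exact: smooth_ge0.
have h5 : (1 - r) * psum smooth n.+1 <= (1 - r) * (F K / (1 - r) + tsum F K.+1).
  rewrite mulrDr [(1 - r) * (_ / _)]mulrC divfK; last by rlra.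
  have : (1 - r) * (psum F n.+1 - psum F K.+1) <= (1 - r) * tsum F K.+1.
    by apply: ler_wpM2l; rewrite /tsum; rlra.
  rlra.
by move: h5; rewrite ler_pM2l ?subr_gt0.
Qed.

End Smoothing.

(* With t s = P(Y > (s - 1) theta), u s = P(Y <= - s theta) and X = ceil(Y / theta), the last clause
   is E h(n - X) <= h(n) after a summation by parts, with the downward steps truncated at K. *)
Definition supersol {R : realType} (t u : nat -> R) (K : nat) (h : nat -> R) : Prop :=
  [/\ 1 <= h 0%N, forall n, 0 <= h n, forall m n, (m <= n)%N -> h n <= h m &
   forall n, \sum_(l < n) (h l - h l.+1) * t (n - l)%N <=
             \sum_(i < K) u i.+1 * (h (n + i)%N - h (n + i).+1)].

Lemma psum_if {R : realType} (a : nat -> R) K n :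
  psum (fun s => if (s < K)%N then a s else 0) n = psum a (minn n K).
Proof.
elim: n => [|n IH]; first by rewrite min0n !psum0.
rewrite psumS IH; have [nK|Kn] := ltnP n K.
  by rewrite (minn_idPl nK) psumS.
by rewrite addr0 (minn_idPr (leqW Kn)).
Qed.

Section Supersolution.
Context {R : realType}.
Variables (F : nat -> R) (K : nat) (r alpha e c : R).
Hypothesis F0 : forall n, 0 <= F n.
Hypothesis Fc : forall n, psum F n <= c.
Hypotheses (r0 : 0 < r) (r1 : r < 1) (K0 : (0 < K)%N).
Hypotheses (alpha0 : 0 < alpha) (e0 : 0 <= e) (e1 : e < 1).
Hypothesis mass : F K / (1 - r) + tsum F K.+1 <= alpha * e.

Local Ltac rlra := move: r0 r1 alpha0 e0 e1 => ? ? ? ? ?; lra.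

Let f s : R := smooth F K r s / alpha.
(** A source of total mass 1 and ratio r: the mass forces the tail of g at 0 to be at least 1, and
    the ratio lets g inherit the slow decay of f. *)
Let q n : R := (1 - r) * r ^+ n.
Definition super_density := renewal q f.
Definition super_tail := tsum super_density.
Local Notation g := super_density.

Let f_ge0 s : 0 <= f s.
Proof. by apply: divr_ge0; [apply: smooth_ge0 => //; rlra|rlra]. Qed.

Let q_ge0 n : 0 <= q n.
Proof. by apply: mulr_ge0; [rlra|apply: exprn_ge0; rlra]. Qed.

Let f0 : f 0%N = 0.
Proof. by rewrite /f smooth_lt // mul0r. Qed.

Lemma super_densityE n : g n = q n + \sum_(s < n.+1) f s * g (n - s).
Proof. exact: renewalE. Qed.

Lemma super_density_ge0 n : 0 <= g n.
Proof.
elim/ltn_ind: n => n IH; rewrite super_densityE addr_ge0 // sumr_ge0 // => s _.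
have [->|s0] := eqVneq (s : nat) 0%N; first by rewrite f0 mul0r.
by apply: mulr_ge0 => //; apply: IH; have := ltn_ord s; lia.
Qed.

Lemma super_density_decay n : r * g n <= g n.+1.
Proof.
rewrite !super_densityE mulrDr; apply: lerD; first by rewrite /q exprS; rlra.
rewrite [leRHS]big_ord_recl f0 mul0r add0r mulr_sumr; apply: ler_sum => s _.
rewrite mulrA; apply: ler_wpM2r; first exact: super_density_ge0.
have := @smooth_decay _ F K r F0 (ltW r0) r1 s.
by rewrite /f lift0 => h; rewrite mulrA ler_pM2r ?invr_gt0.
Qed.

Lemma super_density_decayX n k : r ^+ k * g n <= g (n + k)%N.
Proof.
elim: k => [|k IH]; first by rewrite expr0 mul1r addn0.
rewrite exprS addnS -mulrA; apply: le_trans (super_density_decay _).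
by apply: ler_wpM2l => //; rlra.
Qed.

Lemma psum_fmass n : psum f n <= e.
Proof.
have h := psum_smooth_le F0 (ltW r0) r1 K0 Fc n.
have -> : psum f n = psum (smooth F K r) n / alpha.
  by rewrite /psum mulr_suml.
by rewrite ler_pdivrMr // mulrC; exact: le_trans h mass.
Qed.

Lemma psum_geom n : psum q n = 1 - r ^+ n.
Proof.
elim: n => [|n IH]; first by rewrite psum0 expr0 subrr.
by rewrite psumS IH /q exprS; rlra.
Qed.

Lemma psum_super n : psum g n = 1 - r ^+ n + \sum_(s < n) f s * psum g (n - s).
Proof.
rewrite -psum_conv -psum_geom /psum -big_split /=.
by apply: eq_bigr => i _; rewrite super_densityE.
Qed.

Lemma psum_super_le n : psum g n <= (1 - e)^-1.
Proof.
have h : psum g n <= 1 + e * psum g n.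
  rewrite {1}psum_super; apply: lerD.
    by have : 0 <= r ^+ n by [apply: exprn_ge0; rlra]; rlra.
  apply: (@le_trans _ _ (psum f n * psum g n)).
    rewrite /psum mulr_suml; apply: ler_sum => s _; apply: ler_wpM2l => //.
    apply: (psum_le (f := g)); [exact: super_density_ge0|lia].
  by apply: ler_wpM2r (psum_fmass n); apply: psum_ge0; exact: super_density_ge0.
by rewrite -[leRHS]mul1r ler_pdivlMr; [rlra|rlra].
Qed.

Lemma super_tail_ge0 n : 0 <= super_tail n.
Proof. exact: tsum_ge0 psum_super_le n. Qed.

Lemma super_tail0_le : super_tail 0 <= (1 - e)^-1.
Proof. by rewrite /super_tail /tsum psum0 subr0; apply: total_le; exact: psum_super_le. Qed.

Lemma super_tail_noninc m n : (m <= n)%N -> super_tail n <= super_tail m.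
Proof. exact: tsum_noninc super_density_ge0 _ _. Qed.

Lemma super_tail_diff n : super_tail n - super_tail n.+1 = g n.
Proof. by rewrite /super_tail (tsumS g n); rlra. Qed.

Lemma super_tail0_ge1 : 1 <= super_tail 0.
Proof.
rewrite /super_tail /tsum psum0 subr0.
apply/ler_addgt0Pr => d d0.
have [N _ hN] := geometric_small 1 (ltW r0) r1 d0.
have := hN N (leqnn N); rewrite mul1r => h1.
have := psum_total psum_super_le N.
have : 1 - r ^+ N <= psum g N.
  rewrite psum_super lerDl sumr_ge0 // => s _; apply: mulr_ge0 => //.
  by apply: psum_ge0; exact: super_density_ge0.
rlra.
Qed.

Lemma super_tail_small d : 0 < d -> \forall n \near \oo, super_tail n <= d.
Proof. exact: tsum_small super_density_ge0 psum_super_le _. Qed.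

(** The renewal equation summed beyond n: the source leaves [r ^+ n], indices s < n give the
    convolution, and for s >= n the partial sums of g are bounded by its total mass. *)
Lemma super_tail_rec n :
  super_tail n <= r ^+ n + \sum_(s < n) f s * super_tail (n - s)
                  + (1 - e)^-1 * tsum f n.
Proof.
apply: (tsum_le super_density_ge0) => N nN.
rewrite psum_super (psum_super n).
have -> : \sum_(s < N) f s * psum g (N - s) =
   \sum_(s < n) f s * psum g (N - s) + \sum_(n <= s < N) f s * psum g (N - s).
  by rewrite -!(big_mkord xpredT (fun s => f s * psum g (N - s))) (@big_cat_nat _ _ _ n) //=.
have h1 : \sum_(s < n) f s * psum g (N - s) - \sum_(s < n) f s * psum g (n - s)
   <= \sum_(s < n) f s * super_tail (n - s).
  rewrite -sumrB; apply: ler_sum => s _; rewrite -mulrBr; apply: ler_wpM2l => //.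
  by rewrite lerD2r; exact: psum_total psum_super_le _.
have h2 : \sum_(n <= s < N) f s * psum g (N - s) <= (1 - e)^-1 * tsum f n.
  apply: (@le_trans _ _ ((1 - e)^-1 * (psum f N - psum f n))).
    have -> : psum f N - psum f n = \sum_(n <= s < N) f s.
      by rewrite /psum -!(big_mkord xpredT f) (@big_cat_nat _ _ _ n 0%N N) //=; lra.
    rewrite mulr_sumr; apply: ler_sum => s _; rewrite mulrC.
    by apply: ler_wpM2r => //; exact: psum_super_le.
  apply: ler_wpM2l; first by rewrite invr_ge0; rlra.
  by rewrite lerD2r; exact: psum_total psum_fmass N.
have : 0 <= r ^+ N by apply: exprn_ge0; rlra.
rlra.
Qed.

Variables t u : nat -> R.
Hypothesis Fm : forall m n, (m <= n)%N -> F n <= F m.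
Hypotheses (t0 : forall s, 0 <= t s) (u0 : forall s, 0 <= u s).
Hypothesis tF : forall s, (K <= s)%N -> t s <= F s.
Hypothesis balance :
  r ^- K * \sum_(s < K) t s.+1 + alpha <= r ^+ K * \sum_(s < K) u s.+1.

(** The increments of [super_tail] are g. Slow decay compares g at distance at most K with [g n], at
    the cost of [r ^- K] for upward and [r ^+ K] for downward steps. Larger upward steps satisfy t s
    <= F s <= alpha * f s, and the renewal equation bounds their convolution with g by
    [alpha * g n]. [balance] is what remains after dividing by [g n]. *)
Lemma super_tail_supersol : supersol t u K super_tail.
Proof.
split; [exact: super_tail0_ge1|exact: super_tail_ge0|exact: super_tail_noninc|].
move=> n.
under eq_bigr do rewrite super_tail_diff.
under [leRHS]eq_bigr do rewrite super_tail_diff.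
have gn0 := super_density_ge0 n.
have rK0 : 0 < r ^+ K by exact: exprn_gt0.
apply: (@le_trans _ _ (r ^+ K * \sum_(s < K) u s.+1 * g n)); last first.
  rewrite mulr_sumr; apply: ler_sum => i _.
  rewrite mulrCA; apply: ler_wpM2l => //.
  apply: le_trans (super_density_decayX n i).
  apply: ler_wpM2r => //; apply: ler_wiXn2l; [rlra|rlra|exact: ltnW].
rewrite -mulr_suml mulrA.
apply: le_trans (ler_wpM2r gn0 balance).
rewrite mulrDl.
rewrite (reindex_inj rev_ord_inj) /=.
pose a s := t s.+1 * (r ^- K * g n).
apply: (@le_trans _ _ (psum (fun s => if (s < K)%N then a s else 0) n
    + \sum_(s < n) alpha * f s.+1 * g (n - s.+1))).
  rewrite -big_split /=; apply: ler_sum => s _.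
  have sn := ltn_ord s; rewrite subKn // mulrC.
  have gs0 := super_density_ge0 (n - s.+1).
  have af : alpha * f s.+1 = smooth F K r s.+1 by rewrite /f mulrCA mulfV ?mulr1 //; rlra.
  rewrite af; have sm0 := @smooth_ge0 _ F K r F0 (ltW r0) r1 s.+1.
  case: ifP => sK.
    apply: ler_wpDr; first exact: mulr_ge0.
    rewrite /a; apply: ler_wpM2l => //.
    rewrite ler_pdivlMl //.
    apply: le_trans (_ : r ^+ s.+1 * g (n - s.+1) <= _).
      by apply: ler_wpM2r => //; apply: ler_wiXn2l; [rlra|rlra|].
    by have := super_density_decayX (n - s.+1) s.+1; rewrite subnK.
  rewrite add0r; apply: ler_wpM2r => //.
  have Ks : (K <= s.+1)%N by apply: leqW; rewrite leqNgt sK.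
  by apply: le_trans (tF Ks) _; apply: le_smooth => //; rlra.
apply: lerD.
  rewrite psum_if; apply: (@le_trans _ _ (psum a K)).
    apply: psum_le; last exact: geq_minr.
    move=> i; rewrite /a; apply: mulr_ge0 => //; apply: mulr_ge0 => //.
    by rewrite invr_ge0 ltW.
  by rewrite /psum /a -mulr_suml; rlra.
have := super_densityE n; rewrite big_ord_recl f0 mul0r add0r => gE.
under eq_bigr do rewrite -mulrA.
rewrite -mulr_sumr ler_pM2l // [leRHS]gE.
apply: ler_wpDl => //.
Qed.

End Supersolution.

(** If G is the tail of independent X1 and X2, the last sum bounds from below the part of P(X1 + X2
    > n) where X1 <= n; the part X1 > n has probability G n. Hence 1 + e here against the limit 2 of
    the full ratio. The third clause is convexity, provided by a nonincreasing density. *)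
Definition lattice_subexp {R : realType} (G : nat -> R) : Prop :=
  [/\ G 0%N = 1, forall n, 0 < G n,
      forall n, G n.+1 - G n.+2 <= G n - G n.+1,
      forall e : R, 0 < e -> \forall n \near \oo, G n <= e &
      forall e : R, 0 < e ->
        \forall n \near \oo, \sum_(j < n) (G j - G j.+1) * G (n - j)%N <= (1 + e) * G n].

(** * Long tails and convolutions of subexponential sequences *)

Section LatticeSubexp.
Context {R : realType}.
Variable G : nat -> R.
Hypotheses (G1 : G 0%N = 1) (Gpos : forall n, 0 < G n).
Hypothesis Gm : forall m n, (m <= n)%N -> G n <= G m.
Hypothesis Gsmall : forall e : R, 0 < e -> \forall n \near \oo, G n <= e.
Hypothesis Gconv : forall e : R, 0 < e ->
  \forall n \near \oo, \sum_(j < n) (G j - G j.+1) * G (n - j)%N <= (1 + e) * G n.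
Local Notation d := (fun j => G j - G j.+1).

Lemma lattice_diff_ge0 j : 0 <= d j.
Proof. by rewrite subr_ge0 Gm. Qed.

Lemma psum_lattice_diff n : psum d n = 1 - G n.
Proof. by elim: n => [|n IH]; rewrite ?psum0 ?psumS ?IH ?G1; lra. Qed.

Lemma lattice_diffS_sum n : \sum_(j < n) (G j.+1 - G j.+2) = G 1%N - G n.+1.
Proof.
elim: n => [|n IH]; first by rewrite big_ord0 subrr.
by rewrite big_ord_recr IH /=; lra.
Qed.

(** In the convolution at n.+1 the index 0 gives (1 - G 1) * G n.+1, and the others carry at least G
    n with total weight G 1 - G n.+1. As the sum is at most (1 + e') * G n.+1, the excess of G n
    over G n.+1 is small. *)
Lemma lattice_long_tail1 e : 0 < e -> \forall n \near \oo, G n <= (1 + e) * G n.+1.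
Proof.
move=> e0; have g1 := Gpos 1.
pose e' := e * G 1%N / 4.
have e'0 : 0 < e' by rewrite /e'; apply: divr_gt0; [exact: mulr_gt0|lra].
have g10 : 0 < G 1%N / 2 by lra.
have [N1 _ hN1] := Gconv e'0.
have [N2 _ hN2] := Gsmall e'0.
have [N3 _ hN3] := Gsmall g10.
exists (N1 + N2 + N3).+1%N => // n /= hn.
have h1 : \sum_(j < n.+1) (G j - G j.+1) * G (n.+1 - j)%N <= (1 + e') * G n.+1.
  by apply: hN1 => /=; lia.
have h2 : G n.+1 <= e' by apply: hN2 => /=; lia.
have h3 : G n.+1 <= G 1%N / 2 by apply: hN3 => /=; lia.
have h4 : (1 - G 1%N) * G n.+1 + (G 1%N - G n.+1) * G n <=
    \sum_(j < n.+1) (G j - G j.+1) * G (n.+1 - j)%N.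
  rewrite big_ord_recl subn0 G1 lerD2l.
  rewrite -lattice_diffS_sum mulr_suml; apply: ler_sum => j _; rewrite lift0 subSS.
  by apply: ler_wpM2l; [exact: lattice_diff_ge0|apply: Gm; lia].
have h5 : G n.+1 <= G n by apply: Gm.
have g0 := Gpos n.+1.
have h6 : (G 1%N - G n.+1) * (G n - G n.+1) <= (e' + G n.+1) * G n.+1 by lra.
have h7 : G 1%N / 2 * (G n - G n.+1) <= (G 1%N - G n.+1) * (G n - G n.+1).
  by apply: ler_wpM2r; lra.
have h8 : (e' + G n.+1) * G n.+1 <= (e' + e') * G n.+1.
  by apply: ler_wpM2r; lra.
have h9 : G 1%N / 2 * (G n - G n.+1) <= G 1%N / 2 * (e * G n.+1).
  by move: h6 h7 h8; rewrite /e'; lra.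
by move: h9; rewrite ler_pM2l //; lra.
Qed.

Lemma lattice_long_tail e k : 0 < e -> \forall n \near \oo, G (n - k)%N <= (1 + e) * G n.
Proof.
elim: k e => [|k IH] e e0.
  by near=> n; rewrite subn0; have := Gpos n; nra.
pose e' := Num.min (e / 3) 1.
have e'0 : 0 < e' by rewrite lt_min; apply/andP; split; lra.
have [e'1 e'2] : e' <= e / 3 /\ e' <= 1 by split; rewrite ge_min lexx ?orbT.
have [N1 _ hN1] := IH _ e'0.
have [N2 _ hN2] := lattice_long_tail1 e'0.
exists (N1 + N2 + k).+2%N => // n /= hn.
have h1 : G (n - k)%N <= (1 + e') * G n by apply: hN1 => /=; lia.
have h2 : G (n - k.+1)%N <= (1 + e') * G (n - k)%N.
  have -> : (n - k)%N = (n - k.+1).+1 by lia.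
  by apply: hN2 => /=; lia.
have g0 := Gpos n.
apply: (le_trans h2).
apply: (@le_trans _ _ ((1 + e') * ((1 + e') * G n))); first by apply: ler_wpM2l; lra.
by rewrite mulrA; apply: ler_wpM2r; [lra|nra].
Unshelve. all: by end_near. Qed.

(** The first k terms already amount to at least (1 - G k) * G n out of (1 + e) * G n. *)
Lemma lattice_conv_tail e k : 0 < e -> \forall n \near \oo,
  \sum_(k <= j < n) (G j - G j.+1) * G (n - j)%N <= (e + G k) * G n.
Proof.
move=> e0; have [N _ hN] := Gconv e0.
exists (N + k)%N => // n /= hn.
have := hN n; rewrite /= => /(_ ltac:(lia)).
rewrite -(big_mkord xpredT (fun j => (G j - G j.+1) * G (n - j)%N)).
rewrite (@big_cat_nat _ _ _ k) //=; last by lia.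
have : (1 - G k) * G n <= \sum_(0 <= j < k) (G j - G j.+1) * G (n - j)%N.
  rewrite big_mkord -psum_lattice_diff /psum mulr_suml; apply: ler_sum => j _.
  by apply: ler_wpM2l; [exact: lattice_diff_ge0|apply: Gm; lia].
lra.
Qed.

(** After division by G, long-tailedness turns the recursion into a contraction of ratio r * (1 +
    dl); [dl] keeps this ratio below 1 and moves the fixed point by at most e / 2. *)
Lemma lattice_contraction_limsup (r b e : R) (x y : nat -> R) :
  0 <= r -> r < 1 -> 0 <= b -> 0 < e -> (forall n, 0 <= x n) ->
  (\forall n \near \oo, x n.+1 <= r * x n + (1 - r) * y n) ->
  (\forall n \near \oo, y n <= b * G n.+1) ->
  \forall n \near \oo, x n <= (b + e) * G n.
Proof.
move=> r0 r1 b0 e0 x0 hx hy.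
have be : 0 < b + e / 2 by lra.
pose dl := (1 - r) * (e / 2) / (b + e / 2).
have dl0 : 0 < dl by rewrite /dl divr_gt0 // mulr_gt0; lra.
have dlE : dl * (b + e / 2) = (1 - r) * (e / 2) by rewrite /dl divfK //; lra.
have dl1 : dl <= 1 - r.
  by rewrite /dl ler_pdivrMr //; apply: ler_wpM2l; lra.
pose r' := r * (1 + dl).
have r'0 : 0 <= r' by apply: mulr_ge0; lra.
have r'1 : r' < 1 by rewrite /r'; nra.
have e20 : 0 < e / 2 by lra.
have hb : (1 - r) * b <= (1 - r') * (b + e / 2).
  have -> : 1 - r' = (1 - r) - r * dl by rewrite /r'; lra.
  have : r * (dl * (b + e / 2)) <= 1 * ((1 - r) * (e / 2)).
    by rewrite dlE; apply: ler_wpM2r; [apply: mulr_ge0; lra|lra].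
  lra.
have key : \forall n \near \oo, x n.+1 / G n.+1 <= r' * (x n / G n) + (1 - r') * (b + e / 2).
  near=> n.
  have h1 : x n.+1 <= r * x n + (1 - r) * y n by near: n.
  have h2 : y n <= b * G n.+1 by near: n.
  have h3 : G n <= (1 + dl) * G n.+1 by near: n; exact: lattice_long_tail1.
  have g0 := Gpos n; have g1 := Gpos n.+1.
  rewrite ler_pdivrMr // mulrDl.
  apply: (le_trans h1); apply: lerD.
    set z := x n / G n; have z0 : 0 <= z by apply: divr_ge0; [exact: x0|exact: ltW].
    have -> : x n = z * G n by rewrite /z divfK // lt0r_neq0.
    have : r * (z * G n) <= r * (z * ((1 + dl) * G n.+1)) by do 2!apply: ler_wpM2l => //.
    by rewrite /r'; lra.
  apply: (@le_trans _ _ ((1 - r) * b * G n.+1)).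
    by rewrite -mulrA; apply: ler_wpM2l => //; lra.
  by apply: ler_wpM2r => //; lra.
have := contraction_limsup r'0 r'1 e20 key.
apply: filterS => n; rewrite ler_pdivrMr //.
have -> // : b + e / 2 + e / 2 = b + e by lra.
Unshelve. all: by end_near. Qed.

End LatticeSubexp.

Section SmoothTail.
Context {R : realType}.
Variables (F : nat -> R) (K : nat) (r c : R).
Hypotheses (F0 : forall n, 0 <= F n) (Fm : forall m n, (m <= n)%N -> F n <= F m).
Hypotheses (r0 : 0 <= r) (r1 : r < 1) (K0 : (0 < K)%N).
Hypothesis Fc : forall n, psum F n <= c.
Local Notation sm := (smooth F K r).

(** Tail sums of a moving average obey the averaging recursion driven by the tail sums of F, so
    smoothing does not change their order. *)
Lemma tsum_smooth_rec n : (K <= n)%N ->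
  tsum sm n.+1 <= r * tsum sm n + (1 - r) * tsum F n.+1.
Proof.
move=> Kn.
have smb := psum_smooth_le F0 r0 r1 K0 Fc.
have sm0 := smooth_ge0 K F0 r0 r1.
apply: (tsum_le sm0) => N nN.
have step m : psum sm (n + m).+1 - psum sm n.+1 =
    r * (psum sm (n + m)%N - psum sm n) + (1 - r) * (psum F (n + m).+1 - psum F n.+1).
  elim: m => [|m IH]; first by rewrite addn0; lra.
  rewrite (psumS sm (n + m)) in IH.
  rewrite addnS (psumS sm (n + m).+1) (psumS F (n + m).+1) (psumS sm (n + m)).
  by rewrite smoothS; [lra|lia].
case: N nN => // N nN; have := step (N - n)%N; rewrite subnKC // => ->.
apply: lerD; apply: ler_wpM2l => //; rewrite ?lerD2r.
- exact: psum_total smb N.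
- by rewrite subr_ge0 ltW.
- exact: psum_total Fc N.+1.
Qed.

Variable G : nat -> R.

(** Convolution with G commutes with the averaging recursion, except at the first retained index L,
    which leaves the boundary term with [sm L]. *)
Lemma conv_smooth_rec L n : (K <= L)%N -> (L <= n)%N ->
  \sum_(s < n.+1) (if (s < L)%N then 0 else sm s) * G (n.+1 - s)%N =
  r * (\sum_(s < n) (if (s < L)%N then 0 else sm s) * G (n - s)%N)
  + (sm L * G (n - L.-1)%N + (1 - r) * \sum_(L <= s < n) F s.+1 * G (n - s)%N).
Proof.
move=> KL Ln; have L0 : (0 < L)%N by lia.
rewrite big_ord_recl /= L0 mul0r add0r.
transitivity (\sum_(s < n) ((r * ((if (s < L)%N then 0 else sm s) * G (n - s)%N)
   + (if s == L.-1 :> nat then sm L * G (n - L.-1)%N else 0))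
   + (if (s < L)%N then 0 else (1 - r) * (F s.+1 * G (n - s)%N)))).
  apply: eq_bigr => s _; rewrite /bump leq0n add1n subSS.
  have [sL|Ls] := ltnP s.+1 L.
    have -> : (s < L)%N by lia.
    have -> : (s == L.-1 :> nat) = false by lia.
    by rewrite !mul0r mulr0 !addr0.
  have [sE|sN] := eqVneq (s : nat) L.-1.
    have -> : (s < L)%N by lia.
    have -> : s.+1 = L by lia.
    by rewrite !mul0r mulr0 addr0 add0r sE.
  have -> : (s < L)%N = false by lia.
  by rewrite smoothS; [lra|lia].
rewrite !big_split /= -mulr_sumr -addrA; congr (_ + _); congr (_ + _).
  have Ln1 : (L.-1 < n)%N by lia.
  rewrite (bigD1 (Ordinal Ln1)) //= eqxx big1 ?addr0 // => s.
  by rewrite -val_eqE /= => /negbTE ->.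
rewrite -(big_mkord xpredT (fun s => if (s < L)%N then 0 else (1 - r) * (F s.+1 * G (n - s)%N))).
rewrite (@big_cat_nat _ _ _ L) //= big_nat big1 ?add0r.
  rewrite mulr_sumr; apply: eq_big_nat => s /andP[Ls _].
  by rewrite ltnNge Ls.
by move=> s /andP[_ ->].
Qed.

End SmoothTail.

(** * Asymptotics of the supersolution for a subexponential integrated tail *)

Section SubexpSupersolution.
Context {R : realType}.
Variables (G : nat -> R) (C : R) (p : nat).
Hypotheses (G1 : G 0%N = 1) (Gpos : forall n, 0 < G n).
Hypothesis Gm : forall m n, (m <= n)%N -> G n <= G m.
Hypothesis Gd : forall m n, (m <= n)%N -> G n - G n.+1 <= G m - G m.+1.
Hypothesis Gsmall : forall e : R, 0 < e -> \forall n \near \oo, G n <= e.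
Hypothesis Gconv : forall e : R, 0 < e ->
  \forall n \near \oo, \sum_(j < n) (G j - G j.+1) * G (n - j)%N <= (1 + e) * G n.
Hypothesis C0 : 0 <= C.

(* The subtractions are truncated: the sequence is constant up to p.+1, hence still nonincreasing. *)
Definition shifted_diff s := C * (G (s - p.+1)%N - G (s - p.+1).+1).
Local Notation F := shifted_diff.

Lemma shifted_diff_ge0 s : 0 <= F s.
Proof. by apply: mulr_ge0 => //; exact: lattice_diff_ge0. Qed.

Lemma shifted_diff_noninc m n : (m <= n)%N -> F n <= F m.
Proof. by move=> mn; apply: ler_wpM2l => //; apply: Gd; lia. Qed.

Lemma psum_shifted_diff n :
  psum F n = C * ((minn n p.+1)%:R * (1 - G 1%N) + (1 - G (n - p.+1)%N)).
Proof.
elim: n => [|n IH]; first by rewrite psum0 min0n sub0n G1 subrr mul0r add0r mulr0.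
rewrite psumS IH /shifted_diff; have [np|pn] := ltnP n p.+1.
  rewrite (minn_idPl np) -natr1.
  have -> : (n - p.+1 = 0)%N by lia.
  have -> : (n.+1 - p.+1 = 0)%N by lia.
  rewrite G1; lra.
rewrite (minn_idPr (leqW pn)) subSn //; lra.
Qed.

Lemma psum_shifted_diff_le n : psum F n <= C * (p.+1%:R + 1).
Proof.
rewrite psum_shifted_diff; apply: ler_wpM2l => //.
have h1 : (minn n p.+1)%:R <= p.+1%:R :> R by rewrite ler_nat geq_minr.
have h2 : 0 <= (minn n p.+1)%:R :> R by [].
have := Gpos 1; have := Gpos (n - p.+1); nra.
Qed.

Lemma tsum_shifted_diff_le n : (p < n)%N -> tsum F n <= C * G (n - p.+1).
Proof.
move=> pn; apply: (tsum_le shifted_diff_ge0) => N nN.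
rewrite !psum_shifted_diff !(minn_idPr _) //; last by lia.
have : 0 <= C * G (N - p.+1) by apply: mulr_ge0 => //; exact: ltW.
lra.
Qed.

Section Scale.
Variables (K : nat) (r : R).
Hypotheses (r0 : 0 <= r) (r1 : r < 1) (K0 : (0 < K)%N).
Local Notation sm := (smooth F K r).

Lemma tsum_smooth_lattice e : 0 < e -> \forall n \near \oo, tsum sm n <= (C + e) * G n.
Proof.
move=> e0.
have e20 : 0 < e / 2 by lra.
have d0 : 0 < e / 2 / (C + 1) by apply: divr_gt0 => //; move: C0; lra.
have -> : C + e = (C + e / 2) + e / 2 by lra.
apply: (@lattice_contraction_limsup _ _ G1 Gpos Gm Gsmall Gconv r (C + e / 2) (e / 2) _
   (fun n => tsum F n.+1)) => //.
- by move: C0; lra.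
- move=> n; exact: (tsum_ge0 (psum_smooth_le shifted_diff_ge0 r0 r1 K0 psum_shifted_diff_le) n).
- exists K => // n /= Kn; exact: tsum_smooth_rec shifted_diff_ge0 r0 r1 K0 psum_shifted_diff_le _ _.
- have [N _ hN] := lattice_long_tail G1 Gpos Gm Gsmall Gconv p.+1 d0.
  exists (N + p.+1)%N => // n /= hn.
  apply: le_trans (tsum_shifted_diff_le _) _; first by lia.
  have := hN n.+1 => /= /(_ ltac:(lia)) h.
  apply: (@le_trans _ _ (C * ((1 + e / 2 / (C + 1)) * G n.+1))); first exact: ler_wpM2l.
  rewrite mulrA; apply: ler_wpM2r; first exact: ltW.
  rewrite mulrDr mulr1 lerD2l mulrCA ger_pMr // ler_pdivrMr; move: C0; lra.
Qed.

(** The factors 2 are crude long-tail constants. What matters is that the coefficient of G n becomes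
    small for large L: far steps contribute little to the convolution. *)
Lemma conv_smooth_lattice L e : (K <= L)%N -> (p < L)%N -> 0 < e ->
  \forall n \near \oo, \sum_(s < n) (if (s < L)%N then 0 else sm s) * G (n - s)%N
     <= (2 * (sm L / (1 - r)) + 2 * C * G (L - p)%N + e) * G n.
Proof.
move=> KL pL e0.
have sm0 := smooth_ge0 K shifted_diff_ge0 r0 r1.
have r1' : 0 < 1 - r by rewrite subr_gt0.
have C0' := C0.
have e20 : 0 < e / 2 by lra.
pose d := e / 2 / (2 * C + 1).
have d0 : 0 < d by apply: divr_gt0 => //; lra.
have dE : 2 * C * d <= e / 2.
  by rewrite /d mulrCA ger_pMr // ler_pdivrMr; lra.
have -> : 2 * (sm L / (1 - r)) + 2 * C * G (L - p)%N + e =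
   (2 * (sm L / (1 - r)) + 2 * C * G (L - p)%N + e / 2) + e / 2 by lra.
have smL0 : 0 <= sm L / (1 - r) by apply: divr_ge0 => //; exact: ltW.
have gL := Gpos (L - p).
have CG0 : 0 <= C * G (L - p)%N by apply: mulr_ge0 => //; exact: ltW.
apply: (@lattice_contraction_limsup _ _ G1 Gpos Gm Gsmall Gconv r _ (e / 2) _
   (fun n => sm L / (1 - r) * G (n - L.-1)%N + \sum_(L <= s < n) F s.+1 * G (n - s)%N)) => //.
- by lra.
- move=> n; apply: sumr_ge0 => s _; case: ifP => _; first by rewrite mul0r.
  by apply: mulr_ge0 => //; exact: ltW.
- exists L => // n /= Ln; rewrite conv_smooth_rec // lerD2l mulrDr.
  by rewrite [(1 - r) * (_ * _)]mulrA [(1 - r) * (_ / _)]mulrC divfK // lt0r_neq0.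
have [N1 _ hN1] := lattice_long_tail G1 Gpos Gm Gsmall Gconv L (@ltr01 R).
have [N2 _ hN2] := lattice_long_tail G1 Gpos Gm Gsmall Gconv p.+1 (@ltr01 R).
have [N3 _ hN3] := lattice_conv_tail G1 Gm Gconv (L - p) d0.
exists (N1 + N2 + N3 + L + p)%N => // n /= hn.
have h1 : G (n - L.-1)%N <= 2 * G n.+1.
  have n1 : (N1 <= n.+1)%N by move: hn; clear; lia.
  have -> : (n - L.-1 = n.+1 - L)%N by move: hn K0 KL; clear; lia.
  exact: hN1.
have h2 : G (n - p)%N <= 2 * G n.+1.
  have n2 : (N2 <= n.+1)%N by move: hn; clear; lia.
  by rewrite -subSS; exact: hN2.
have h3 : \sum_(L <= s < n) F s.+1 * G (n - s)%N <= C * ((d + G (L - p)%N) * G (n - p)%N).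
  have -> : \sum_(L <= s < n) F s.+1 * G (n - s)%N =
      C * \sum_(L - p <= j < n - p) (G j - G j.+1) * G (n - p - j)%N.
    rewrite -{1}(subnK (ltnW pL)) big_addn mulr_sumr; apply: eq_big_nat => s _.
    rewrite /shifted_diff subSS addnK -mulrA.
    by rewrite addnC subnDA.
  apply: ler_wpM2l => //; apply: hN3 => /=; move: hn; clear; lia.
have g1 := Gpos n.+1.
have h4 : sm L / (1 - r) * G (n - L.-1)%N <= sm L / (1 - r) * (2 * G n.+1) by exact: ler_wpM2l.
have h5 : C * ((d + G (L - p)%N) * G (n - p)%N) <= C * ((d + G (L - p)%N) * (2 * G n.+1)).
  by apply: ler_wpM2l => //; apply: ler_wpM2l => //; lra.
have h6 : 2 * C * d * G n.+1 <= e / 2 * G n.+1 by apply: ler_wpM2r => //; exact: ltW.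
lra.
Qed.

(** A long-tailed G decays more slowly than any geometric sequence: the contraction lemma with zero
    source. *)
Lemma geometric_lattice e : 0 < e -> \forall n \near \oo, r ^+ n <= e * G n.
Proof.
move=> e0; rewrite -[e]add0r.
apply: (@lattice_contraction_limsup _ _ G1 Gpos Gm Gsmall Gconv r 0 e _ (fun=> 0)) => //.
- by move=> n; exact: exprn_ge0.
- by exists 0%N => // n _ /=; rewrite exprS mulr0 addr0.
- by exists 0%N => // n _ /=; rewrite mul0r.
Qed.

End Scale.

Variables (K : nat) (r alpha e : R).
Hypotheses (r0 : 0 < r) (r1 : r < 1) (K0 : (0 < K)%N) (pK : (p < K)%N).
Hypotheses (alpha0 : 0 < alpha) (e0 : 0 < e) (e1 : e <= 1 / 2).
Hypothesis mass : F K / (1 - r) + tsum F K.+1 <= alpha * e.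
Hypothesis small_conv : 2 * (F K / (1 - r)) + 2 * C * G (K - p)%N < alpha * e.
Local Notation h := (super_tail F K r alpha).
Local Notation f := (fun s => smooth F K r s / alpha).

Let S := (1 - e)^-1.

Let e1' : e < 1. Proof. by move: e0 e1; lra. Qed.
Let hrec := super_tail_rec shifted_diff_ge0 psum_shifted_diff_le r0 r1 K0 alpha0 (ltW e0) e1' mass.
Let h0 := super_tail_ge0 shifted_diff_ge0 psum_shifted_diff_le r0 r1 K0 alpha0 (ltW e0) e1' mass.
Let hm := super_tail_noninc shifted_diff_ge0 r0 r1 K0 alpha0 (ltW e0) e1' mass.
Let hS : forall n, h n <= S.
Proof.
move=> n; apply: le_trans (hm (leq0n n)) _.
exact: super_tail0_le shifted_diff_ge0 psum_shifted_diff_le r0 r1 K0 alpha0 (ltW e0) e1' mass.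
Qed.

Let f0 s : 0 <= f s.
Proof.
apply: divr_ge0; last exact: ltW.
exact: smooth_ge0 shifted_diff_ge0 (ltW r0) r1 _.
Qed.

Let S0 : 0 < S. Proof. by rewrite /S invr_gt0; move: e0 e1; lra. Qed.

Let tsumf d : 0 < d -> \forall n \near \oo, tsum f n <= (C / alpha + d) * G n.
Proof.
move=> d0; have ad0 : 0 < alpha * d by exact: mulr_gt0.
have [N _ hN] := tsum_smooth_lattice (ltW r0) r1 K0 ad0.
exists N => // n /= nN; apply: (tsum_le f0) => M nM.
have fE k : psum f k = psum (smooth F K r) k / alpha by rewrite /psum mulr_suml.
rewrite !fE -mulrBl ler_pdivrMr //.
apply: le_trans (_ : tsum (smooth F K r) n <= _).
  by rewrite lerD2r (psum_total (psum_smooth_le shifted_diff_ge0 (ltW r0) r1 K0 psum_shifted_diff_le)).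
apply: le_trans (hN n nN) _.
have Ea : C / alpha * alpha = C by rewrite divfK // lt0r_neq0.
by rewrite -{1}Ea; set x := C / alpha; lra.
Qed.

Let convf L d : (K <= L)%N -> 0 < d ->
   2 * (smooth F K r L / (1 - r)) + 2 * C * G (L - p)%N < alpha * d ->
   \forall n \near \oo, \sum_(s < n) (if (s < L)%N then 0 else f s) * G (n - s)%N <= d * G n.
Proof.
move=> KL d0; rewrite -subr_gt0 => hd.
have pL : (p < L)%N by lia.
have := conv_smooth_lattice (ltW r0) r1 K0 KL pL hd.
apply: filterS => n; rewrite addrC subrK => hn.
have -> : \sum_(s < n) (if (s < L)%N then 0 else f s) * G (n - s)%N =
  (\sum_(s < n) (if (s < L)%N then 0 else smooth F K r s) * G (n - s)%N) / alpha.
  rewrite mulr_suml; apply: eq_bigr => s _.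
  by case: ifP => _; rewrite ?mul0r // mulrAC.
by rewrite ler_pdivrMr // mulrC mulrA.
Qed.

Let convK : \forall n \near \oo, \sum_(s < n) f s * G (n - s)%N <= e * G n.
Proof.
have := @convf K e (leqnn K) e0; rewrite smoothK => /(_ small_conv).
apply: filterS => n; apply: le_trans; apply: ler_sum => s _.
apply: ler_wpM2r; first exact: ltW.
by case: ifP => // sK; rewrite smooth_lt // mul0r.
Qed.

(** Strong induction: since e <= 1 / 2 the convolution returns at most half of M, and [c2], at most
    M / 2, covers the other terms. The summand S / G N settles n <= N. *)
Let crude : exists M, 0 <= M /\ forall n, h n <= M * G n.
Proof.
have [N1 _ hN1] := convK.
have [N2 _ hN2] := tsumf (@ltr01 R).
have [N3 _ hN3] := geometric_lattice (ltW r0) r1 (@ltr01 R).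
pose N := (N1 + N2 + N3)%N.
have gN := Gpos N.
pose c2 := 1 + S * (C / alpha + 1).
have Ca : 0 <= C / alpha by apply: divr_ge0 => //; exact: ltW.
have c20 : 0 <= c2.
  by have : 0 <= S * (C / alpha + 1) by [apply: mulr_ge0; [exact: ltW|lra]]; rewrite /c2; lra.
pose M := S / G N + 2 * c2.
have SG0 : 0 <= S / G N by apply: divr_ge0; exact: ltW.
have M0 : 0 <= M by rewrite /M; lra.
exists M; split=> //; elim/ltn_ind=> n IH.
have gn := Gpos n.
have [nN|hn] := leqP n N.
  apply: le_trans (hS n) _.
  have : S / G N * G N <= S / G N * G n by apply: ler_wpM2l => //; exact: Gm.
  rewrite divfK ?lt0r_neq0 // => hh.
  have : 0 <= 2 * c2 * G n by apply: mulr_ge0; lra.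
  rewrite /M; lra.
rewrite /N in hn.
have i1 : \sum_(s < n) f s * G (n - s)%N <= e * G n by apply: hN1 => /=; move: hn; clear; lia.
have i2 : tsum f n <= (C / alpha + 1) * G n by apply: hN2 => /=; move: hn; clear; lia.
have i3 : r ^+ n <= 1 * G n by apply: hN3 => /=; move: hn; clear; lia.
have i4 : \sum_(s < n) f s * h (n - s)%N <= M * \sum_(s < n) f s * G (n - s)%N.
  rewrite mulr_sumr; apply: ler_sum => s _; rewrite mulrCA.
  have [s0|s0] := posnP s; first by rewrite smooth_lt ?s0 // !mul0r.
  by apply: ler_wpM2l => //; apply: IH; move: (ltn_ord s) s0; clear; lia.
have i5 := hrec n; rewrite -/S in i5.
have i6 : S * tsum f n <= S * ((C / alpha + 1) * G n) by apply: ler_wpM2l => //; exact: ltW.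
have i7 : M * (\sum_(s < n) f s * G (n - s)%N) <= M * (e * G n) by exact: ler_wpM2l.
have i8 : M * (e * G n) <= M * (1 / 2 * G n).
  by apply: ler_wpM2l => //; apply: ler_wpM2r => //; exact: ltW.
have i9 : c2 * G n <= M / 2 * G n.
  by apply: ler_wpM2r; [exact: ltW|rewrite /M; lra].
by move: i9; rewrite /c2; lra.
Qed.

(** For s < L the index n - s is still large and the constant M' applies. For s >= L only the crude
    constant M is available, but L is so large that this part is negligible. *)
Let bootstrap M' d : 0 <= M' -> 0 < d ->
  (\forall n \near \oo, h n <= M' * G n) ->
  \forall n \near \oo, h n <= (e * M' + S * (C / alpha) + d) * G n.
Proof.
move=> M'0 d0 [N0 _ hN0].
have [M [M0 hM]] := crude.
have d30 : 0 < d / 3 by lra.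
have d3S : 0 < d / 3 / S by exact: divr_gt0.
have d3M : 0 < d / 3 / (M + 1) by apply: divr_gt0 => //; lra.
have r1' : 0 < 1 - r by rewrite subr_gt0.
have C0' := C0.
have [L [KL hL]] : exists L, (K <= L)%N /\
    2 * (smooth F K r L / (1 - r)) + 2 * C * G (L - p)%N < alpha * (d / 3 / (M + 1)).
  set w := alpha * _.
  have w0 : 0 < w by exact: mulr_gt0.
  have sm0 := smooth_ge0 K shifted_diff_ge0 (ltW r0) r1.
  have smb := psum_smooth_le shifted_diff_ge0 (ltW r0) r1 K0 psum_shifted_diff_le.
  have x1 : 0 < w / 8 * (1 - r) by apply: mulr_gt0 => //; lra.
  have x2 : 0 < w / 4 / (C + 1) by apply: divr_gt0; lra.
  have [n1 _ hn1] := tsum_small sm0 smb x1.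
  have [n2 _ hn2] := Gsmall x2.
  exists (K + n1 + n2 + p)%N; split; first by clear; lia.
  set L := (K + n1 + n2 + p)%N.
  have y1 : smooth F K r L / (1 - r) <= w / 8.
    rewrite ler_pdivrMr //; apply: le_trans (hn1 L _); last by rewrite /=; clear; lia.
    by rewrite (tsumS (smooth F K r)) lerDl; exact: tsum_ge0 smb _.
  have y2 : G (L - p)%N <= w / 4 / (C + 1) by apply: hn2 => /=; clear; lia.
  have y3 : C * G (L - p)%N <= C * (w / 4 / (C + 1)) by exact: ler_wpM2l.
  have y4 : C * (w / 4 / (C + 1)) <= w / 4.
    by rewrite mulrCA ger_pMr; [rewrite ler_pdivrMr; lra|lra].
  lra.
have [N1 _ hN1] := convK.
have [N2 _ hN2] := tsumf d3S.
have [N3 _ hN3] := geometric_lattice (ltW r0) r1 d30.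
have [N4 _ hN4] := convf KL d3M hL.
exists (N0 + N1 + N2 + N3 + N4 + L)%N => // n /= hn.
have gn := Gpos n.
have i1 : \sum_(s < n) f s * G (n - s)%N <= e * G n by apply: hN1 => /=; move: hn; clear; lia.
have i2 : tsum f n <= (C / alpha + d / 3 / S) * G n by apply: hN2 => /=; move: hn; clear; lia.
have i3 : r ^+ n <= d / 3 * G n by apply: hN3 => /=; move: hn; clear; lia.
have i4 : \sum_(s < n) (if (s < L)%N then 0 else f s) * G (n - s)%N
    <= d / 3 / (M + 1) * G n by apply: hN4 => /=; move: hn; clear; lia.
have i5 := hrec n; rewrite -/S in i5.
have i6 : \sum_(s < n) f s * h (n - s)%N <=
    M' * (\sum_(s < n) f s * G (n - s)%N)
    + M * \sum_(s < n) (if (s < L)%N then 0 else f s) * G (n - s)%N.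
  rewrite !mulr_sumr -big_split /=; apply: ler_sum => s _.
  have gs := Gpos (n - s); have fs := f0 s.
  have fg : 0 <= f s * G (n - s)%N by apply: mulr_ge0 => //; exact: ltW.
  rewrite /= in fs fg.
  have [sL|Ls] := ltnP s L.
    rewrite mul0r mulr0 addr0 mulrCA; apply: ler_wpM2l => //.
    by apply: hN0 => /=; move: hn sL; clear; lia.
  apply: ler_wpDl; first exact: mulr_ge0.
  by rewrite mulrCA; apply: ler_wpM2l.
have i7 : M' * (\sum_(s < n) f s * G (n - s)%N) <= M' * (e * G n) by exact: ler_wpM2l.
have i8 : M * (\sum_(s < n) (if (s < L)%N then 0 else f s) * G (n - s)%N)
    <= M * (d / 3 / (M + 1) * G n) by exact: ler_wpM2l.
have i9 : M * (d / 3 / (M + 1) * G n) <= d / 3 * G n.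
  rewrite mulrA; apply: ler_wpM2r; first exact: ltW.
  by rewrite mulrCA ger_pMr // ler_pdivrMr; lra.
have i10 : S * tsum f n <= S * ((C / alpha + d / 3 / S) * G n).
  by apply: ler_wpM2l => //; exact: ltW.
have i11 : S * ((C / alpha + d / 3 / S) * G n) = (S * (C / alpha) + d / 3) * G n.
  rewrite mulrA mulrDr; congr ((_ + _) * _).
  by rewrite mulrC divfK // lt0r_neq0.
lra.
Qed.

(** [bootstrap] is iterated: the map M' -> e * M' + b contracts to b / (1 - e) = b * S, which is the
    claimed constant up to d / 2. *)
Lemma super_tail_lattice d : 0 < d ->
  \forall n \near \oo, h n <= (C / alpha * S ^+ 2 + d) * G n.
Proof.
move=> d0.
have [M [M0 hM]] := crude.
have Ca : 0 <= C / alpha by apply: divr_ge0 => //; exact: ltW.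
have SC0 : 0 <= S * (C / alpha) by apply: mulr_ge0 => //; exact: ltW.
have e1e := e1'; have e00 := e0.
have d20 : 0 < d / 2 by lra.
pose dd := d / 2 * (1 - e).
have dd0 : 0 < dd by apply: mulr_gt0 => //; lra.
pose b := S * (C / alpha) + dd.
have b0 : 0 <= b by rewrite /b; lra.
have bS : b * S = C / alpha * S ^+ 2 + d / 2.
  rewrite /b mulrDl expr2 /dd -[_ * (1 - e) * S]mulrA mulfV; last by lra.
  lra.
have iter k : \forall n \near \oo, h n <= (e ^+ k * M + b * S) * G n.
  elim: k => [|k IH].
    exists 0%N => // n _; rewrite expr0 mul1r; apply: le_trans (hM n) _.
    apply: ler_wpM2r; first exact: ltW.
    by rewrite lerDl; apply: mulr_ge0 => //; exact: ltW.
  have q0 : 0 <= e ^+ k * M + b * S.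
    apply: addr_ge0; first by apply: mulr_ge0 => //; apply: exprn_ge0; lra.
    by apply: mulr_ge0 => //; exact: ltW.
  have := bootstrap q0 dd0 IH; apply: filterS => n; congr (_ <= _ * _).
  rewrite -addrA -/b mulrDr exprS -!mulrA -addrA; congr (_ + _).
  have bE : b = b * S * (1 - e) by rewrite /S divfK //; lra.
  rewrite [X in _ + X]bE; lra.
have [k _ hk] := geometric_small M (ltW e0) e1' d20.
have := iter k; apply: filterS => n hn; apply: le_trans hn _.
apply: ler_wpM2r; first exact: ltW.
have := hk k (leqnn k); rewrite bS mulrC; lra.
Qed.

End SubexpSupersolution.

(** * Choice of the scale K and the ratio r *)

Section SupersolutionExistence.
Context {R : realType}.

Lemma scale_mass (F : nat -> R) (c e w : R) :
  (forall n, 0 <= F n) -> (forall m n, (m <= n)%N -> F n <= F m) ->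
  (forall n, psum F n <= c) -> 0 < e -> e < 1 -> 0 < w ->
  \forall K \near \oo, [/\ (0 < K)%N, 0 < 1 - e / K%:R, 1 - e / K%:R < 1,
     F K / (1 - (1 - e / K%:R)) <= w & tsum F K <= w].
Proof.
move=> F0 Fm Fc e0 e1 w0.
have we0 : 0 < w * e by exact: mulr_gt0.
have [N1 _ hN1] := noninc_summable_small F0 Fm Fc we0.
have [N2 _ hN2] := tsum_small F0 Fc w0.
exists (N1 + N2).+1 => // K /= hK.
have K0 : (0 < K)%N by move: hK; clear; lia.
have KR0 : 0 < K%:R :> R by rewrite ltr0n.
have K1 : 1 <= K%:R :> R by rewrite ler1n.
have eK0 : 0 < e / K%:R by exact: divr_gt0.
split => //.
- by rewrite subr_gt0 ltr_pdivrMr // mul1r; lra.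
- by lra.
(* As 1 - r = e / K, the quotient equals K * F K / e. *)
- rewrite opprB addrC subrK invf_div mulrA ler_pdivrMr // mulrC.
  by apply: hN1 => /=; move: hK; clear; lia.
- by apply: hN2 => /=; move: hK; clear; lia.
Qed.

(** Bernoulli's inequality gives r ^ K >= 1 - e and r ^- K <= 1 + 2 * e, so distorting the two sums
    costs at most e * c0 and 2 * e * c0. *)
Lemma scale_balance (t u : nat -> R) (c0 a0 e : R) (K : nat) :
  (forall s, 0 <= t s) -> (forall s, 0 <= u s) -> 0 < e -> e <= 1 / 2 -> (0 < K)%N ->
  \sum_(s < K) t s.+1 <= c0 -> \sum_(s < K) u s.+1 <= c0 ->
  a0 <= \sum_(s < K) u s.+1 - \sum_(s < K) t s.+1 ->
  (1 - e / K%:R) ^- K * (\sum_(s < K) t s.+1) + (a0 - 3 * e * c0)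
    <= (1 - e / K%:R) ^+ K * \sum_(s < K) u s.+1.
Proof.
move=> t0 u0 e0 e1 K0; set t1 := \sum_(s < K) _; set u1 := \sum_(s < K) _ => tc uc ha.
have t10 : 0 <= t1 by apply: sumr_ge0.
have u10 : 0 <= u1 by apply: sumr_ge0.
have KR0 : 0 < K%:R :> R by rewrite ltr0n.
have K1 : 1 <= K%:R :> R by rewrite ler1n.
have eK0 : 0 <= e / K%:R by apply: divr_ge0; exact: ltW.
have eK1 : e / K%:R <= 1 by rewrite ler_pdivrMr //; lra.
set r := 1 - e / K%:R.
have hr : 1 - e <= r ^+ K.
  by have := bernoulli K eK0 eK1; rewrite mulrCA mulfV ?mulr1 // lt0r_neq0.
have rK0 : 0 < r ^+ K by lra.
have hri : r ^- K <= 1 + 2 * e.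
  rewrite -[leLHS]mul1r ler_pdivrMr //.
  have : (1 + 2 * e) * (1 - e) <= (1 + 2 * e) * r ^+ K by apply: ler_wpM2l; lra.
  have : e * e <= e * (1 / 2) by apply: ler_wpM2l; lra.
  lra.
have h1 : r ^- K * t1 <= (1 + 2 * e) * t1 by exact: ler_wpM2r.
have h2 : (1 - e) * u1 <= r ^+ K * u1 by exact: ler_wpM2r.
have h3 : e * t1 <= e * c0 by apply: ler_wpM2l => //; exact: ltW.
have h4 : e * u1 <= e * c0 by apply: ler_wpM2l => //; exact: ltW.
lra.
Qed.

(** Here t dominates itself, in the role of F. A supersolution tending to 0 suffices for tightness
    of the supremum, and it requires only summability and negative drift. *)
Lemma tight_supersol (t u : nat -> R) (c0 a0 : R) :
  (forall s, 0 <= t s) -> (forall m n, (m <= n)%N -> t n <= t m) ->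
  (forall n, psum t n <= c0) -> (forall s, 0 <= u s) ->
  (forall n, \sum_(s < n) u s.+1 <= c0) -> 0 < a0 ->
  (\forall K \near \oo, a0 <= \sum_(s < K) u s.+1 - \sum_(s < K) t s.+1) ->
  exists K h, supersol t u K h /\ forall e : R, 0 < e -> \forall n \near \oo, h n <= e.
Proof.
move=> t0 tm tc u0 uc a00 ha.
have c00 : 0 <= c0 by rewrite -(psum0 t).
have tc' n : \sum_(s < n) t s.+1 <= c0.
  by apply: le_trans (tc n.+1); rewrite /psum big_ord_recl lerDr.
(* The second bound makes 3 * e * c0 at most a0 / 2, so that [alpha] is positive. *)
pose e := Num.min (1 / 4) (a0 / (6 * c0 + 2)).
have ca0 : 0 < a0 / (6 * c0 + 2) by apply: divr_gt0; lra.
have e0 : 0 < e by rewrite lt_min ca0 andbT; lra.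
have e4 : e <= 1 / 4 by rewrite ge_min lexx.
have ea : e * (6 * c0 + 2) <= a0 by rewrite -ler_pdivlMr ?ge_min ?lexx ?orbT //; lra.
pose alpha := a0 - 3 * e * c0.
have alpha0 : 0 < alpha by rewrite /alpha; lra.
have w0 : 0 < alpha * e / 2 by apply: divr_gt0 => //; exact: mulr_gt0.
have e1 : e < 1 by lra.
have [N1 _ hN1] := scale_mass t0 tm tc e0 e1 w0.
have [N2 _ hN2] := ha.
pose K := (N1 + N2)%N.
have [|K0 r0 r1 m1 m2] := hN1 K; first by rewrite /K /=; clear; lia.
have haK : a0 <= \sum_(s < K) u s.+1 - \sum_(s < K) t s.+1.
  by apply: hN2; rewrite /K /=; clear; lia.
set r := 1 - e / K%:R in r0 r1 m1.
have mass : t K / (1 - r) + tsum t K.+1 <= alpha * e.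
  have := @tsum_noninc _ t t0 _ _ (leqnSn K); lra.
exists K, (super_tail t K r alpha); split.
  apply: (super_tail_supersol t0 tc r0 r1 K0 alpha0 (ltW e0) e1 mass tm t0 u0) => //.
  by apply: scale_balance => //; lra.
move=> d d0; exact: super_tail_small t0 tc r0 r1 K0 alpha0 (ltW e0) e1 mass _ d0.
Qed.

Lemma subexp_supersol (G t u : nat -> R) (p : nat) (C c0 a0 b : R) :
  lattice_subexp G -> 0 <= C ->
  (forall s, 0 <= t s) -> (forall n, psum t n <= c0) -> (forall s, 0 <= u s) ->
  (forall n, \sum_(s < n) u s.+1 <= c0) -> 0 < a0 ->
  (\forall K \near \oo, a0 <= \sum_(s < K) u s.+1 - \sum_(s < K) t s.+1) ->
  (\forall s \near \oo, t s <= shifted_diff G C p s) ->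
  C < b * a0 ->
  exists K h, supersol t u K h /\ \forall n \near \oo, h n <= b * G n.
Proof.
move=> [G1 Gpos Gd1 Gsmall Gconv] C0 t0 tc u0 uc a00 ha htF Cb.
have Gd m n : (m <= n)%N -> G n - G n.+1 <= G m - G m.+1.
  by move=> /subnK <-; elim: (n - m)%N => // k IH; apply: le_trans (Gd1 _) IH.
(* A convex sequence that increases once keeps increasing at least as fast, and cannot tend to 0. *)
have Gm m n : (m <= n)%N -> G n <= G m.
  move=> mn; have step k : G k.+1 <= G k.
    rewrite leNgt; apply/negP => hk.
    have [N _ hN] := Gsmall _ (Gpos k).
    have : G (k + N).+1 - G k >= (N.+1)%:R * (G k.+1 - G k).
      elim: (N) => [|j IH]; first by rewrite addn0 mul1r.
      have : G (k + j).+1 - G (k + j).+2 <= G k - G k.+1.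
        by have := @Gd k (k + j).+1; apply; clear; lia.
      by rewrite addnS -natr1 mulrDl mul1r; lra.
    have : G (k + N).+1 <= G k by apply: hN => /=; clear; lia.
    have : 0 < N.+1%:R * (G k.+1 - G k) by apply: mulr_gt0; [rewrite ltr0n|lra].
    lra.
  by rewrite -(subnK mn); elim: (n - m)%N => // k IH; exact: le_trans (step _) IH.
have F0 := shifted_diff_ge0 p Gm C0.
have Fm := shifted_diff_noninc p Gd C0.
have Fc := psum_shifted_diff_le p G1 Gpos C0.
have c00 : 0 <= c0 by rewrite -(psum0 t).
have tc' n : \sum_(s < n) t s.+1 <= c0.
  by apply: le_trans (tc n.+1); rewrite /psum big_ord_recl lerDr.
have b0 : 0 < b by rewrite -(pmulr_lgt0 _ a00); lra.
(* To first order in e, b * (1 - e) ^ 2 * alpha falls short of b * a0 by e * w; the last bound in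
   the minimum keeps this loss below the gap b * a0 - C. *)
pose w := b * (3 * c0 + 2 * a0).
have w0 : 0 <= w by apply: mulr_ge0; lra.
pose e := Num.min (1 / 4) (Num.min (a0 / (6 * c0 + 2)) ((b * a0 - C) / (2 * w + 2))).
have ca0 : 0 < a0 / (6 * c0 + 2) by apply: divr_gt0; lra.
have cb0 : 0 < (b * a0 - C) / (2 * w + 2) by apply: divr_gt0; lra.
have e0 : 0 < e by rewrite !lt_min ca0 cb0 !andbT; lra.
have e4 : e <= 1 / 4 by rewrite ge_min lexx.
have ea : e * (6 * c0 + 2) <= a0 by rewrite -ler_pdivlMr ?ge_min ?lexx ?orbT //; lra.
have eb : e * (2 * w + 2) <= b * a0 - C.
  by rewrite -ler_pdivlMr ?ge_min ?lexx ?orbT //; lra.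
pose alpha := a0 - 3 * e * c0.
have ec0 : 0 <= e * c0 by apply: mulr_ge0; lra.
have alpha0 : 0 < alpha by rewrite /alpha; lra.
have e1 : e < 1 by lra.
have se0 : 0 < (1 - e) ^+ 2 by apply: exprn_gt0; lra.
have hb : C / alpha * ((1 - e)^-1) ^+ 2 < b.
  rewrite exprVn ltr_pdivrMr // ltr_pdivrMr //.
  have h1 : (1 - e) ^+ 2 >= 1 - 2 * e by rewrite expr2; have := mulr_ge0 (ltW e0) (ltW e0); lra.
  have h2 : b * ((1 - 2 * e) * alpha) <= b * ((1 - e) ^+ 2 * alpha).
    by apply: ler_wpM2l; [lra|apply: ler_wpM2r => //; exact: ltW].
  have h3 : 0 <= b * (e * (e * c0)) by apply: mulr_ge0; [lra|apply: mulr_ge0; lra].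
  by move: eb h2; rewrite /w /alpha; lra.
have ae0 : 0 < alpha * e by exact: mulr_gt0.
have w1 : 0 < alpha * e / 8 by lra.
have w2 : 0 < alpha * e / 8 / (C + 1) by apply: divr_gt0; lra.
have [N1 _ hN1] := scale_mass F0 Fm Fc e0 e1 w1.
have [N2 _ hN2] := ha.
have [N3 _ hN3] := htF.
have [N4 _ hN4] := Gsmall _ w2.
pose K := (N1 + N2 + N3 + N4 + p).+1.
have [|K0 r0 r1 m1 m2] := hN1 K; first by rewrite /K /=; clear; lia.
have haK : a0 <= \sum_(s < K) u s.+1 - \sum_(s < K) t s.+1.
  by apply: hN2; rewrite /K /=; clear; lia.
set r := 1 - e / K%:R in r0 r1 m1.
have mass : shifted_diff G C p K / (1 - r) + tsum (shifted_diff G C p) K.+1 <= alpha * e.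
  have := tsum_noninc F0 (leqnSn K); lra.
have pK : (p < K)%N by rewrite /K; clear; lia.
have sc : 2 * (shifted_diff G C p K / (1 - r)) + 2 * C * G (K - p)%N < alpha * e.
  have h1 : G (K - p)%N <= alpha * e / 8 / (C + 1) by apply: hN4; rewrite /K /=; clear; lia.
  have h2 : C * G (K - p)%N <= C * (alpha * e / 8 / (C + 1)) by exact: ler_wpM2l.
  have h3 : C * (alpha * e / 8 / (C + 1)) <= alpha * e / 8.
    by rewrite mulrCA ger_pMr // ler_pdivrMr; lra.
  lra.
exists K, (super_tail (shifted_diff G C p) K r alpha); split.
  apply: (super_tail_supersol F0 Fc r0 r1 K0 alpha0 (ltW e0) e1 mass Fm t0 u0).
    by move=> s Ks; apply: hN3 => /=; move: Ks; rewrite /K; clear; lia.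
  by apply: scale_balance => //; lra.
have d0 : 0 < b - C / alpha * ((1 - e)^-1) ^+ 2 by rewrite subr_gt0.
have e2 : e <= 1 / 2 by lra.
have := super_tail_lattice G1 Gpos Gm Gsmall Gconv C0 r0 r1 K0 pK alpha0 e0 e2 mass sc d0.
by apply: filterS => n; rewrite addrC subrK.
Qed.

End SupersolutionExistence.

(** * Random walks *)

Section ProbabilityReal.
Context {R : realType} {d : measure_display} {T : measurableType d}.
Variable P : probability T R.
Implicit Types A B : set T.

Lemma EFin_pr A : measurable A -> (pr P A)%:E = P A.
Proof. by move=> mA; rewrite /pr fineK // fin_num_measure. Qed.

Lemma pr_ge0 A : 0 <= pr P A.
Proof. by rewrite /pr fine_ge0. Qed.

Lemma pr_setT : pr P setT = 1.
Proof. by rewrite /pr probability_setT. Qed.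

Lemma le_pr A B : measurable A -> measurable B -> A `<=` B -> pr P A <= pr P B.
Proof.
by move=> mA mB AB; rewrite -lee_fin !EFin_pr // le_measure // inE.
Qed.

Lemma prU_le A B : measurable A -> measurable B -> pr P (A `|` B) <= pr P A + pr P B.
Proof.
move=> mA mB; rewrite -lee_fin EFinD !EFin_pr //; first exact: measureU2.
exact: measurableU.
Qed.

Lemma prDI A B : measurable A -> measurable B -> pr P A = pr P (A `\` B) + pr P (A `&` B).
Proof.
move=> mA mB; apply: EFin_inj; rewrite EFinD !EFin_pr //.
- exact: measureDI.
- exact: measurableI.
- exact: measurableD.
Qed.

Lemma pr_setC A : measurable A -> pr P (~` A) = 1 - pr P A.
Proof.
move=> mA; have := prDI measurableT mA; rewrite setTI setTD pr_setT; lra.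
Qed.

Lemma pr_bigcup_le (A : nat -> set T) c : (forall n, measurable (A n)) ->
  (forall m n, (m <= n)%N -> A m `<=` A n) -> (forall n, pr P (A n) <= c) ->
  pr P (\bigcup_n A n) <= c.
Proof.
move=> mA ndA h.
have mU : measurable (\bigcup_n A n) by exact: bigcupT_measurable.
rewrite -lee_fin EFin_pr //.
have cv := @nondecreasing_cvg_mu _ _ _ P A mA mU _.
have /cv {}cv : nondecreasing_seq A by move=> m n mn; apply/subsetPset; exact: ndA.
rewrite -(cvg_lim _ cv) //; apply: lime_le; first by apply/cvg_ex; eexists; exact: cv.
by near=> n => /=; rewrite -EFin_pr // lee_fin.
Unshelve. all: by end_near. Qed.

Lemma ae_le_pr A B : measurable A -> measurable B ->
  {ae P, forall w, A w -> B w} -> pr P A <= pr P B.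
Proof.
move=> mA mB [N [mN PN hN]].
have h : pr P A <= pr P (B `|` N).
  apply: le_pr => //; first exact: measurableU.
  move=> w Aw; have [Bw|nBw] := pselect (B w); [by left|right].
  by apply: hN => /= /(_ Aw).
apply: le_trans h _; apply: le_trans (prU_le mB mN) _.
by rewrite gerDl /pr PN.
Qed.

Lemma pr_sum_disjoint (F : nat -> set T) N U : (forall n, measurable (F n)) -> measurable U ->
  (forall n, F n `<=` U) -> (forall m n, (m < n)%N -> F m `&` F n = set0) ->
  \sum_(n < N) pr P (F n) <= pr P U.
Proof.
move=> mF mU + dF.
have : forall V, measurable V -> (forall n, (n < N)%N -> F n `<=` V) ->
    \sum_(n < N) pr P (F n) <= pr P V.
  elim: N => [|N IH] V mV FV; first by rewrite big_ord0 pr_ge0.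
  rewrite big_ord_recr /= (prDI mV (mF N)) (setIidr (FV N (ltnSn N))) lerD2r.
  apply: IH; first exact: measurableD.
  move=> n nN w Fw; split; first exact: FV (ltnW nN) _ Fw.
  by move=> FNw; have := dF _ _ nN; rewrite -subset0 => /(_ w); apply.
by move=> h FU; apply: h.
Qed.

End ProbabilityReal.

Section IndependentClasses.
Context {R : realType} {d : measure_display} {T : measurableType d}.
Variables (P : probability T R) (F : nat -> set (set T)).
Hypothesis indepF : mutually_indep P F.
Hypothesis measF : forall i A, F i A -> measurable A.

(** Mutual independence is a product formula for finite intersections with distinct indices.
    Conditioning only on such events avoids extending it to generated sigma-algebras. *)
Definition cylinder_class (I : pred nat) : set (set T) :=
  [set E | exists (s : seq nat) (Ev : nat -> set T),
     [/\ uniq s, all I s, forall i, i \in s -> F i (Ev i)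
       & E = \big[setI/setT]_(i <- s) Ev i]].

Lemma cylinder_setT I : cylinder_class I setT.
Proof. by exists [::], (fun=> setT); split=> //; rewrite big_nil. Qed.

Lemma cylinder_measurable I E : cylinder_class I E -> measurable E.
Proof.
move=> [s [Ev [_ _ h ->]]]; rewrite big_seq.
by elim/big_ind: _ => //; [move=> A B mA mB; exact: measurableI|move=> i /h /measF].
Qed.

Lemma cylinder_setI (I J : pred nat) E k C : cylinder_class I E -> F k C -> ~~ I k ->
  J k -> (forall i, I i -> J i) ->
  cylinder_class J (E `&` C) /\ pr P (E `&` C) = pr P E * pr P C.
Proof.
move=> [s [Ev [us aI h ->]]] FC nIk Jk IJ.
have ks : k \notin s by apply/negP => /(allP aI) Ik; rewrite Ik in nIk.
pose Ev' i := if i == k then C else Ev i.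
have eqEv : \big[setI/setT]_(i <- s) Ev i = \big[setI/setT]_(i <- s) Ev' i.
  rewrite big_seq [RHS]big_seq; apply: eq_bigr => i si.
  by rewrite /Ev'; case: eqP => // ik; rewrite -ik si in ks.
have hk i : i \in k :: s -> F i (Ev' i).
  by rewrite inE /Ev'; case: eqP => [->|_ /= si]; [|exact: h].
have us' : uniq (k :: s) by rewrite /= ks.
have EC : \big[setI/setT]_(i <- s) Ev i `&` C = \big[setI/setT]_(i <- k :: s) Ev' i.
  by rewrite big_cons /Ev' eqxx setIC; congr (_ `&` _); exact: eqEv.
split.
  exists (k :: s), Ev'; split => //=; rewrite Jk /=.
  by apply/allP => i /(allP aI) /IJ.
rewrite EC (indepF us' hk) big_cons {1}/Ev' eqxx mulrC; congr (_ * _).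
by rewrite eqEv indepF // => i si; apply: hk; rewrite inE si orbT.
Qed.

End IndependentClasses.

(** * Hitting probabilities bounded by a supersolution *)

Section Walk.
Context {R : realType} {d : measure_display} {T : measurableType d}.
Variables (P : probability T R) (F : nat -> set (set T)) (Y : nat -> T -> R).
Hypothesis indepF : mutually_indep P F.
Hypothesis measF : forall i A, F i A -> measurable A.
Hypothesis FY : forall k (C : set R), measurable C -> F k (Y k @^-1` C).
Hypothesis mY : forall k, measurable_fun setT (Y k).
Hypothesis lawY : forall k (C : set R), measurable C -> pr P (Y k @^-1` C) = pr P (Y 0%N @^-1` C).

Variable theta : R.
Hypothesis theta0 : 0 < theta.

Definition up_tail (s : nat) : R := pr P [set w | (s%:R - 1) * theta < Y 0%N w].
Definition down_tail (s : nat) : R := pr P [set w | Y 0%N w <= - (s%:R * theta)].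

Definition walk_exceeds (k m : nat) (x : R) : set T :=
  [set w | exists2 j, (j <= m)%N & x < \sum_(k <= i < k + j) Y i w].

Lemma measurable_walk_exceeds k m x : measurable (walk_exceeds k m x).
Proof.
have -> : walk_exceeds k m x =
    \bigcup_(j in [set j | (j <= m)%N]) [set w | x < \sum_(k <= i < k + j) Y i w].
  by apply/seteqP; split => [w [j jm h]|w [j jm h]]; exists j.
apply: bigcup_measurable => j _.
have mS : measurable_fun setT (fun w => \sum_(k <= i < k + j) Y i w).
  by apply: measurable_sum => i; exact: mY.
rewrite -[X in measurable X]setTI.
have := mS measurableT `]x, +oo[%classic (measurable_itv _).
by congr (measurable (_ `&` _)); apply/seteqP; split => w /=; rewrite in_itv /= andbT.
Qed.

Variables (K : nat) (h : nat -> R).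
Hypothesis hsuper : supersol up_tail down_tail K h.

(** Induction on the number of remaining steps. E may use all indices outside the window: those
    before it record the steps already taken, those after it carry events about the future. *)
Lemma walk_supersol m k n E :
  cylinder_class F (fun i => (i < k)%N || (k + m <= i)%N) E ->
  pr P (E `&` walk_exceeds k m (n%:R * theta)) <= pr P E * h n.
Proof.
have [h01 h0 hm hs] := hsuper.
elim: m k n E => [|m IH] k n E FE.
  have -> : E `&` walk_exceeds k 0 (n%:R * theta) = set0.
    rewrite -subset0 => w [_ [j]]; rewrite leqn0 => /eqP ->.
    rewrite addn0 big_geq // ltNge mulr_ge0 //; exact: ltW.
  by rewrite {1}/pr measure0 mulr_ge0 ?pr_ge0.
have mE : measurable E := cylinder_measurable measF FE.
set W := walk_exceeds _ _ _.
have mW : measurable W by exact: measurable_walk_exceeds.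
pose N := (n + K)%N.
(* Increasing events that cut the range of the first step into cells: off [V i], a level of at least
   i.+1 lattice units remains. The last cell contains all steps of - K * theta or less, which is the
   truncation at K. *)
pose V i : set T := if (i < N)%N then [set w | (n%:R - i%:R - 1) * theta < Y k w] else setT.
pose CV i : set R := if (i < N)%N then `](n%:R - i%:R - 1) * theta, +oo[%classic else setT.
have VE i : V i = Y k @^-1` CV i.
  rewrite /V /CV; case: ifP => _ //.
  by apply/seteqP; split => w /=; rewrite in_itv /= andbT.
have mCV i : measurable (CV i) by rewrite /CV; case: ifP => _ //; exact: measurable_itv.
have FV i : F k (V i) by rewrite VE; exact: FY.
have mV i : measurable (V i) by exact: measF (FV i).
have FVD i : F k (V i.+1 `\` V i).
  by rewrite !VE; apply: (@FY k (CV i.+1 `\` CV i)); exact: measurableD.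
have subV i : V i `<=` V i.+1.
  rewrite /V; case: ltnP => [iN|Ni]; last by rewrite ltnNge (leqW Ni).
  case: ifP => // _ w /=; apply: le_lt_trans.
  by rewrite ler_pM2r // lerB // lerB // ler_nat.
pose v i := pr P (V i).
have prEV (C : set T) : F k C -> pr P (E `&` C) = pr P E * pr P C /\
    cylinder_class F (fun i => (i < k.+1)%N || (k.+1 + m <= i)%N) (E `&` C).
  move=> FC; have [] // := cylinder_setI indepF (J := fun i => (i < k.+1)%N || (k.+1 + m <= i)%N) FE FC.
  - by rewrite ltnn /= -ltnNge; lia.
  - by rewrite ltnSn.
  - by move=> i; lia.
(* Summation by parts of the expectation of h at the remaining level. On [V 0] the probability is
   bounded through h 0 >= 1; each further cell uses the induction hypothesis with E restricted to
   that cell. *)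
have key i : (i <= N)%N ->
    pr P (E `&` V i `&` W) <= pr P E * (v i * h i + \sum_(l < i) v l * (h l - h l.+1)).
  elim: i => [|i IHi] iN.
    rewrite big_ord0 addr0.
    apply: (@le_trans _ _ (pr P (E `&` V 0%N))).
      apply: le_pr; [do 2?apply: measurableI => //|exact: measurableI|exact: subIsetl].
    have [-> _] := prEV _ (FV 0%N); rewrite mulrA ler_peMr //.
    by apply: mulr_ge0; exact: pr_ge0.
  have mVD : measurable (V i.+1 `\` V i) by exact: measurableD.
  have sub : E `&` V i.+1 `&` W `<=`
      (E `&` V i `&` W) `|` (E `&` (V i.+1 `\` V i) `&` walk_exceeds k.+1 m (i.+1%:R * theta)).
    move=> w [[Ew Vw] Ww]; have [Vi|nVi] := pselect (V i w); [by left|right].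
    split => //; case: Ww => -[|j] jm.
      by rewrite addn0 big_geq // ltNge mulr_ge0 //; exact: ltW.
    rewrite big_ltn ?addnS; last by lia.
    move=> hj; exists j; first by lia.
    rewrite addSn -(ltrD2l (Y k w)); apply: le_lt_trans hj.
    move: nVi; rewrite /V iN /= => /negP; rewrite -leNgt => nVi.
    have : Y k w <= (n%:R - i%:R - 1) * theta := nVi.
    rewrite -natr1; lra.
  have mW' := measurable_walk_exceeds k.+1 m (i.+1%:R * theta).
  apply: le_trans (le_pr P _ _ sub) _.
  - by do 2?apply: measurableI => //.
  - by apply: measurableU; do 2?apply: measurableI => //.
  apply: le_trans (prU_le _ _ _) _; [by do 2?apply: measurableI|by do 2?apply: measurableI|].
  have [prD cD] := prEV _ (FVD i).
  have := IH _ i.+1 _ cD; rewrite prD => h1.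
  have h2 := IHi (ltnW iN).
  have vD : pr P (V i.+1 `\` V i) = v i.+1 - v i.
    have := prDI P (mV i.+1) (mV i); rewrite (setIidr (subV i)) /v; lra.
  rewrite vD in h1; rewrite big_ord_recr /=.
  have E0 := pr_ge0 P E.
  lra.
have vN : v N = 1 by rewrite /v /V ltnn pr_setT.
have VN : V N = setT by rewrite /V ltnn.
have := key N (leqnn N); rewrite VN setIT vN mul1r => /le_trans; apply.
apply: ler_wpM2l; first exact: pr_ge0.
have -> : \sum_(l < N) v l * (h l - h l.+1) =
    \sum_(l < n) (h l - h l.+1) * up_tail (n - l) +
    \sum_(i < K) (h (n + i)%N - h (n + i).+1) * (1 - down_tail i.+1).
  rewrite big_split_ord /=; congr (_ + _); apply: eq_bigr => l _; rewrite mulrC; congr (_ * _).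
    rewrite /v /up_tail /V ltn_addr //.
    have -> : [set w | (n%:R - l%:R - 1) * theta < Y k w] = Y k @^-1` `](n%:R - l%:R - 1) * theta, +oo[%classic.
      by apply/seteqP; split => w /=; rewrite in_itv /= andbT.
    rewrite lawY; last exact: measurable_itv.
    congr (pr P _); apply/seteqP; split => w /=; rewrite in_itv /= andbT natrB //; exact: ltnW.
  rewrite /v /down_tail /V ltn_add2l ltn_ord.
  have -> : [set w | (n%:R - (n + l)%:R - 1) * theta < Y k w] = Y k @^-1` `](n%:R - (n + l)%:R - 1) * theta, +oo[%classic.
    by apply/seteqP; split => w /=; rewrite in_itv /= andbT.
  rewrite lawY; last exact: measurable_itv.
  rewrite -pr_setC.
    congr (pr P _); apply/seteqP; split => w /=; rewrite in_itv /= andbT natrD.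
      by move=> hw; apply/negP; rewrite -ltNge; apply: le_lt_trans hw; rewrite -natr1; lra.
    by move=> /negP; rewrite -ltNge; apply: le_lt_trans; rewrite -natr1; lra.
  rewrite -[X in measurable X]setTI.
  have := mY 0%N measurableT (measurable_itv `]-oo, - (l.+1%:R * theta)]).
  by congr (measurable (_ `&` _)); apply/seteqP; split => w /=; rewrite in_itv.
have := hs n.
have -> : \sum_(i < K) (h (n + i)%N - h (n + i).+1) * (1 - down_tail i.+1) =
   \sum_(i < K) (h (n + i)%N - h (n + i).+1) - \sum_(i < K) down_tail i.+1 * (h (n + i)%N - h (n + i).+1).
  by rewrite -sumrB; apply: eq_bigr => i _; lra.
have -> : \sum_(i < K) (h (n + i)%N - h (n + i).+1) = h n - h N.
  rewrite /N; elim: (K) => [|j IHj]; first by rewrite big_ord0 addn0 subrr.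
  by rewrite big_ord_recr IHj /= addnS; lra.
lra.
Qed.

Lemma walk_sup_supersol n :
  pr P [set w | exists j, n%:R * theta < \sum_(i < j) Y i w] <= h n.
Proof.
have -> : [set w | exists j, n%:R * theta < \sum_(i < j) Y i w] =
    \bigcup_m walk_exceeds 0 m (n%:R * theta).
  apply/seteqP; split => w.
    by move=> [j hj]; exists j => //; exists j => //; rewrite add0n big_mkord.
  by move=> [m _ [j _]]; rewrite add0n big_mkord => hj; exists j.
apply: pr_bigcup_le.
- by move=> m; exact: measurable_walk_exceeds.
- by move=> m m' mm' w [j jm hj]; exists j => //; lia.
move=> m; have := walk_supersol n (cylinder_setT F (fun i => (i < 0)%N || (0 + m <= i)%N)).
by rewrite setTI pr_setT mul1r.
Qed.

End Walk.

Section Expectation.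
Context {R : realType} {d : measure_display} {T : measurableType d}.
Variable P : probability T R.
Implicit Types f g : T -> R.

Definition integrableR f := P.-integrable setT (EFin \o f).
Definition Ex f : R := \int[P]_x f x.

Lemma integrableR_meas f : integrableR f -> measurable_fun setT f.
Proof. by move=> /integrableP[/measurable_EFinP]. Qed.

Lemma integrableRD f g : integrableR f -> integrableR g -> integrableR (fun x => f x + g x).
Proof. by move=> hf hg; have := integrableD measurableT hf hg. Qed.

Lemma integrableRB f g : integrableR f -> integrableR g -> integrableR (fun x => f x - g x).
Proof. by move=> hf hg; have := integrableB measurableT hf hg. Qed.

Lemma integrableRZ c f : integrableR f -> integrableR (fun x => c * f x).
Proof. by move=> hf; have := integrableZl measurableT c hf. Qed.

Lemma integrableR_cst c : integrableR (fun=> c).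
Proof. exact: finite_measure_integrable_cst. Qed.

Lemma integrableR_norm f : integrableR f -> integrableR (fun x => `|f x|).
Proof. by move=> hf; have := integrable_norm hf. Qed.

Lemma integrableR_indic A : measurable A -> integrableR (\1_A : T -> R).
Proof. by move=> mA; exact: integrable_indic. Qed.

Lemma integrableR_le f g : measurable_fun setT f -> (forall x, `|f x| <= g x) ->
  integrableR g -> integrableR f.
Proof.
move=> mf fg; apply: le_integrable => //; first exact/measurable_EFinP.
by move=> x _ /=; rewrite lee_fin (le_trans (fg x)) // ler_norm.
Qed.

Lemma ExD f g : integrableR f -> integrableR g -> Ex (fun x => f x + g x) = Ex f + Ex g.
Proof. by move=> hf hg; exact: RintegralD. Qed.

Lemma ExB f g : integrableR f -> integrableR g -> Ex (fun x => f x - g x) = Ex f - Ex g.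
Proof. by move=> hf hg; exact: RintegralB. Qed.

Lemma ExZ c f : integrableR f -> Ex (fun x => c * f x) = c * Ex f.
Proof. by move=> hf; exact: RintegralZl. Qed.

Lemma Ex_cst c : Ex (fun=> c) = c.
Proof.
transitivity (c * pr P setT); first exact: Rintegral_cst.
by rewrite pr_setT mulr1.
Qed.

Lemma Ex_indic A : measurable A -> Ex (\1_A : T -> R) = pr P A.
Proof. by move=> mA; rewrite /Ex /Rintegral integral_indic // setIT. Qed.

Lemma le_Ex f g : integrableR f -> integrableR g -> (forall x, f x <= g x) -> Ex f <= Ex g.
Proof. by move=> hf hg fg; apply: le_Rintegral. Qed.

Lemma Ex_sum_indic (A : nat -> set T) n : (forall i, measurable (A i)) ->
  integrableR (fun x => \sum_(i < n) \1_(A i) x) /\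
  Ex (fun x => \sum_(i < n) \1_(A i) x) = \sum_(i < n) pr P (A i).
Proof.
move=> mA; elim: n => [|n [IH1 IH2]].
  rewrite big_ord0; have -> : (fun x => \sum_(i < 0) \1_(A i) x) = (fun=> 0 : R).
    by apply/funext => x; rewrite big_ord0.
  by split; [exact: integrableR_cst|exact: Ex_cst].
have -> : (fun x => \sum_(i < n.+1) \1_(A i) x) =
    (fun x => \sum_(i < n) \1_(A i) x + \1_(A n) x : R).
  by apply/funext => x; rewrite big_ord_recr.
split; first by apply: integrableRD => //; exact: integrableR_indic.
by rewrite ExD ?IH2 ?Ex_indic ?big_ord_recr //; exact: integrableR_indic.
Qed.

Lemma EFin_Ex f : integrableR f -> (Ex f)%:E = (\int[P]_x (f x)%:E)%E.
Proof. by move=> hf; rewrite /Ex /Rintegral fineK //; exact: integrable_fin_num. Qed.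

Lemma Ex_dominated (fn : nat -> T -> R) f g (e : R) :
  (forall n, measurable_fun setT (fn n)) -> (forall n x, `|fn n x| <= g x) ->
  integrableR g -> (forall x, \forall n \near \oo, fn n x = f x) ->
  integrableR f -> 0 < e -> \forall n \near \oo, `|Ex (fn n) - Ex f| <= e.
Proof.
move=> mfn fg ig cv hf e0.
have ifn n : integrableR (fn n) by exact: integrableR_le (mfn n) (fg n) ig.
have := @dominated_cvg _ _ _ P setT measurableT (fun n => EFin \o fn n) (EFin \o f) (EFin \o g).
have h0 n : measurable_fun setT (EFin \o fn n) by exact/measurable_EFinP.
have h1 x : [set: T] x -> (fun n => (EFin \o fn n) x) @ \oo --> (EFin \o f) x.
  by move=> _; apply: cvg_near_cst; have := cv x; apply: filterS => n /= ->.
have h2 n x : [set: T] x -> (`|(EFin \o fn n) x| <= (EFin \o g) x)%E.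
  by move=> _; rewrite /= lee_fin.
move=> /(_ h0 h1 (fun x _ => isT) ig h2) h.
have {}h : (fun n => Ex (fn n)) @ \oo --> Ex f.
  apply: fine_cvg; rewrite EFin_Ex //.
move/cvgrPdist_le : h => /(_ _ e0); apply: filterS => n.
by rewrite distrC.
Qed.

End Expectation.

(** * Lattice counts and the drift of the rounded walk *)

Section LatticeCounts.
Context {R : realType}.
Implicit Types z : R.

Lemma sum_bool_le (b : nat -> bool) n : \sum_(s < n) (b s : nat)%:R <= n%:R :> R.
Proof.
elim: n => [|n IH]; first by rewrite big_ord0.
rewrite big_ord_recr /= -[n.+1%:R]natr1; apply: lerD => //.
by case: (b n).
Qed.

Lemma count_up_le z n : \sum_(s < n) ((s%:R - 1 < z)%R : nat)%:R <= `|z| + 2 :> R.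
Proof.
elim: n => [|n IH]; first by rewrite big_ord0; have := normr_ge0 z; lra.
have keyn : \sum_(s < n) ((s%:R - 1 < z)%R : nat)%:R <= n%:R :> R.
  exact: sum_bool_le (fun s => (s%:R - 1 < z)%R) n.
rewrite big_ord_recr /=; have := ler_norm z.
have [h|h] := ltP (n%:R - 1) z; last by rewrite addr0 => _; exact: IH.
by rewrite mulr1n; lra.
Qed.

Lemma count_down_le z n : \sum_(s < n) ((z <= - s.+1%:R)%R : nat)%:R <= `|z| :> R.
Proof.
elim: n => [|n IH]; first by rewrite big_ord0.
rewrite big_ord_recr /=; have [h|h] := leP z (- n.+1%:R); last by rewrite addr0.
have keyn : \sum_(s < n) ((z <= - s.+1%:R)%R : nat)%:R <= n%:R :> R.
  exact: sum_bool_le (fun s => (z <= - s.+1%:R)%R) n.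
move: h; rewrite -natr1 mulr1n; have := ler_norm (- z); rewrite normrN; lra.
Qed.

Definition clamp n z := Num.max (- n%:R) (Num.min z n%:R).

Lemma clamp_id n z : `|z| <= n%:R -> clamp n z = z.
Proof.
rewrite ler_norml => /andP[h1 h2]; rewrite /clamp (min_idPl h2).
by apply/max_idPr.
Qed.

Lemma norm_clamp_le n z : `|clamp n z| <= `|z|.
Proof.
have [h|h] := leP `|z| n%:R; first by rewrite clamp_id.
have n0 : 0 <= n%:R :> R by [].
have : `|clamp n z| <= n%:R.
  rewrite ler_norml /clamp le_max lexx ge_max ge_min lexx orbT !andbT; lra.
lra.
Qed.

(** The indicators count the lattice levels crossed downwards and upwards by z, so their balance is
    - z up to a rounding error of 1. The counts saturate at n, hence [clamp]. *)
Lemma count_balance z n :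
  - clamp n z - 1 <= \sum_(s < n) (((z <= - s.+1%:R)%R : nat)%:R - ((s%:R < z)%R : nat)%:R).
Proof.
set S := \sum_(s < n) _.
have n0 : 0 <= n%:R :> R by [].
have [z0|z0] := leP z 0.
  have : n%:R <= S \/ - z - 1 <= S.
    rewrite /S; elim: (n) => [|k IH]; first by left; rewrite big_ord0.
    rewrite big_ord_recr /=; have k0 : 0 <= k%:R :> R by [].
    have -> : (k%:R < z) = false by apply/negbTE; rewrite -leNgt; lra.
    have [h|h] := leP z (- k.+1%:R).
      by rewrite mulr1n mulr0n -[k.+1%:R]natr1; case: IH => IH; [left|right]; lra.
    by rewrite mulr0n; case: IH => IH; right; move: h; rewrite -[k.+1%:R]natr1; lra.
  rewrite /clamp (min_idPl _); last by lra.
  by have [h|h] := leP (- n%:R) z => -[] h'; lra.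
have : - n%:R <= S /\ - (z + 1) <= S.
  rewrite /S; elim: (n) => [|k [IH1 IH2]]; first by rewrite big_ord0; split; lra.
  rewrite big_ord_recr /=; have k0 : 0 <= k%:R :> R by [].
  have -> : (z <= - k.+1%:R) = false.
    by apply/negbTE; rewrite -ltNge -natr1; lra.
  by have [h|h] := ltP k%:R z; rewrite mulr0n ?mulr1n ?mulr0n -[k.+1%:R]natr1; split; lra.
rewrite /clamp => -[h1 h2]; have [h3|h3] := leP z n%:R; [have [h4|h4] := leP (- n%:R) z|have [h4|h4] := leP (- n%:R) n%:R]; lra.
Qed.

End LatticeCounts.

Section WalkBalance.
Context {R : realType} {d : measure_display} {T : measurableType d}.
Variables (P : probability T R) (Y : nat -> T -> R) (theta : R).
Hypotheses (iY : integrableR P (Y 0%N)) (theta0 : 0 < theta).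

Let Z w := theta^-1 * Y 0%N w.
Let iZ : integrableR P Z. Proof. exact: integrableRZ. Qed.
Let mZ : measurable_fun setT Z := integrableR_meas iZ.
Let Up s := [set w | (s%:R - 1) * theta < Y 0%N w].
Let Dn s := [set w | Y 0%N w <= - (s%:R * theta)].

Let mUp s : measurable (Up s).
Proof.
have := integrableR_meas iY measurableT (measurable_itv `](s%:R - 1) * theta, +oo[).
by rewrite setTI; congr measurable; apply/seteqP; split => w /=; rewrite in_itv /= andbT.
Qed.

Let mDn s : measurable (Dn s).
Proof.
have := integrableR_meas iY measurableT (measurable_itv `]-oo, - (s%:R * theta)]).
by rewrite setTI; congr measurable; apply/seteqP; split => w /=; rewrite in_itv /=.
Qed.

Let UpE s w : \1_(Up s) w = ((s%:R - 1 < Z w)%R : nat)%:R :> R.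
Proof.
rewrite indicE; congr (nat_of_bool _)%:R; apply/idP/idP; rewrite inE /Up /Z /=.
  by rewrite ltr_pdivlMl // mulrC.
by rewrite ltr_pdivlMl // mulrC.
Qed.

Let DnE s w : \1_(Dn s) w = ((Z w <= - s%:R)%R : nat)%:R :> R.
Proof.
rewrite indicE; congr (nat_of_bool _)%:R; apply/idP/idP; rewrite inE /Dn /Z /=.
  by rewrite ler_pdivrMl // mulrN mulrC.
by rewrite ler_pdivrMl // mulrN mulrC.
Qed.

Lemma psum_up_tail_le n : psum (up_tail P Y theta) n <= Ex P (fun w => `|Z w|) + 2.
Proof.
have [i1 E1] := Ex_sum_indic P n mUp.
have -> : psum (up_tail P Y theta) n = \sum_(i < n) pr P (Up i) by [].
rewrite -E1.
rewrite -[2](Ex_cst P) -ExD; [|exact: integrableR_norm|exact: integrableR_cst].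
apply: le_Ex => //; first by apply: integrableRD; [exact: integrableR_norm|exact: integrableR_cst].
by move=> w; under eq_bigr do rewrite UpE; exact: count_up_le.
Qed.

Lemma sum_down_tail_le n : \sum_(s < n) down_tail P Y theta s.+1 <= Ex P (fun w => `|Z w|) + 2.
Proof.
have [i1 E1] := Ex_sum_indic P n (fun s => mDn s.+1).
have -> : \sum_(s < n) down_tail P Y theta s.+1 = \sum_(i < n) pr P (Dn i.+1) by [].
rewrite -E1.
rewrite -[2](Ex_cst P) -ExD; [|exact: integrableR_norm|exact: integrableR_cst].
apply: le_Ex => //; first by apply: integrableRD; [exact: integrableR_norm|exact: integrableR_cst].
move=> w; under eq_bigr do rewrite DnE.
by apply: (le_trans (count_down_le _ _)); rewrite lerDl.
Qed.

(** [count_balance] in expectation, with the truncation removed by dominated convergence; the - 1 is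
    the price of rounding. *)
Lemma walk_balance a0 : a0 < - (Ex P (Y 0%N) / theta) - 1 ->
  \forall K \near \oo, a0 <= \sum_(s < K) down_tail P Y theta s.+1
                             - \sum_(s < K) up_tail P Y theta s.+1.
Proof.
move=> ha.
have EZ : Ex P Z = Ex P (Y 0%N) / theta by rewrite /Z ExZ // mulrC.
have e0 : 0 < - (Ex P (Y 0%N) / theta) - 1 - a0 by lra.
have mc n : measurable_fun setT (fun w => clamp n (Z w)).
  by apply: measurable_maxr => //; apply: measurable_minr.
have ic n : integrableR P (fun w => clamp n (Z w)).
  by apply: integrableR_le (mc n) (fun w => norm_clamp_le n (Z w)) (integrableR_norm iZ).
have := @Ex_dominated _ _ _ P (fun n w => clamp n (Z w)) Z (fun w => `|Z w|) _ mc
  (fun n w => norm_clamp_le n (Z w)) (integrableR_norm iZ) _ iZ e0.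
have cv x : \forall n \near \oo, clamp n (Z x) = Z x.
  exists (Num.truncn `|Z x|).+1 => // n /= hn; apply: clamp_id.
  have := truncnS_gt `|Z x|; have : (Num.truncn `|Z x|).+1%:R <= n%:R :> R by rewrite ler_nat.
  lra.
move=> /(_ cv); apply: filterS => K; rewrite EZ ler_norml => /andP[_ hK].
have [i1 E1] := Ex_sum_indic P K (fun s => mDn s.+1).
have [i2 E2] := Ex_sum_indic P K (fun s => mUp s.+1).
have -> : \sum_(s < K) down_tail P Y theta s.+1 = \sum_(i < K) pr P (Dn i.+1) by [].
have -> : \sum_(s < K) up_tail P Y theta s.+1 = \sum_(i < K) pr P (Up i.+1) by [].
rewrite -E1 -E2 -ExB //.
have : Ex P (fun w => (-1) * clamp K (Z w) - 1) <=
    Ex P (fun w => \sum_(i < K) \1_(Dn i.+1) w - \sum_(i < K) \1_(Up i.+1) w).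
  apply: le_Ex; first by apply: integrableRB; [exact: integrableRZ|exact: integrableR_cst].
    exact: integrableRB.
  move=> w; rewrite -sumrB mulN1r; apply: le_trans (count_balance (Z w) K) _.
  apply: ler_sum => s _; rewrite DnE UpE.
  by have -> : s.+1%:R - 1 = s%:R :> R by rewrite -natr1 addrK.
rewrite (ExB (f := fun w => -1 * clamp K (Z w)) (integrableRZ _ (ic K)) (integrableR_cst P 1)).
rewrite ExZ // Ex_cst; lra.

Qed.

End WalkBalance.

(** * The integrated tail *)

Section HalfLineIntegral.
Context {R : realType}.
Local Notation mu := (@lebesgue_measure R).
Local Notation D0 := (`[0%R, +oo[%classic : set R).
Variable f : R -> R.
Hypotheses (f0 : forall x, 0 <= f x) (mf : measurable_fun setT f).
Hypothesis ffin : (\int[mu]_(x in D0) (f x)%:E < +oo)%E.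

Definition iint (S : set R) : R := fine (\int[mu]_(x in S) (f x)%:E)%E.

Let mfE (S : set R) : measurable_fun S (EFin \o f).
Proof. by apply/measurable_EFinP; exact: measurable_funS mf. Qed.

Lemma EFin_iint S : measurable S -> S `<=` D0 -> (iint S)%:E = (\int[mu]_(x in S) (f x)%:E)%E.
Proof.
move=> mS SD; rewrite /iint fineK // ge0_fin_numE; last first.
  by apply: integral_ge0 => x _; rewrite lee_fin.
apply: le_lt_trans ffin; apply: ge0_subset_integral => //.
exact: mfE.
by move=> x _; rewrite lee_fin.
Qed.

Lemma iint_ge0 S : 0 <= iint S.
Proof. by rewrite /iint fine_ge0 // integral_ge0 // => x _; rewrite lee_fin. Qed.

Lemma le_iint A B : measurable A -> measurable B -> A `<=` B -> B `<=` D0 -> iint A <= iint B.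
Proof.
move=> mA mB AB BD; rewrite -lee_fin !EFin_iint //; last exact: subset_trans BD.
by apply: ge0_subset_integral => //; [exact: mfE|move=> x _; rewrite lee_fin].
Qed.

Lemma iintU A B : measurable A -> measurable B -> A `<=` D0 -> B `<=` D0 ->
  A `&` B = set0 -> iint (A `|` B) = iint A + iint B.
Proof.
move=> mA mB AD BD AB; apply: EFin_inj; rewrite EFinD !EFin_iint //.
- apply: ge0_integral_setU => //; first exact: mfE.
    by move=> x _; rewrite lee_fin.
  by apply/disj_setPS; rewrite AB.
- exact: measurableU.
- by move=> x [/AD|/BD].
Qed.

Lemma iint_itv_le a b c : 0 <= a -> a <= b -> (forall x, a < x -> x <= b -> f x <= c) ->
  iint `]a, b] <= (b - a) * c.
Proof.
move=> a0 ab fc.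
have [ab'|] := ltP a b; last first.
  move=> ba; rewrite /iint set_itv_ge ?integral_set0 /=; last by rewrite bnd_simp -leNgt.
  have -> : b - a = 0 by lra.
  by rewrite mul0r.
have sub : `]a, b]%classic `<=` D0 by move=> x /=; rewrite !in_itv /= andbT => /andP[h _]; lra.
rewrite -lee_fin EFin_iint //.
apply: (@le_trans _ _ (\int[mu]_(x in `]a, b]) c%:E)%E).
  apply: ge0_le_integral => //.
  - by move=> x _; rewrite lee_fin.
  - exact: mfE.
  - by move=> x; rewrite /= in_itv /= => /andP[ax xb]; rewrite lee_fin fc.
rewrite integral_cst //= lebesgue_measure_itv /= lte_fin ab' -EFinB -EFinM lee_fin; lra.
Qed.

Lemma iint_itv_ge a b c : 0 <= a -> a <= b -> 0 <= c ->
  (forall x, a < x -> x <= b -> c <= f x) -> (b - a) * c <= iint `]a, b].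
Proof.
move=> a0 ab c0 fc.
have [ab'|] := ltP a b; last first.
  move=> ba; have -> : b - a = 0 by lra.
  by rewrite mul0r iint_ge0.
have sub : `]a, b]%classic `<=` D0 by move=> x /=; rewrite !in_itv /= andbT => /andP[h _]; lra.
rewrite -lee_fin EFin_iint //.
apply: (@le_trans _ _ (\int[mu]_(x in `]a, b]) c%:E)%E); last first.
  apply: ge0_le_integral => //.
  - exact: mfE.
  - by move=> x; rewrite /= in_itv /= => /andP[ax xb]; rewrite lee_fin fc.
rewrite integral_cst //= lebesgue_measure_itv /= lte_fin ab' -EFinB -EFinM lee_fin; lra.
Qed.

Lemma iint_tail_small e : 0 < e -> \forall n \near \oo, iint `]n%:R, +oo[ <= e.
Proof.
move=> e0.
pose A (n : nat) : set R := `[0%R, n%:R]%classic.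
have ndA : nondecreasing_seq A.
  move=> m n mn; apply/subsetPset => x; rewrite /A /= !in_itv /= => /andP[-> h] /=.
  by apply: le_trans h _; rewrite ler_nat.
have mA n : measurable (A n) by exact: measurable_itv.
have UA : \bigcup_n A n = D0.
  apply/seteqP; split => x; first by move=> [n _]; rewrite /A /= !in_itv /= => /andP[->].
  rewrite /= in_itv /= andbT => x0; exists (Num.truncn x).+1 => //.
  by rewrite /A /= in_itv /= x0 /= ltW // truncnS_gt.
have AD n : A n `<=` D0 by rewrite -UA; exact: bigcup_sup.
have : (fun n => \int[mu]_(x in A n) (f x)%:E)%E @ \oo -->
    (\int[mu]_(x in \bigcup_n A n) (f x)%:E)%E.
  apply: ge0_nondecreasing_set_cvg_integral => //.
  - by move=> n; exact: mfE.
  - by move=> n x _; rewrite lee_fin.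
rewrite UA => cv.
have {}cv : (fun n => iint (A n)) @ \oo --> iint D0.
  by apply: fine_cvg; rewrite EFin_iint.
move/cvgrPdist_le : cv => /(_ _ e0); apply: filterS => n hn.
have E : D0 = A n `|` `]n%:R, +oo[%classic.
  apply/seteqP; split => x; rewrite /A /= !in_itv /= !andbT.
    by move=> x0; have [xn|nx] := leP x n%:R; [left; rewrite x0|right].
  by case=> [/andP[]//|h]; apply: le_trans (ltW h).
have := iintU (A := A n) (B := `]n%:R, +oo[%classic) (mA n) (measurable_itv _) (AD n).
rewrite -E => hU.
have h1 : `]n%:R, +oo[%classic `<=` D0 by rewrite E; exact: subsetUr.
have h2 : A n `&` `]n%:R, +oo[%classic = set0.
  by apply/seteqP; split => // x [] /=; rewrite /A /= !in_itv /= andbT => /andP[_ h3] h4; lra.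
have := hU h1 h2; move: hn; rewrite ler_norml; lra.
Qed.

End HalfLineIntegral.

Section DensTail.
Context {R : realType}.
Local Notation D0 := (`[0%R, +oo[%classic : set R).
Variable h : R -> R.
Hypotheses (h0 : forall x, 0 <= h x) (hm : forall x y, x <= y -> h y <= h x).
Hypothesis hsub : subexp_tail_law h.
Local Notation G := (dens_tail h).

Let mh : measurable_fun setT h.
Proof. by apply: nonincreasing_measurable => // x y; exact: hm. Qed.

Let hfin : (\int[lebesgue_measure]_(x in D0) (h x)%:E < +oo)%E.
Proof. by case: hsub. Qed.

Definition dens_total : R := iint h D0.
Local Notation M := dens_total.

Lemma dens_total_gt0 : 0 < M.
Proof.
case: hsub => + _ _ _; rewrite /dens_mass => m0.
by rewrite -lte_fin EFin_iint.
Qed.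

Let MK x : x / M * M = x.
Proof. by rewrite divfK // lt0r_neq0 // dens_total_gt0. Qed.

Let mray t : measurable (`]t, +oo[%classic : set R). Proof. exact: measurable_itv. Qed.
Let mD : measurable D0. Proof. exact: measurable_itv. Qed.

Lemma dens_tailE t : 0 <= t -> G t = iint h `]t, +oo[ / M.
Proof.
move=> t0; rewrite /dens_tail /M /iint /dens_mass (setIidr _) //.
by move=> x /=; rewrite !in_itv /= !andbT => /ltW; exact: le_trans.
Qed.

Lemma dens_tail_le0 t : t <= 0 -> G t = 1.
Proof.
move=> t0; have M0 := dens_total_gt0.
suff -> : G t = M / M by rewrite divff // lt0r_neq0.
congr (_ / _); move: t0; rewrite le_eqVlt => /predU1P[->|t0].
  rewrite /iint; congr (fine _).
  rewrite (setIidr _); last by move=> x /=; rewrite !in_itv /= !andbT; exact: ltW.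
  by rewrite integral_itv_obnd_cbnd //; apply/measurable_EFinP; exact: measurable_funS mh.
rewrite /iint; congr (fine _); rewrite (setIidl _) //.
by move=> x /=; rewrite !in_itv /= !andbT; exact: lt_le_trans.
Qed.

Lemma dens_tail_noninc s t : s <= t -> G t <= G s.
Proof.
move=> st; rewrite /dens_tail ler_pM2r ?invr_gt0 ?dens_total_gt0 //.
apply: (le_iint h0 mh hfin); [exact: measurableI|exact: measurableI| |exact: subIsetl].
by apply: setIS => x /=; rewrite !in_itv /= !andbT; exact: le_lt_trans.
Qed.

Lemma dens_tail_gt0 t : 0 < G t.
Proof. by case: hsub. Qed.

Lemma dens_tail_le1 t : G t <= 1.
Proof.
have [t0|t0] := leP t 0; first by rewrite dens_tail_le0.
by rewrite -(dens_tail_le0 (lexx 0)); apply: dens_tail_noninc; exact: ltW.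
Qed.

Lemma dens_tailB a b : 0 <= a -> a <= b -> M * (G a - G b) = iint h `]a, b].
Proof.
move=> a0 ab; rewrite !dens_tailE //; last exact: le_trans ab.
have E : (`]a, +oo[ = `]a, b] `|` `]b, +oo[)%classic.
  apply/seteqP; split => x; rewrite /= !in_itv /= !andbT.
    by move=> ax; have [xb|bx] := leP x b; [left; rewrite ax|right].
  by case=> [/andP[]//|]; exact: le_lt_trans.
rewrite E (iintU h0 mh hfin) //.
- by rewrite mulrBr ![M * _]mulrC !MK addrK.
- by move=> x /=; rewrite !in_itv /= andbT => /andP[ax _]; exact: le_trans (ltW ax).
- by move=> x /=; rewrite !in_itv /= !andbT => bx; apply: le_trans (ltW bx); exact: le_trans ab.
- by apply/seteqP; split => // x [] /=; rewrite !in_itv /= andbT => /andP[_ h3] h4; lra.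
Qed.

Lemma dens_tailB_le a b : 0 <= a -> a <= b -> M * (G a - G b) <= (b - a) * h a.
Proof.
move=> a0 ab; rewrite dens_tailB //; apply: (iint_itv_le h0 mh hfin) => // x ax _.
by apply: hm; exact: ltW.
Qed.

Lemma dens_tailB_ge a b : 0 <= a -> a <= b -> (b - a) * h b <= M * (G a - G b).
Proof.
by move=> a0 ab; rewrite dens_tailB //; apply: (iint_itv_ge h0 mh hfin) => // x ax /hm.
Qed.

Lemma sum_tail_lower s b N : 0 <= s -> 0 < b ->
  M * (G s - G (s + N%:R * b)) <= b * \sum_(n < N) h (s + n%:R * b).
Proof.
move=> s0 b0; elim: N => [|N IH]; first by rewrite big_ord0 mul0r addr0 subrr !mulr0.
rewrite big_ord_recr /= mulrDr.
have Nb : 0 <= N%:R * b by apply: mulr_ge0 => //; exact: ltW.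
have a0 : 0 <= s + N%:R * b by lra.
have ab : s + N%:R * b <= s + N.+1%:R * b by rewrite -natr1; lra.
have := dens_tailB_le a0 ab.
have -> : s + N.+1%:R * b - (s + N%:R * b) = b by rewrite -natr1; lra.
lra.
Qed.

(** Each summand is the value at the right end of a cell, so the cells start at s - b; hence b <=
    s. *)
Lemma sum_tail_upper s b N : b <= s -> 0 < b ->
  b * \sum_(n < N) h (s + n%:R * b) <= M * (G (s - b) - G (s - b + N%:R * b)).
Proof.
move=> s0 b0; elim: N => [|N IH]; first by rewrite big_ord0 mul0r addr0 subrr !mulr0.
rewrite big_ord_recr /= mulrDr.
have Nb : 0 <= N%:R * b by apply: mulr_ge0 => //; exact: ltW.
have a0 : 0 <= s - b + N%:R * b by lra.
have ab : s - b + N%:R * b <= s - b + N.+1%:R * b by rewrite -natr1; lra.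
have := dens_tailB_ge a0 ab.
have -> : s - b + N.+1%:R * b - (s - b + N%:R * b) = b by rewrite -natr1; lra.
have -> : s - b + N.+1%:R * b = s + N%:R * b by rewrite -natr1; lra.
have -> : M * (G (s - b) - G (s + N%:R * b)) = M * (G (s - b) - G (s - b + N%:R * b)) +
   M * (G (s - b + N%:R * b) - G (s + N%:R * b)) by lra.
lra.
Qed.

Section Convolution.
Variable x : R.
Let f y := G (x - y) * h y.

Let f0 y : 0 <= f y.
Proof. by apply: mulr_ge0 => //; exact: ltW (dens_tail_gt0 _). Qed.

Let mf : measurable_fun setT f.
Proof.
apply: measurable_funM => //; apply: nondecreasing_measurable => // y z yz.
by apply: dens_tail_noninc; lra.
Qed.

Let ffin : (\int[lebesgue_measure]_(x in D0) (f x)%:E < +oo)%E.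
Proof.
apply: le_lt_trans hfin; apply: ge0_le_integral => //.
- by move=> y _; rewrite lee_fin.
- by apply/measurable_EFinP; exact: measurable_funS mf.
- by apply/measurable_EFinP; exact: measurable_funS mh.
- move=> y _; rewrite lee_fin; apply: ler_piMl => //; exact: dens_tail_le1.
Qed.

Lemma dens_conv_tailE : dens_conv_tail h x = iint f D0 / M.
Proof. by []. Qed.

(** On the cell from j * theta to j.+1 * theta, y > j * theta gives G (x - y) >= G ((n - j) *
    theta). Beyond x the factor G (x - y) is 1, and this part contributes the extra G x. *)
Lemma dens_conv_lower theta n : 0 < theta -> x = n%:R * theta ->
  \sum_(j < n) (G (j%:R * theta) - G (j.+1%:R * theta)) * G ((n - j)%:R * theta)
    + G x <= dens_conv_tail h x.
Proof.
move=> th0 xE; have M0 := dens_total_gt0.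
have jth (j : nat) : 0 <= j%:R * theta by apply: mulr_ge0 => //; exact: ltW.
have nth : 0 <= x by rewrite xE.
have key k : (k <= n)%N ->
    M * \sum_(j < k) (G (j%:R * theta) - G (j.+1%:R * theta)) * G ((n - j)%:R * theta)
    <= iint f `]0, k%:R * theta].
  elim: k => [|k IH] kn; first by rewrite big_ord0 mulr0; apply: iint_ge0.
  rewrite big_ord_recr /= mulrDr.
  have kk : k%:R * theta <= k.+1%:R * theta by rewrite ler_pM2r // ler_nat.
  have E : (`]0%R, k.+1%:R * theta] = `]0%R, k%:R * theta] `|` `]k%:R * theta, k.+1%:R * theta])%classic.
    apply/seteqP; split => y; rewrite /= !in_itv /=.
      by move=> /andP[-> yk]; have [yk'|ky] := leP y (k%:R * theta); [left|right].
    move=> [/andP[-> yk]|/andP[yk ->]] /=; first exact: le_trans kk.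
    by rewrite andbT; apply: le_lt_trans yk.
  rewrite E (iintU f0 mf ffin) //.
  - apply: lerD; first by apply: IH; exact: ltnW.
    have Gn : 0 <= G ((n - k)%:R * theta) by exact: ltW (dens_tail_gt0 _).
    rewrite mulrA dens_tailB // mulrC.
    have mhE (S : set R) : measurable_fun S (EFin \o h).
      by apply/measurable_EFinP; exact: measurable_funS mh.
    have mfE (S : set R) : measurable_fun S (EFin \o f).
      by apply/measurable_EFinP; exact: measurable_funS mf.
    have sub : `]k%:R * theta, k.+1%:R * theta]%classic `<=` D0.
      by move=> y /=; rewrite !in_itv /= andbT => /andP[ky _]; apply: le_trans (ltW ky).
    rewrite -lee_fin EFinM.
    rewrite (EFin_iint h0 mh hfin) //.
    rewrite (EFin_iint f0 mf ffin) //.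
    set I := `]k%:R * theta, k.+1%:R * theta]%classic.
    have mI : measurable I by exact: measurable_itv.
    apply: (@le_trans _ _ (\int[lebesgue_measure]_(y in I)
        ((G ((n - k)%:R * theta))%:E * (h y)%:E))%E).
      by rewrite ge0_integralZl //; [exact: mhE|move=> y _; rewrite lee_fin].
    apply: ge0_le_integral => //.
    + by move=> y _; rewrite -EFinM lee_fin mulr_ge0.
    + by apply: measurable_funeM; exact: mhE.
    + exact: mfE.
    + move=> y; rewrite /I /= in_itv /= => /andP[ky _]; rewrite -EFinM lee_fin /f.
      apply: ler_wpM2r => //; apply: dens_tail_noninc; rewrite xE natrB; last exact: ltnW.
      by rewrite mulrBl; lra.
  - by move=> y /=; rewrite !in_itv /= => /andP[/ltW ->].
  - by move=> y /=; rewrite !in_itv /= andbT => /andP[ky _]; apply: le_trans (ltW ky).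
  - by apply/seteqP; split => // y [] /=; rewrite !in_itv /= => /andP[_ h3] /andP[h4 _]; lra.
have last_part : M * G x <= iint f `]x, +oo[.
  rewrite dens_tailE // mulrC MK.
  have sub : `]x, +oo[%classic `<=` D0.
    by move=> y /=; rewrite !in_itv /= !andbT => ky; apply: le_trans (ltW ky).
  rewrite -lee_fin !EFin_iint //; apply: ge0_le_integral => //.
  - by move=> y _; rewrite lee_fin.
  - by apply/measurable_EFinP; exact: measurable_funS mh.
  - by apply/measurable_EFinP; exact: measurable_funS mf.
  - move=> y; rewrite /= in_itv /= andbT => ky; rewrite lee_fin /f dens_tail_le0 ?mul1r //; lra.
rewrite dens_conv_tailE ler_pdivlMr // mulrC mulrDr.
apply: le_trans (lerD (key n (leqnn n)) last_part) _; rewrite -xE.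
rewrite -(iintU f0 mf ffin) //.
- apply: (le_iint f0 mf ffin) => //; first exact: measurableU.
  move=> y; rewrite /= !in_itv /= !andbT => -[/andP[/ltW]//|ky].
  by apply: le_trans (ltW ky).
- by move=> y /=; rewrite !in_itv /= andbT => /andP[/ltW].
- by move=> y /=; rewrite !in_itv /= !andbT => ky; apply: le_trans (ltW ky).
- by apply/seteqP; split => // y [] /=; rewrite !in_itv /= andbT => /andP[_ h3] h4; lra.
Qed.

End Convolution.

Lemma dens_tail_lattice theta : 0 < theta -> lattice_subexp (fun n => G (n%:R * theta)).
Proof.
move=> th0; have M0 := dens_total_gt0.
have jth (j : nat) : 0 <= j%:R * theta by apply: mulr_ge0 => //; exact: ltW.
have jthS (j : nat) : j%:R * theta <= j.+1%:R * theta by rewrite ler_pM2r // ler_nat.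
split.
- by rewrite mul0r dens_tail_le0.
- by move=> n; exact: dens_tail_gt0.
- move=> n; rewrite -(ler_pM2l M0).
  apply: le_trans (dens_tailB_le (jth _) (jthS _)) _.
  apply: le_trans (dens_tailB_ge (jth _) (jthS _)).
  by rewrite -!natr1; apply: ler_wpM2r => //; lra.
- move=> e e0; have eM : 0 < e * M by exact: mulr_gt0.
  have [N _ hN] := iint_tail_small h0 mh hfin eM.
  exists (Num.truncn (N%:R / theta)).+1 => // n /= hn.
  have Nn : N%:R <= n%:R * theta.
    rewrite -ler_pdivrMr //; apply: le_trans (ltW (truncnS_gt _)) _.
    by rewrite ler_nat.
  apply: le_trans (dens_tail_noninc Nn) _; rewrite dens_tailE // ler_pdivrMr //.
  exact: (hN N (leqnn N)).
- move=> e e0; case: hsub => _ _ _ /cvgrPdist_le /(_ _ e0) [A [_ hA]].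
  exists (Num.truncn (A / theta)).+1 => // n /= hn.
  have An : A < n%:R * theta.
    rewrite -ltr_pdivrMr //; apply: lt_le_trans (truncnS_gt _) _.
    by rewrite ler_nat.
  have := hA _ An; have g0 := dens_tail_gt0 (n%:R * theta).
  rewrite ler_norml => /andP[h1 _].
  have : dens_conv_tail h (n%:R * theta) <= (2 + e) * G (n%:R * theta).
    by rewrite -ler_pdivrMr //; lra.
  (* The extra G x of the lower bound turns 2 + e into 1 + e. *)
  have := dens_conv_lower th0 (erefl (n%:R * theta)); lra.
Qed.

End DensTail.

(** * The i.i.d. model *)

Section LawUniqueness.
Local Open Scope ereal_scope.
Context {R : realType} {d d1 d2 : measure_display} {T : measurableType d}
  {T1 : measurableType d1} {T2 : measurableType d2}.
Variables (P : probability T R) (U V : T -> T1 * T2) (E F : set T).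
Hypotheses (mU : measurable_fun setT U) (mV : measurable_fun setT V).
Hypotheses (mE : measurable E) (mF : measurable F).
Hypothesis rectUV : forall A B, measurable A -> measurable B ->
  P (U @^-1` (A `*` B) `&` E) = P (V @^-1` (A `*` B) `&` F).

Let mUS S : measurable S -> measurable (U @^-1` S `&` E).
Proof. by move=> mS; apply: measurableI => //; rewrite -[X in measurable X]setTI; exact: mU. Qed.

Let mVS S : measurable S -> measurable (V @^-1` S `&` F).
Proof. by move=> mS; apply: measurableI => //; rewrite -[X in measurable X]setTI; exact: mV. Qed.

(** Monotone class argument on rectangles. The events E and F are carried along so that it can be
    applied twice to a triple seen as a nested pair. *)
Lemma eq_law_rectangles S : measurable S ->
  P (U @^-1` S `&` E) = P (V @^-1` S `&` F).
Proof.
move=> mS.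
pose G : set (set (T1 * T2)) :=
  [set A `*` B | A in @measurable _ T1 & B in @measurable _ T2].
pose M : set (set (T1 * T2)) :=
  [set S | measurable S /\ P (U @^-1` S `&` E) = P (V @^-1` S `&` F)].
have GI : setI_closed G.
  move=> _ _ [X1 mX1 [X2 mX2 <-]] [Y1 mY1 [Y2 mY2 <-]].
  rewrite -setXI; exists (X1 `&` Y1); first exact: measurableI.
  by exists (X2 `&` Y2) => //; exact: measurableI.
have GM : G `<=` M.
  move=> _ [A mA [B mB <-]]; split; [exact: measurableX|exact: rectUV].
have lM : lambda_system setT M.
  split => //.
  - split => //; have := rectUV measurableT measurableT.
    by rewrite setXTT.
  - move=> X Y YX [mX hX] [mY hY]; split; first exact: measurableD.
    have aux (W : T -> T1 * T2) (H : set T) (mW : measurable (W @^-1` X `&` H)) (mW' : measurable (W @^-1` Y `&` H)) :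
        P (W @^-1` (X `\` Y) `&` H) = P (W @^-1` X `&` H) - P (W @^-1` Y `&` H).
      have -> : W @^-1` (X `\` Y) `&` H = (W @^-1` X `&` H) `\` (W @^-1` Y `&` H).
        by apply/seteqP; split => [w [[Xw nYw] Hw]|w [[Xw Hw] nYw]]; split => //; [case|split => // Yw; exact: nYw].
      rewrite measureD //; last by rewrite ltey_eq fin_num_measure.
      have sub : W @^-1` Y `&` H `<=` W @^-1` X `&` H.
        by move=> w [Yw Hw]; split => //; exact: YX.
      by rewrite (setIidr sub).
    by rewrite !aux ?hX ?hY //; solve [exact: mUS|exact: mVS].
  - move=> Q ndQ MQ; have mQ n : measurable (Q n) by case: (MQ n).
    have mUQ : measurable (\bigcup_n Q n) by exact: bigcupT_measurable.
    split => //.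
    have aux (W : T -> T1 * T2) (H : set T) (mW : forall S, measurable S -> measurable (W @^-1` S `&` H)) :
        (fun n => P (W @^-1` (Q n) `&` H)) @ \oo --> P (W @^-1` (\bigcup_n Q n) `&` H).
      have -> : W @^-1` (\bigcup_n Q n) `&` H = \bigcup_n (W @^-1` (Q n) `&` H).
        by rewrite preimage_bigcup setI_bigcupl.
      apply: (@nondecreasing_cvg_mu _ _ _ P (fun n => W @^-1` (Q n) `&` H)).
      - by move=> n; exact: mW.
      - by apply: bigcupT_measurable => n; exact: mW.
      - move=> m n mn; apply/subsetPset; apply: setSI; apply: preimage_subset.
        by apply/subsetPset; exact: ndQ.
    have cU := aux U E mUS; have := aux V F mVS.
    under eq_fun do rewrite -(MQ _).2.
    by move=> cV; exact: (cvg_unique _ cU cV).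
have : <<s G >> `<=` M by exact: lambda_system_subset.
by rewrite -measurable_prod_measurableType => /(_ S mS)[].
Qed.

End LawUniqueness.

Section IidModel.
Context {R : realType} {d : measure_display} {T : measurableType d}.
Variables (P : probability T R) (Psi : nat -> T -> R -> R) (A B D : nat -> T -> R).
Hypothesis iid : iid_seq P Psi A B D.
Local Notation sig := (sigma_n Psi A B D).

Let mPsi n t : measurable_fun setT (fun w => Psi n w t). Proof. by case: iid. Qed.
Let mA n : measurable_fun setT (A n). Proof. by case: iid => _ []. Qed.
Let mB n : measurable_fun setT (B n). Proof. by case: iid => _ [_ []]. Qed.
Let mD n : measurable_fun setT (D n). Proof. by case: iid => _ [_ [_ []]]. Qed.

Lemma iid_indep : mutually_indep P sig.
Proof. by case: iid => _ [_ [_ [_ []]]]. Qed.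

Lemma sigma_n_measurable n E : sig n E -> measurable E.
Proof.
apply: smallest_sub; first exact: sigma_algebra_measurable.
have pre (f : T -> R) C : measurable_fun setT f -> measurable C -> measurable (f @^-1` C).
  by move=> mf mC; rewrite -[X in measurable X]setTI; exact: mf.
move=> S [[t [C [mC ->]]]|[C [mC [->|[->|->]]]]]; exact: pre.
Qed.

Definition triple n w := ((A n w, B n w), D n w).

Lemma measurable_triple n : measurable_fun setT (triple n).
Proof. by apply: measurable_fun_pair => //; exact: measurable_fun_pair. Qed.

Lemma sigma_n_Psi n t C : measurable C -> sig n ((fun w => Psi n w t) @^-1` C).
Proof. by move=> mC; apply: sub_sigma_algebra; left; exists t, C. Qed.

Lemma sigma_n_triple n S : measurable S -> sig n (triple n @^-1` S).
Proof.
move=> mS.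
pose T' := g_sigma_algebraType (gen_events Psi A B D n).
have mG (f : T -> R) : (forall C, measurable C -> gen_events Psi A B D n (f @^-1` C)) ->
    measurable_fun setT (f : T' -> R).
  by move=> hf _ C mC; rewrite setTI; apply: sub_sigma_algebra; exact: hf.
have mA' : measurable_fun setT (A n : T' -> R).
  by apply: mG => C mC; right; exists C; split => //; left.
have mB' : measurable_fun setT (B n : T' -> R).
  by apply: mG => C mC; right; exists C; split => //; right; left.
have mD' : measurable_fun setT (D n : T' -> R).
  by apply: mG => C mC; right; exists C; split => //; right; right.
have : measurable_fun setT (triple n : T' -> (R * R) * R).
  by apply: measurable_fun_pair => //; exact: measurable_fun_pair.
by move=> /(_ measurableT S mS); rewrite setTI.
Qed.

Lemma law_cylinder n ts (Cs : nat -> set R) CA CB CD :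
  (forall j, measurable (Cs j)) -> measurable CA -> measurable CB -> measurable CD ->
  pr P (cyl_event Psi A B D ts Cs CA CB CD n) = pr P (cyl_event Psi A B D ts Cs CA CB CD 0).
Proof. by move=> mCs mCA mCB mCD; case: iid => _ [_ [_ [_ [_ h]]]]; exact: h. Qed.

Lemma law_triple n S : measurable S -> pr P (triple n @^-1` S) = pr P (triple 0 @^-1` S).
Proof.
have pre (f : T -> R) C : measurable_fun setT f -> measurable C -> measurable (f @^-1` C).
  by move=> mf mC; rewrite -[X in measurable X]setTI; exact: mf.
move=> mS; congr fine.
rewrite -[triple n @^-1` S]setIT -[triple 0 @^-1` S]setIT.
apply: eq_law_rectangles => //; try exact: measurable_triple.
move=> S2 CD mS2 mCD; rewrite !setIT.
have E k : triple k @^-1` (S2 `*` CD) = (fun w => (A k w, B k w)) @^-1` S2 `&` (D k @^-1` CD).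
  by apply/seteqP; split => w.
rewrite !E; apply: eq_law_rectangles => //.
- exact: measurable_fun_pair.
- exact: measurable_fun_pair.
- exact: pre.
- exact: pre.
move=> CA CB mCA mCB.
have E2 k : (fun w => (A k w, B k w)) @^-1` (CA `*` CB) `&` D k @^-1` CD =
    cyl_event Psi A B D [::] (fun=> setT) CA CB CD k.
  by apply/seteqP; split => [w [[/= h1 h2] h3]|w [_ [h1 [h2 h3]]]]; split => //.
have mE2 k : measurable ((fun w => (A k w, B k w)) @^-1` (CA `*` CB) `&` D k @^-1` CD).
  apply: measurableI; last exact: pre.
  rewrite -[X in measurable X]setTI; apply: measurable_fun_pair => //; exact: measurableX.
have mE3 k : measurable (cyl_event Psi A B D [::] (fun=> setT) CA CB CD k) by rewrite -E2.
rewrite !E2 -!EFin_pr //; congr (_%:E); exact: law_cylinder.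
Qed.

Lemma law_Psi0 n C : measurable C ->
  pr P ((fun w => Psi n w 0) @^-1` C) = pr P ((fun w => Psi 0%N w 0) @^-1` C).
Proof.
move=> mC.
have E k : (fun w => Psi k w 0) @^-1` C =
    cyl_event Psi A B D [:: 0] (fun=> C) setT setT setT k.
  apply/seteqP; split => [w Cw|w [h _]]; last exact: (h 0%N).
  by split => // -[|j].
by rewrite !E; exact: law_cylinder.
Qed.

Hypothesis contPsi : forall n w, continuous (Psi n w).

(** Psi is measurable in w at fixed arguments and continuous in the argument. X is the limit of
    [Xk], which takes countably many values, and composition with [Xk] is a countable gluing of
    fixed arguments. *)
Lemma measurable_Psi_comp n (X : T -> R) : measurable_fun setT X ->
  measurable_fun setT (fun w => Psi n w (X w)).
Proof.
move=> mX.
pose q (k : nat) (j : int) : R := j%:~R / k.+1%:R.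
pose Xk (k : nat) w : R := q k (Num.floor (k.+1%:R * X w)).
have cvX w : (fun k => Xk k w) @ \oo --> X w.
  apply/cvgrPdist_le => e e0.
  exists (Num.truncn e^-1).+1 => // k /= hk.
  have k0 : 0 < k.+1%:R :> R by rewrite ltr0n.
  have ek : e^-1 <= k.+1%:R.
    apply: le_trans (ltW (truncnS_gt _)) _; rewrite ler_nat; exact: leqW.
  have ek' : 1 <= e * k.+1%:R by rewrite -ler_pdivrMl // mulr1.
  have := real_floor_le (num_real (k.+1%:R * X w)).
  have := real_floorD1_gt (num_real (k.+1%:R * X w)).

  set z := Num.floor _; rewrite intrD => h1 h2.
  have E : X w - Xk k w = (k.+1%:R * X w - z%:~R) / k.+1%:R.
    by rewrite mulrBl mulrAC mulfV ?lt0r_neq0 // mul1r.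
  rewrite E normrM normfV (gtr0_norm k0) ler_pdivrMr //.
  apply: le_trans ek'; rewrite ger0_norm; [|lra].
  by move: h1; rewrite mulr1z; lra.
apply: (@measurable_fun_cvg _ _ _ setT (fun k w => Psi n w (Xk k w))); last first.
  move=> w _; apply: continuous_cvg; [exact: contPsi|exact: cvX].
move=> k _ C mC; rewrite setTI.
have -> : (fun w => Psi n w (Xk k w)) @^-1` C =
    \bigcup_j ([set w | Num.floor (k.+1%:R * X w) = j] `&` (fun w => Psi n w (q k j)) @^-1` C).
  apply/seteqP; split => w; last by move=> [j _ [/= <-]].
  by move=> h; exists (Num.floor (k.+1%:R * X w)).
apply: countable_bigcupT_measurable; first exact: countableP.
move=> j; apply: measurableI; last first.
  by rewrite -[X in measurable X]setTI; exact: mPsi.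
have -> : [set w | Num.floor (k.+1%:R * X w) = j] = X @^-1` `[q k j, q k (j + 1)[.
  have k0 : 0 < k.+1%:R :> R by rewrite ltr0n.
  apply/seteqP; split => w /=; rewrite in_itv /= /q ler_pdivrMr // ltr_pdivlMr // mulrC.
    by move=> <-; rewrite real_floor_le ?num_real //= real_floorD1_gt ?num_real.
  by move=> h; exact: floor_def.
by rewrite -[X in measurable X]setTI; apply: mX => //; exact: measurable_itv.
Qed.

Lemma measurable_comp_range k m (x : R) :
  measurable_fun setT (fun w => comp_range (fun i => Psi i w) k m x).
Proof.
elim: m k => [|m IH] k /=; first exact: measurable_cst.
exact: measurable_Psi_comp.
Qed.

Lemma measurable_Zproc n : measurable_fun setT (Zproc Psi n).
Proof. exact: measurable_comp_range. Qed.

End IidModel.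

Lemma comp_rangeD {R : realType} (Psi : nat -> R -> R) k n m x :
  comp_range Psi k n (comp_range Psi (k + n) m x) = comp_range Psi k (n + m) x.
Proof.
elim: n k => [|n IH] k /=; first by rewrite addn0.
by rewrite addnS -addSn IH.
Qed.

Lemma lipschitz_fun_continuous {R : realType} (f : R -> R) :
  lipschitz f -> continuous f.
Proof.
move=> [M [_ hM]].
pose k := Num.max 1 (M + 1).
have Mk : M < k by rewrite lt_max; apply/orP; right; lra.
have k0 : 0 < k by rewrite lt_max ltr01.
have h := hM k Mk.
move=> x; apply/cvgrPdist_le => e e0.
near=> y.
have := h (x, y) => /= /(_ (conj Logic.I Logic.I)) => h1; apply: (le_trans h1).
rewrite -ler_pdivlMl //.
by near: y; apply: cvgr_dist_le => //; rewrite mulr_gt0 ?invr_gt0.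
Unshelve. all: by end_near. Qed.

Section LongTail.
Context {R : realType}.
Variable h : R -> R.
Hypotheses (h0 : forall x, 0 <= h x) (hm : forall x y, x <= y -> h y <= h x).
Hypothesis hsub : subexp_tail_law h.
Local Notation G := (dens_tail h).

Lemma dens_tail_lattice_long_tail theta k e : 0 < theta -> 0 < e ->
  \forall n \near \oo, G ((n - k)%N%:R * theta) <= (1 + e) * G (n%:R * theta).
Proof.
move=> th0 e0; have [G1 Gpos _ Gsmall Gconv] := dens_tail_lattice h0 hm hsub th0.
apply: (@lattice_long_tail _ (fun n => G (n%:R * theta)) G1 Gpos _ Gsmall Gconv) => //.
move=> m n mn; apply: (dens_tail_noninc h0 hm hsub).
by rewrite ler_pM2r // ler_nat.
Qed.

Lemma dens_long_tail c e : 0 < e -> \forall x \near +oo, G (x - c) <= (1 + e) * G x.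
Proof.
move=> e0; pose k := (Num.truncn c).+1.
have ck : c < k%:R by exact: truncnS_gt.
have [N _ hN] := dens_tail_lattice_long_tail k.+1 ltr01 e0.
exists (N + k.+1)%:R; split; first exact: num_real.
move=> x hx; pose n := (Num.truncn x).+1.
have x0 : 0 <= x by apply: le_trans (ltW hx).
have hn : (N + k.+1 <= n)%N.
  by rewrite -(ler_nat R); apply: le_trans (ltW hx) _; exact: ltW (truncnS_gt _).
have := hN n => /= /(_ ltac:(lia)); rewrite !mulr1 => h1.
have xn : x <= n%:R by exact: ltW (truncnS_gt _).
have nx : n%:R <= x + 1.
  by rewrite /n -natr1 lerD2r; have := truncn_itv x0 => /andP[].
apply: (@le_trans _ _ (G (n - k.+1)%N%:R)).
  apply: (dens_tail_noninc h0 hm hsub); rewrite natrB; last by lia.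
  by rewrite -natr1; lra.
apply: le_trans h1 _; apply: ler_wpM2l; first lra.
exact: (dens_tail_noninc h0 hm hsub).
Qed.

End LongTail.

(** * Walks driven by the triples (A, B, D) *)

Section TripleWalk.
Context {R : realType} {d : measure_display} {T : measurableType d}.
Variables (P : probability T R) (Psi : nat -> T -> R -> R) (A B D : nat -> T -> R).
Hypothesis iid : iid_seq P Psi A B D.
Variable phi : (R * R) * R -> R.
Hypothesis mphi : measurable_fun setT phi.
Let Y k w := phi (triple A B D k w).
Hypothesis iY : integrableR P (Y 0%N).
Hypothesis EY : Ex P (Y 0%N) < 0.
Local Notation sig := (sigma_n Psi A B D).

Let mpre (C : set R) : measurable C -> measurable (phi @^-1` C).
Proof. by move=> mC; rewrite -[X in measurable X]setTI; exact: mphi. Qed.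

Let FY k (C : set R) : measurable C -> sig k (Y k @^-1` C).
Proof. by move=> mC; have := @sigma_n_triple _ _ _ Psi A B D k _ (mpre mC). Qed.

Let mY k : measurable_fun setT (Y k).
Proof. exact: measurableT_comp mphi (measurable_triple iid k). Qed.

Let lawY k (C : set R) : measurable C -> pr P (Y k @^-1` C) = pr P (Y 0%N @^-1` C).
Proof. by move=> mC; exact: (law_triple iid k (mpre mC)). Qed.

Let t_ge0 theta s : 0 <= up_tail P Y theta s. Proof. exact: pr_ge0. Qed.
Let u_ge0 theta s : 0 <= down_tail P Y theta s. Proof. exact: pr_ge0. Qed.

Let mray x : measurable [set w | x < Y 0%N w].
Proof.
have := mY 0%N measurableT (measurable_itv `]x, +oo[).
by rewrite setTI; congr measurable; apply/seteqP; split => w /=; rewrite in_itv /= andbT.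
Qed.

(** One level x0 serves every m and E, hence every time at which the big jump may occur. *)
Lemma tight_walk e : 0 < e -> exists2 x0, 0 <= x0 & forall m E,
  cylinder_class sig (fun i => (m <= i)%N) E ->
  pr P (E `&` walk_exceeds Y 0 m x0) <= e * pr P E.
Proof.
move=> e0; pose EY0 := Ex P (Y 0%N); have EYn : EY0 < 0 := EY.
(* The drift becomes 4 lattice units per step, well above the rounding cost 1. *)
pose theta := - EY0 / 4.
have th0 : 0 < theta by rewrite /theta; lra.
have Eth : EY0 / theta = - 4.
  by rewrite /theta; field; lra.
have bal1 : 1 < - (Ex P (Y 0%N) / theta) - 1 by rewrite -/EY0 Eth; lra.
have bal := walk_balance iY th0 bal1.
have [|K [h [hs hsmall]]] := @tight_supersol _ (up_tail P Y theta) (down_tail P Y theta) _ 1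
   (t_ge0 theta) _ (psum_up_tail_le iY th0) (u_ge0 theta) (sum_down_tail_le iY th0) ltr01 bal.
  move=> m n mn; apply: le_pr => // w /=; apply: le_lt_trans.
  by rewrite ler_pM2r // lerD2r ler_nat.
have [N _ hN] := hsmall _ e0.
exists (N%:R * theta); first by apply: mulr_ge0 => //; exact: ltW.
move=> m E cE.
have cE' : cylinder_class sig (fun i => (i < 0)%N || (0 + m <= i)%N) E by [].
apply: le_trans (walk_supersol (iid_indep iid) (sigma_n_measurable iid) FY mY lawY th0 hs N cE') _.
by rewrite mulrC; apply: ler_wpM2r; [exact: pr_ge0|exact: (hN N (leqnn N))].
Qed.

Variable H : R -> R.
Hypotheses (H0 : forall x, 0 <= H x) (Hm : forall x y, x <= y -> H y <= H x).
Hypothesis Hsub : subexp_tail_law H.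
Variable c : R.
Hypothesis domY : forall e, 0 < e -> \forall s \near +oo,
  pr P [set w | s < Y 0%N w] <= (1 + e) * H (s - c).
Local Notation G := (dens_tail H).
Local Notation M := (dens_total H).

Lemma walk_sup_bound b : M < b * - Ex P (Y 0%N) ->
  \forall x \near +oo, pr P [set w | exists j, x < \sum_(i < j) Y i w] <= b * G x.
Proof.
move=> hb; have EYn := EY; set EY0 := Ex P (Y 0%N) in EYn hb.
have M0 := dens_total_gt0 H0 Hm Hsub.
have EY0' : 0 < - EY0 by rewrite oppr_gt0.
have b0 : 0 < b by rewrite -(pmulr_lgt0 _ EY0'); apply: lt_trans hb.
(* The gap from b' to b pays for moving from the lattice level below x to x. Of the margin [dl], dl
   / 2 pays for the tail comparison and dl / 4 for rounding. *)
pose b' := (b + M / - EY0) / 2.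
have Mb : M / - EY0 < b by rewrite ltr_pdivrMr.
have ME0 : 0 < M / - EY0 by exact: divr_gt0.
have b'0 : 0 < b' by rewrite /b'; lra.
have b'b : b' < b by rewrite /b'; lra.
have hb' : M < b' * - EY0 by rewrite -ltr_pdivrMr // /b'; lra.
pose dl := b' * - EY0 - M.
have dl0 : 0 < dl by rewrite subr_gt0.
pose e := dl / (2 * M).
have e0 : 0 < e by apply: divr_gt0 => //; lra.
have eM : e * M = dl / 2 by rewrite /e invfM mulrA divfK // lt0r_neq0.
pose theta := dl / (8 * b').
have th0 : 0 < theta by apply: divr_gt0 => //; lra.
have bth : b' * theta = dl / 8.
  by rewrite /theta; field; rewrite lt0r_neq0.
(* Rounding costs 1 in [walk_balance]; the other 1 makes that inequality strict. *)
pose a0 := - EY0 / theta - 2.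
pose C := (1 + e) * M / theta.
have C0 : 0 <= C by apply: divr_ge0; [apply: mulr_ge0; lra|exact: ltW].
have Ca : C < b' * a0.
  rewrite /C ltr_pdivrMr // /a0 -mulrA mulrBl divfK ?lt0r_neq0 //.
  rewrite mulrBr mulrDl mul1r eM.
  have -> : b' * (2 * theta) = 2 * (b' * theta) by rewrite mulrCA.
  by rewrite bth /dl; lra.
have a00 : 0 < a0 by rewrite -(pmulr_rgt0 _ b'0); exact: le_lt_trans Ca.
have bal1 : a0 < - (Ex P (Y 0%N) / theta) - 1 by rewrite -/EY0 /a0; lra.
have bal := walk_balance iY th0 bal1.
pose p := (Num.truncn (c / theta)).+1.
have pc : c <= p%:R * theta.
  by rewrite -ler_pdivrMr //; exact: ltW (truncnS_gt _).
(* Since c <= p * theta, the tail is at most (1 + e) * H at (s - p.+1) * theta. As H is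
   nonincreasing, this value is below its mean over the preceding cell, which is a difference of
   G. *)
have tF : \forall s \near \oo,
    up_tail P Y theta s <= shifted_diff (fun n => G (n%:R * theta)) C p.+1 s.
  have [x1 [_ hx1]] := domY e0.
  exists ((Num.truncn (x1 / theta)).+1 + p.+2)%N => // s /= hs.
  have h1 : x1 < (s%:R - 1) * theta.
    rewrite -ltr_pdivrMr //; apply: lt_le_trans (truncnS_gt _) _.
    have : ((Num.truncn (x1 / theta)).+1 + 1)%:R <= s%:R :> R by rewrite ler_nat; (move: hs; clear; lia).
    by rewrite natrD; lra.
  have h2 : up_tail P Y theta s <= (1 + e) * H ((s%:R - 1) * theta - c) := hx1 _ h1.
  apply: le_trans h2 _; rewrite /shifted_diff.
  have sE : (s - p.+2).+1 = (s - p.+1)%N by (move: hs; clear; lia).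
  rewrite sE.
  have h3 : H ((s%:R - 1) * theta - c) <= H ((s - p.+1)%N%:R * theta).
    apply: Hm; rewrite natrB; last by (move: hs; clear; lia).
    by rewrite -natr1 mulrBl mulrDl mulrBl; lra.
  have j0 (j : nat) : 0 <= j%:R * theta by apply: mulr_ge0 => //; exact: ltW.
  have h5 : (s - p.+2)%N%:R * theta <= (s - p.+1)%N%:R * theta.
    by rewrite ler_pM2r // ler_nat; (move: hs; clear; lia).
  have := dens_tailB_ge H0 Hm Hsub (j0 (s - p.+2)%N) h5; rewrite -mulrBl -{1}sE -natr1 addrAC subrr add0r mul1r => h6.
  set dG := G _ - G _ in h6 *.
  have -> : C * dG = (1 + e) * (M * dG / theta) by rewrite /C; ring.
  apply: ler_wpM2l; first lra.
  apply: le_trans h3 _; rewrite ler_pdivlMr //.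
  by rewrite mulrC; exact: h6.
have lat := dens_tail_lattice H0 Hm Hsub th0.
have [K [h [hs [N1 _ hN1]]]] := @subexp_supersol _ (fun n => G (n%:R * theta)) (up_tail P Y theta)
   (down_tail P Y theta) p.+1 C _ a0 b' lat C0
   (t_ge0 theta) (psum_up_tail_le iY th0) (u_ge0 theta) (sum_down_tail_le iY th0) a00 bal tF Ca.
pose e2 := (b - b') / b'.
have e20 : 0 < e2 by apply: divr_gt0 => //; lra.
have [N2 _ hN2] := dens_tail_lattice_long_tail H0 Hm Hsub 1 th0 e20.
exists ((N1 + N2)%:R * theta); split; first exact: num_real.
move=> x hx.
have x0 : 0 <= x by apply: le_trans (ltW hx); apply: mulr_ge0 => //; exact: ltW.
pose n := Num.truncn (x / theta).
have /andP[nx xn] := truncn_itv (divr_ge0 x0 (ltW th0)).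
have Nn : (N1 + N2 <= n)%N.
  rewrite -ltnS -(ltr_nat R).
  by apply: le_lt_trans xn; rewrite ler_pdivlMr //; exact: ltW.
have nx' : n%:R * theta <= x by rewrite -ler_pdivlMr.
have xn' : x <= n.+1%:R * theta by rewrite -ler_pdivrMr //; exact: ltW.
have mW y : measurable [set w | exists j, y < \sum_(i < j) Y i w].
  have -> : [set w | exists j, y < \sum_(i < j) Y i w] = \bigcup_m walk_exceeds Y 0 m y.
    apply/seteqP; split => w.
      by move=> [j hj]; exists j => //; exists j => //; rewrite add0n big_mkord.
    by move=> [m _ [j _]]; rewrite add0n big_mkord => hj; exists j.
  by apply: bigcupT_measurable => m; exact: measurable_walk_exceeds.
apply: (@le_trans _ _ (pr P [set w | exists j, n%:R * theta < \sum_(i < j) Y i w])).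
  by apply: le_pr => // w [j hj]; exists j; exact: le_lt_trans hj.
apply: le_trans (walk_sup_supersol (iid_indep iid) (sigma_n_measurable iid) FY mY lawY th0 hs n) _.
apply: le_trans (hN1 n _) _; first by rewrite /=; move: Nn; clear; lia.
have := hN2 n.+1 => /= /(_ ltac:(move: Nn; clear; lia)); rewrite subn1 /= => h1.
have h2 : G (n.+1%:R * theta) <= G x by exact: (dens_tail_noninc H0 Hm Hsub).
apply: (@le_trans _ _ (b' * ((1 + e2) * G x))).
  apply: ler_wpM2l; first exact: ltW.
  by apply: le_trans h1 _; apply: ler_wpM2l => //; lra.
have -> : b' * ((1 + e2) * G x) = b * G x.
  rewrite mulrA; congr (_ * _); rewrite mulrDr mulr1 /e2 mulrC divfK ?lt0r_neq0 //; lra.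
by [].
Qed.

End TripleWalk.

(** * Pathwise bounds *)

Section LogBounds.
Context {R : realType}.
Implicit Types y s : R.

Lemma le_expR_logp y : y <= expR (logp y).
Proof.
have [y0|y0] := leP y 0; first exact: le_trans y0 (expR_ge0 _).
by rewrite -{1}(lnK (x := y)) ?posrE // ler_expR le_max lexx.
Qed.

Lemma logp_ge0 y : 0 <= logp y.
Proof. by rewrite /logp le_max lexx orbT. Qed.

Lemma ltr_expR_ln s y : 0 <= s -> (s < ln y) = (expR s < y).
Proof.
move=> s0; have [y0|y0] := leP y 0.
  rewrite ln0 //; apply/idP/idP => h; first by lra.
  by have := expR_gt0 s; lra.
by rewrite -[in RHS](lnK (x := y)) ?posrE // ltr_expR.
Qed.

Lemma ltr_logp s y : 0 <= s -> (s < logp y) = (expR s < y).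
Proof.
move=> s0; rewrite -ltr_expR_ln // /logp lt_max.
by rewrite [s < 0]ltNge s0 orbF.
Qed.

End LogBounds.

Section PathwiseBounds.
Context {R : realType} {T : Type}.
Variables (Psi : nat -> T -> R -> R) (A B D : nat -> T -> R) (w : T).
Hypothesis A0 : forall k, 0 < A k w.
Hypothesis Psi0 : forall k z, 0 < Psi k w z.
Local Notation Z := (fun k m x => comp_range (fun i => Psi i w) k m x).

Lemma comp_range_ge0 k m x : 0 <= x -> 0 <= Z k m x.
Proof. by case: m => [|m] //= _; exact: ltW. Qed.

(** Backward induction on exp(S k) times the inner composition from k on. With q = exp(- g1), a
    bound x * q at k.+1 and a walk below its level give at k the bound q * (x * q + x * (1 - q)) = x
    * q. The level [sthr] is the one for which this closes. *)
Lemma Zproc_le_walk g1 g2 x n : 0 < g1 -> 0 < x ->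
  (forall k z, Psi k w z <= A k w * Num.max z 0 + Num.max (B k w) 0 + D k w) ->
  (forall j, (j <= n)%N -> Swalk A B D g1 g2 j w <= sthr g1 g2 x) ->
  Zproc Psi n w <= x.
Proof.
move=> g10 x0 hup hS.
pose S j := Swalk A B D g1 g2 j w.
pose q := expR (- g1).
have q0 : 0 < q by exact: expR_gt0.
have q1 : q < 1 by rewrite /q -expR0 ltr_expR; lra.
pose c := expR (sthr g1 g2 x + g2).
have cE : c = x * (1 - q).
  rewrite /c /sthr (_ : _ + g2 = ln x + ln (1 - q)); last by rewrite /q; lra.
  by rewrite expRD !lnK ?posrE // subr_gt0.
have key m k : (k + m = n)%N -> expR (S k) * Z k m 0 <= x * q.
  elim: m k => [|m IH] k kn /=; first by rewrite mulr0; apply: mulr_ge0; exact: ltW.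
  set z := comp_range _ _ _ _.
  have z0 : 0 <= z by exact: comp_range_ge0.
  have IHk : expR (S k.+1) * z <= x * q by apply: IH; lia.
  have SE : S k.+1 = S k + Yvar A B D g1 g2 k w by rewrite /S /Swalk big_ord_recr.
  have Sk : expR (S k.+1 + g2) <= c.
    by rewrite ler_expR lerD2r; apply: hS; lia.
  have YA : A k w <= expR (Yvar A B D g1 g2 k w) * q.
    rewrite -expRD -{1}(lnK (x := A k w)) ?posrE // ler_expR /Yvar.
    by rewrite addrK le_max lexx orbT.
  have YB : Num.max (B k w) 0 + D k w <= expR (Yvar A B D g1 g2 k w + g2) * q.
    apply: le_trans (le_expR_logp _) _; rewrite -expRD ler_expR /Yvar.
    rewrite -[leRHS]addrA -[leRHS]addrA (_ : g1 + (g2 - g1) = g2); last by lra.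
    by rewrite -lerBlDr le_max lexx.
  have h1 : Psi k w z <= expR (Yvar A B D g1 g2 k w) * q * z + expR (Yvar A B D g1 g2 k w + g2) * q.
    apply: le_trans (hup k z) _; rewrite (max_idPl z0) -addrA; apply: lerD => //.
    exact: ler_wpM2r.
  apply: (@le_trans _ _ (expR (S k) * (expR (Yvar A B D g1 g2 k w) * q * z +
      expR (Yvar A B D g1 g2 k w + g2) * q))).
    by apply: ler_wpM2l => //; exact: expR_ge0.
  have -> : expR (S k) * (expR (Yvar A B D g1 g2 k w) * q * z +
      expR (Yvar A B D g1 g2 k w + g2) * q) = q * (expR (S k.+1) * z + expR (S k.+1 + g2)).
    by rewrite SE !expRD; ring.
  rewrite [x * q]mulrC; apply: ler_wpM2l; first exact: ltW.
  by move: Sk; rewrite cE; lra.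
have := key n 0%N (add0n n); rewrite /S /Swalk big_ord0 expR0 mul1r /Zproc => h.
apply: le_trans h _; rewrite -[leRHS]mulr1; apply: ler_wpM2l; exact: ltW.
Qed.

(** The k-th term |B - D| enters with weight exp(L k), and L k <= S k - k * g1 bounds the product by
    exp(K + g2) * q ^ k.+1. The subtracted constant is the sum of this geometric series, independent
    of n. *)
Lemma comp_range_ge g1 g2 K n v : 0 < g1 ->
  (forall k z, A k w * z + B k w - D k w <= Psi k w z) ->
  (forall j, (j <= n)%N -> \sum_(i < j)
     (Num.max (logp `|B i w - D i w| - g2) (ln (A i w)) + g1) <= K) ->
  expR (\sum_(i < n) ln (A i w)) * v - expR (K + g2) * expR (- g1) / (1 - expR (- g1))
    <= Z 0%N n v.
Proof.
move=> g10 hlow hS.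
pose Y i := Num.max (logp `|B i w - D i w| - g2) (ln (A i w)) + g1.
pose S j := \sum_(i < j) Y i.
pose L j := \sum_(i < j) ln (A i w).
pose q := expR (- g1).
have q0 : 0 < q by exact: expR_gt0.
have q1 : q < 1 by rewrite /q -expR0 ltr_expR; lra.
pose c := expR (K + g2).
have LS k : L k <= S k - k%:R * g1.
  elim: k => [|k IH]; first by rewrite /L /S !big_ord0 mul0r subr0.
  rewrite /L /S !big_ord_recr /= -/(L k) -/(S k) -natr1.
  have : ln (A k w) <= Y k - g1 by rewrite /Y addrK le_max lexx orbT.
  lra.
have eq k : expR (- (k%:R * g1)) = q ^+ k.
  elim: k => [|k IH]; first by rewrite mul0r oppr0 expR0.
  by rewrite exprS -IH -expRD -natr1; congr expR; lra.
have key m k : (k + m = n)%N ->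
   expR (L n) * v - c * q ^+ k.+1 / (1 - q) <= expR (L k) * Z k m v.
  elim: m k => [|m IH] k kn /=.
    have -> : k = n by lia.
    rewrite gerBl; apply: divr_ge0; last lra.
    by apply: mulr_ge0; [exact: expR_ge0|apply: exprn_ge0; exact: ltW].
  set z := comp_range _ _ _ _.
  have IHk : expR (L n) * v - c * q ^+ k.+2 / (1 - q) <= expR (L k.+1) * z by apply: IH; lia.
  have LE : L k.+1 = L k + ln (A k w) by rewrite /L big_ord_recr.
  have Sk : S k.+1 <= K by apply: hS; lia.
  have BD : expR (L k) * `|B k w - D k w| <= c * q ^+ k.+1.
    apply: (@le_trans _ _ (expR (L k) * expR (Y k - g1 + g2))).
      apply: ler_wpM2l; first exact: expR_ge0.
      apply: le_trans (le_expR_logp _) _; rewrite ler_expR /Y addrK -lerBlDr.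
      by rewrite le_max lexx.
    rewrite -eq /c -!expRD ler_expR -natr1.
    have := LS k; move: Sk; rewrite /S big_ord_recr /= -/(S k); lra.
  have h1 : expR (L k) * (A k w * z - `|B k w - D k w|) <= expR (L k) * Psi k w z.
    apply: ler_wpM2l; first exact: expR_ge0.
    apply: le_trans (hlow k z); have := ler_norm (- (B k w - D k w)); rewrite normrN; lra.
  apply: le_trans h1.
  have -> : expR (L k) * (A k w * z - `|B k w - D k w|) =
      expR (L k.+1) * z - expR (L k) * `|B k w - D k w|.
    by rewrite LE expRD lnK ?posrE //; ring.
  have E : c * q ^+ k.+1 / (1 - q) = c * q ^+ k.+2 / (1 - q) + c * q ^+ k.+1.
    by rewrite [q ^+ k.+2]exprS; field; lra.
  by rewrite E; lra.
have := key n 0%N (add0n n); rewrite /L big_ord0 expR0 mul1r expr1; exact.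
Qed.

(* After a tight past of length n, one jump above u = x * E * expR (beta * n) followed by a step
   landing above c makes both the walk and the process cross their levels. *)
Lemma jump_pathwise g1 g2 gamma1 gamma2 beta c x K1 K2 K3 n :
  let kap := expR (K2 + g2) * expR (- g1) / (1 - expR (- g1)) in
  let u := x * ((1 + kap) * (2 / c) * expR (K3 + 2 * `|gamma2|)) * expR (beta * n%:R) in
  (forall k, 0 < D k w) ->
  (forall k z, A k w * z + B k w - D k w <= Psi k w z) ->
  0 < g1 -> 0 < gamma1 -> 0 < c -> c <= 1 -> 1 <= x -> K1 <= sthr gamma1 gamma2 x ->
  (forall j, (j <= n)%N -> Swalk A B D gamma1 gamma2 j w <= K1) ->
  (forall j, (j <= n)%N -> \sum_(i < j)
     (Num.max (logp `|B i w - D i w| - g2) (ln (A i w)) + g1) <= K2) ->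
  \sum_(i < n) (- ln (A i w) - beta) <= K3 ->
  u < Num.max (A n w) (B n w - D n w) ->
  ~ (c * u / 2 < A n w /\ B n w - D n w <= - (c * u / 2)) ->
  c < Psi n.+1 w 0 ->
  [/\ sthr gamma1 gamma2 x < Swalk A B D gamma1 gamma2 n.+1 w,
      forall m, (m < n.+1)%N -> Swalk A B D gamma1 gamma2 m w <= sthr gamma1 gamma2 x
    & x < Zproc Psi n.+2 w].
Proof.
move=> kap u D0 hlow g10 gam10 c0 c1 x1 K1s hS1 hS2 hS3 hu hneg hc.
have q1 : expR (- g1) < 1 by rewrite -expR0 ltr_expR; lra.
have kap0 : 0 <= kap.
  apply: divr_ge0; last lra.
  by apply: mulr_ge0; exact: expR_ge0.
have c20 : 0 < 2 / c by apply: divr_gt0 => //; lra.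
have c21 : 1 <= 2 / c by rewrite ler_pdivlMr //; lra.
(* 1 + kap pays for the constant subtracted in [comp_range_ge], 2 / c for the loss at the jump, exp
   K3 for the product of the A's, and 2 * |gamma2| for gamma2 in the step Y and in the level. *)
pose E := (1 + kap) * (2 / c) * expR (K3 + 2 * `|gamma2|).
have k1 : 1 <= (1 + kap) * (2 / c).
  by rewrite -[leLHS]mulr1; apply: ler_pM => //; lra.
have E0 : 0 < E by apply: mulr_gt0; [lra|exact: expR_gt0].
have u0 : 0 < u.
  by apply: mulr_gt0; [apply: mulr_gt0; [lra|exact: E0]|exact: expR_gt0].
have lnu : ln u = ln x + ln E + beta * n%:R.
  by rewrite /u -/E !lnM ?posrE ?mulr_gt0 ?expR_gt0 ?expRK //; lra.
have lnE : K3 + 2 * `|gamma2| <= ln E.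
  rewrite lnM ?posrE ?expR_gt0 //; last lra.
  by rewrite expRK lerDr; apply: ln_ge0.
pose L := \sum_(i < n) ln (A i w).
have L3 : - (beta * n%:R) - K3 <= L.
  move: hS3; rewrite sumrB sumrN sumr_const card_ord -mulr_natr /L; lra.
have LS : L <= Swalk A B D gamma1 gamma2 n w.
  apply: ler_sum => i _; rewrite /Yvar.
  apply: (@le_trans _ _ (Num.max (logp (Num.max (B i w) 0 + D i w) - gamma2) (ln (A i w)))); last lra.
  by rewrite le_max lexx orbT.
split.
- have Yn : ln u - `|gamma2| < Yvar A B D gamma1 gamma2 n w.
    rewrite /Yvar; apply: (@le_lt_trans _ _ (Num.max (logp (Num.max (B n w) 0 + D n w) - gamma2) (ln (A n w)))); last lra.
    move: hu; rewrite lt_max => /orP[hu|hu]; rewrite le_max; apply/orP.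
      right; have : ln u <= ln (A n w) by rewrite ler_ln ?posrE // ltW.
      by have := normr_ge0 gamma2; lra.
    left; set y := _ + D n w.
    have uy : u <= y.
      have : B n w <= Num.max (B n w) 0 by rewrite le_max lexx.
      by have := D0 n; rewrite /y; lra.
    have : ln u <= logp y.
      rewrite /logp le_max ler_ln ?posrE ?uy //; lra.
    by have := ler_norm gamma2; lra.
  rewrite /Swalk big_ord_recr /= -/(Swalk A B D gamma1 gamma2 n w) /sthr.
  have : ln (1 - expR (- gamma1)) <= 0.
    by apply: ln_le0; have := expR_gt0 (- gamma1); lra.
  by have := ler_norm (- gamma2); rewrite normrN; lra.
- by move=> m mn; apply: le_trans K1s; exact: hS1.
set z := Psi n.+1 w 0 in hc.
pose v := Psi n w z.
have hv : c * u / 2 < v.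
  apply: (@lt_le_trans _ _ (A n w * z + B n w - D n w)); last exact: hlow.
  have cu0 : 0 < c * u by exact: mulr_gt0.
  have cu : c * u <= u by apply: ler_piMl => //; exact: ltW.
  have Az : A n w * c < A n w * z by rewrite ltr_pM2l.
  have Ac : 0 < A n w * c by exact: mulr_gt0.
  (* If A exceeds u, the excluded event forces B - D above - c * u / 2. Otherwise B - D exceeds u,
     and A * z > 0 suffices. *)
  move: hu; rewrite lt_max; have [hA _|hA /= hu] := ltP u (A n w); last lra.
  have hB : - (c * u / 2) < B n w - D n w.
    by rewrite ltNge; apply/negP => h; apply: hneg; split => //; lra.
  have : c * u < A n w * c by rewrite mulrC ltr_pM2r.
  lra.
have -> : Zproc Psi n.+2 w = Z 0%N n v.
  by rewrite /Zproc -addn2 -(comp_rangeD _ 0 n 2).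
have := comp_range_ge v g10 hlow hS2; rewrite -/kap -/L => h; apply: lt_le_trans h.
have eL : expR (- (beta * n%:R) - K3) <= expR L by rewrite ler_expR.
have cu0 : 0 < c * u / 2 by apply: divr_gt0 => //; exact: mulr_gt0.
have h1 : expR L * (c * u / 2) < expR L * v by rewrite ltr_pM2l // expR_gt0.
have h2 : expR (- (beta * n%:R) - K3) * (c * u / 2) <= expR L * (c * u / 2).
  by apply: ler_wpM2r => //; exact: ltW.
have h3 : expR (- (beta * n%:R) - K3) * (c * u / 2) = x * (1 + kap) * expR (2 * `|gamma2|).
  rewrite /u !expRD (mulrC beta).
  have e1 : expR (- (n%:R * beta)) * expR (n%:R * beta) = 1 by rewrite -expRD addNr expR0.
  have e2 : expR (- K3) * expR K3 = 1 by rewrite -expRD addNr expR0.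
  set a1 := expR (- (n%:R * beta)) in e1 *; set a2 := expR (n%:R * beta) in e1 *.
  set b1 := expR (- K3) in e2 *; set b2 := expR K3 in e2 *.
  set g := expR (2 * _).
  have -> : a1 * b1 * (c * (x * ((1 + kap) * (2 / c) * (b2 * g)) * a2) / 2) =
    (a1 * a2) * (b1 * b2) * (x * (1 + kap) * g) by field; lra.
  by rewrite e1 e2 !mul1r.
have h4 : x * (1 + kap) * 1 <= x * (1 + kap) * expR (2 * `|gamma2|).
  apply: ler_wpM2l; first by apply: mulr_ge0; lra.
  by rewrite -expR0 ler_expR mulr_ge0.
have h5 : kap <= x * kap by apply: ler_peMl.
lra.
Qed.

End PathwiseBounds.

(** * Integrability of logarithms and of the walk steps *)

Section LogMoments.
Context {R : realType} {d : measure_display} {T : measurableType d}.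
Variable P : probability T R.

Lemma measurable_logp : measurable_fun setT (@logp R).
Proof. by apply: measurable_maxr => //; exact: measurable_ln. Qed.

Lemma integrableR_logp (y : T -> R) : measurable_fun setT y ->
  (\int[P]_w (logp (y w))%:E < +oo)%E -> integrableR P (fun w => logp (y w)).
Proof.
move=> my h; apply/integrableP; split.
  apply/measurable_EFinP; exact: measurableT_comp measurable_logp my.
rewrite (eq_integral (fun w => (logp (y w))%:E)) // => w _ /=.
by rewrite ger0_norm // logp_ge0.
Qed.

Lemma le_addr1_powR (x e : R) : 0 <= x -> 0 < e -> x <= 1 + x `^ (1 + e).
Proof.
move=> x0 e0; have p0 : 0 <= x `^ (1 + e) by exact: powR_ge0.
have [x1|x1] := leP x 1; first by lra.
have : x `^ 1 <= x `^ (1 + e) by rewrite ler_powR; [lra|exact: ltW|lra].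
by rewrite powRr1 //; lra.
Qed.

(** The positive part is dominated through the moment of log^+ max(a, b); the negative part is
    finite because the integral is not -oo. *)
Lemma integrableR_ln (a b : T -> R) (eta : R) :
  measurable_fun setT a -> measurable_fun setT b ->
  (-oo < \int[P]_w (ln (a w))%:E)%E -> 0 < eta ->
  (\int[P]_w ((logp (Num.max (a w) (b w))) `^ (1 + eta))%:E < +oo)%E ->
  integrableR P (fun w => ln (a w)).
Proof.
move=> ma mb hneg eta0 hpos.
pose f : T -> \bar R := fun w => (ln (a w))%:E.
have mln : measurable_fun setT (fun w => ln (a w)) by exact: measurableT_comp (@measurable_ln R) ma.
have mf : measurable_fun setT f by exact/measurable_EFinP.
have mmax : measurable_fun setT (fun w => Num.max (a w) (b w)) by exact: measurable_maxr.
have pos : (\int[P]_w f^\+ w < +oo)%E.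
  pose g w := 1 + (logp (Num.max (a w) (b w))) `^ (1 + eta).
  apply: (@le_lt_trans _ _ (\int[P]_w (g w)%:E)%E).
    apply: ge0_le_integral => //.
    - exact: measurable_funepos.
    - apply/measurable_EFinP; apply: measurable_funD => //.
      apply: (measurableT_comp (@measurable_powR R (1 + eta))).
      exact: measurableT_comp measurable_logp mmax.
    - move=> w _; rewrite funeposE /f -EFin_max lee_fin ge_max; apply/andP; split; last first.
        by apply: addr_ge0 => //; exact: powR_ge0.
      apply: le_trans (le_addr1_powR (logp_ge0 _) eta0).
      have [a0|a0] := leP (a w) 0; first by rewrite ln0 // logp_ge0.
      rewrite /logp le_max; apply/orP; left.
      by rewrite ler_ln ?posrE // ?lt_max ?a0 // le_max lexx.
  rewrite /g; under eq_integral do rewrite EFinD.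
  rewrite ge0_integralD //.
  - by rewrite -(EFin_Ex (integrableR_cst P 1)) Ex_cst lte_add_pinfty // ltry.
  - by move=> w _; rewrite lee_fin powR_ge0.
  - apply/measurable_EFinP; apply: (measurableT_comp (@measurable_powR R (1 + eta))).
    exact: measurableT_comp measurable_logp mmax.
have neg : (\int[P]_w f^\- w < +oo)%E.
  rewrite ltNge leye_eq; apply/negP => /eqP E.
  by move: hneg; rewrite integralE E addeNy ltxx.
apply/integrableP; split => //.
rewrite (eq_integral (fun w => f^\+ w + f^\- w)%E); last first.
  by move=> w _; rewrite -[RHS]/((f^\+ \+ f^\-)%E w) -fune_abse.
rewrite ge0_integralD //; [exact: lte_add_pinfty|exact: measurable_funepos|exact: measurable_funeneg].
Qed.

Variables (l f : T -> R).
Hypotheses (il : integrableR P l) (l0 : forall w, 0 <= l w) (if' : integrableR P f).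

Lemma integrableR_walk_step g1 g2 : integrableR P (fun w => Num.max (l w - g2) (f w) + g1).
Proof.
have ml := integrableR_meas il; have mf := integrableR_meas if'.
apply: integrableRD; last exact: integrableR_cst.
apply: (integrableR_le (g := fun w => l w + `|g2| + `|f w|)).
- by apply: measurable_maxr => //; apply: measurable_funB.
- move=> w; have h1 := l0 w; have h2 := ler_norm g2; have h3 := ler_norm (- g2).
  have h4 := ler_norm (f w); have h5 := ler_norm (- f w); rewrite !normrN in h3 h5.
  by rewrite ler_norml; have [h|h] := leP (l w - g2) (f w); apply/andP; split; lra.
- apply: integrableRD; last exact: integrableR_norm.
  by apply: integrableRD => //; exact: integrableR_cst.
Qed.

(** For each w the maximum equals f w once g2 is large, so its expectation tends to that of f by
    dominated convergence. *)
Lemma Ex_walk_step_close dl : 0 < dl -> exists g1 g2, [/\ 0 < g1, 0 <= g2 &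
  Ex P (fun w => Num.max (l w - g2) (f w) + g1) <= Ex P f + dl].
Proof.
move=> dl0.
have ml := integrableR_meas il; have mf := integrableR_meas if'.
have d20 : 0 < dl / 2 by lra.
have mfn n : measurable_fun setT (fun w => Num.max (l w - n%:R) (f w)).
  by apply: measurable_maxr => //; apply: measurable_funB.
have bfn n w : `|Num.max (l w - n%:R) (f w)| <= l w + `|f w|.
  have h1 := l0 w; have n0 : 0 <= n%:R :> R by [].
  have h4 := ler_norm (f w); have h5 := ler_norm (- f w); rewrite !normrN in h5.
  by rewrite ler_norml; have [h|h] := leP (l w - n%:R) (f w); apply/andP; split; lra.
have ig : integrableR P (fun w => l w + `|f w|).
  by apply: integrableRD => //; exact: integrableR_norm.
have cv w : \forall n \near \oo, Num.max (l w - n%:R) (f w) = f w.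
  exists (Num.truncn (l w - f w)).+1 => // n /= hn; apply/max_idPr.
  have := truncnS_gt (l w - f w).
  have : (Num.truncn (l w - f w)).+1%:R <= n%:R :> R by rewrite ler_nat.
  lra.
have [N _ hN] := Ex_dominated mfn bfn ig cv if' d20.
exists (dl / 2), N%:R; split => //.
rewrite ExD; [|exact: integrableR_le (mfn N) (bfn N) ig|exact: integrableR_cst].
have := hN N (leqnn N); rewrite Ex_cst ler_norml /= => /andP[_ h]; lra.
Qed.

End LogMoments.

(** * Upper and lower bounds *)

Lemma near_ln_shift {R : realType} (Q : R -> Prop) (c : R) :
  (\forall s \near +oo, Q s) -> \forall x \near +oo, Q (ln x + c).
Proof.
move=> [s0 [_ hs0]]; exists (expR (s0 - c)); split; first exact: num_real.
move=> x hx; apply: hs0; have x0 : 0 < x by apply: lt_trans hx; exact: expR_gt0.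
by rewrite -ltrBlDr -(ltr_expR (s0 - c)) lnK ?posrE.
Qed.

(** All relative errors are measured by e: the tail comparisons leave the factor 1 - 5 * e, and (1 -
    3 * e) * (1 - e) * (1 - 5 * e) >= 1 - 9 * e. *)
Lemma lower_bound_arith {R : realFieldType} (e M b beta g G0 GN G1 GN1 S S' p : R) :
  0 < e -> e <= 1 / 18 -> 0 < M -> 0 < beta -> b * beta = (1 - 9 * e) * M ->
  0 < g -> 0 <= GN1 -> g <= (1 + e) * G0 -> G1 <= (1 + e) * g -> GN <= e * G0 ->
  M * (G0 - GN) <= beta * S -> beta * S' <= M * (G1 - GN1) ->
  (1 - 3 * e) * (1 - e) * ((1 - e) * S - e * S') <= p -> b * g <= p.
Proof.
move=> e0 e18 M0 beta0 hb g0 GN10 t1 t2 tN l1 l2 hp.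
have Mg0 : 0 < M * g by exact: mulr_gt0.
have ee : 0 <= e * e by exact: mulr_ge0 (ltW e0) (ltW e0).
have eee : e * e * e <= e * e * (1 / 18) by exact: ler_wpM2l.
have G00 : 0 < G0.
  rewrite ltNge; apply/negP => G00.
  have : (1 + e) * G0 <= 0 by apply: mulr_ge0_le0 => //; lra.
  lra.
have a1 : (1 - e) * g <= G0.
  have h1 : (1 - e) * g <= (1 - e) * ((1 + e) * G0) by apply: ler_wpM2l => //; lra.
  have h2 : 0 <= e * e * G0 by apply: mulr_ge0 => //; lra.
  move: h1 h2; clear; lra.
have a2 : M * ((1 - e) * ((1 - e) * g)) <= beta * S.
  apply: le_trans l1; rewrite ler_pM2l //.
  have h1 : (1 - e) * ((1 - e) * g) <= (1 - e) * G0 by apply: ler_wpM2l => //; lra.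
  move: h1 tN; clear; lra.
have a3 : beta * S' <= M * ((1 + e) * g).
  apply: le_trans l2 _; rewrite ler_pM2l //; move: t2 GN10; clear; lra.
have a4 : (1 - 5 * e) * (M * g) <= beta * ((1 - e) * S - e * S').
  have b1 : (1 - e) * (M * ((1 - e) * ((1 - e) * g))) <= (1 - e) * (beta * S).
    by apply: ler_wpM2l => //; lra.
  have b2 : e * (beta * S') <= e * (M * ((1 + e) * g)).
    by apply: ler_wpM2l => //; exact: ltW.
  have b3 : (1 - 5 * e) * (M * g) <= ((1 - e) * (1 - e) * (1 - e) - e * (1 + e)) * (M * g).
    apply: ler_wpM2r; first exact: ltW.
    move: ee eee e0 e18; clear; lra.
  move: b1 b2 b3; clear; lra.
rewrite -(ler_pM2l beta0).
apply: (@le_trans _ _ ((1 - 3 * e) * (1 - e) * ((1 - 5 * e) * (M * g)))); last first.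
  apply: (@le_trans _ _ ((1 - 3 * e) * (1 - e) * (beta * ((1 - e) * S - e * S')))).
    by apply: ler_wpM2l => //; apply: mulr_ge0; lra.
  by rewrite mulrCA ler_pM2l.
have -> : beta * (b * g) = (1 - 9 * e) * (M * g) by rewrite mulrA [beta * b]mulrC hb mulrA.
rewrite mulrA; apply: ler_wpM2r; first exact: ltW.
move: ee eee e0 e18; clear; lra.
Qed.

Section Model.
Context {R : realType} {d : measure_display} {T : measurableType d}.
Variables (P : probability T R) (Psi : nat -> T -> R -> R) (A B D : nat -> T -> R).
Hypothesis iid : iid_seq P Psi A B D.
Hypothesis Psi_gt0 : forall n w t, 0 < Psi n w t.
Hypothesis contPsi : forall n w, continuous (Psi n w).
Hypothesis sandwich : {ae P, forall w, forall n z,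
  A n w * z + B n w - D n w <= Psi n w z /\
  Psi n w z <= A n w * Num.max z 0 + Num.max (B n w) 0 + D n w}.
Hypothesis AD_gt0 : {ae P, forall w, 0 < A 0%N w /\ 0 < D 0%N w}.
Hypothesis ilnA : integrableR P (fun w => ln (A 0%N w)).
Hypothesis logBDp : (\int[P]_w (logp `|Num.max (B 0%N w) 0 + D 0%N w|)%:E < +oo)%E.
Hypothesis logBDm : (\int[P]_w (logp `|B 0%N w - D 0%N w|)%:E < +oo)%E.
Hypothesis tailp :
  asym_equiv (fun x => pr P [set w | x < Num.max (A 0%N w) (Num.max (B 0%N w) 0 + D 0%N w)])
             (fun x => pr P [set w | x < Num.max (A 0%N w) (B 0%N w)]).

Definition log_tail s := pr P [set w | s < ln (Num.max (A 0%N w) (B 0%N w))].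
Local Notation H := log_tail.
Hypothesis Hsub : subexp_tail_law H.

Local Notation G := (dens_tail H).
Local Notation M := (dens_total H).
Local Notation mu := (Ex P (fun w => ln (A 0%N w))).
Hypothesis mu_lt0 : mu < 0.

Let mA n : measurable_fun setT (A n). Proof. by case: iid => _ []. Qed.
Let mB n : measurable_fun setT (B n). Proof. by case: iid => _ [_ []]. Qed.
Let mD n : measurable_fun setT (D n). Proof. by case: iid => _ [_ [_ []]]. Qed.

Lemma measurable_gt (f : T -> R) x : measurable_fun setT f -> measurable [set w | x < f w].
Proof.
move=> mf; have := mf measurableT _ (measurable_itv `]x, +oo[).
by rewrite setTI; congr measurable; apply/seteqP; split => w /=; rewrite in_itv /= andbT.
Qed.

Lemma measurable_le (f : T -> R) x : measurable_fun setT f -> measurable [set w | f w <= x].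
Proof.
move=> mf; have := mf measurableT _ (measurable_itv `]-oo, x]).
by rewrite setTI; congr measurable; apply/seteqP; split => w /=; rewrite in_itv.
Qed.

Let mmax : measurable_fun setT (fun w => Num.max (A 0%N w) (B 0%N w)).
Proof. exact: measurable_maxr. Qed.

Let mBp : measurable_fun setT (fun w => Num.max (B 0%N w) 0 + D 0%N w).
Proof. by apply: measurable_funD => //; exact: measurable_maxr. Qed.

Let mBm : measurable_fun setT (fun w => B 0%N w - D 0%N w).
Proof. exact: measurable_funB. Qed.

Lemma log_tail_ge0 s : 0 <= H s.
Proof. exact: pr_ge0. Qed.

Let mlnmax : measurable_fun setT (fun w => ln (Num.max (A 0%N w) (B 0%N w))).
Proof. exact: measurableT_comp (@measurable_ln R) mmax. Qed.

Lemma log_tail_noninc s t : s <= t -> H t <= H s.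
Proof.
move=> st; apply: le_pr; [exact: measurable_gt|exact: measurable_gt|].
by move=> w; exact: le_lt_trans.
Qed.

Lemma log_tailE s : 0 <= s -> H s = pr P [set w | expR s < Num.max (A 0%N w) (B 0%N w)].
Proof. by move=> s0; congr pr; apply/seteqP; split => w /=; rewrite ltr_expR_ln. Qed.

(** If H vanished at s, G would be constant from s on and, tending to 0, would vanish there.
    Positivity makes the ratios in the tail hypotheses genuine quotients. *)
Lemma log_tail_gt0 s : 0 <= s -> 0 < H s.
Proof.
move=> s0; have M0 := dens_total_gt0 log_tail_ge0 log_tail_noninc Hsub.
rewrite lt_neqAle log_tail_ge0 andbT; apply/negP => /eqP H00.
have := dens_tail_gt0 Hsub s; rewrite ltNge => /negP; apply.
apply/ler_addgt0Pr => dl dl0; rewrite add0r.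
have [_ _ _ Gs _] := dens_tail_lattice log_tail_ge0 log_tail_noninc Hsub (@ltr01 R).
have [N _ hN] := Gs _ dl0.
have sN : s <= s + N%:R by rewrite lerDl.
have := dens_tailB_le log_tail_ge0 log_tail_noninc Hsub s0 sN.
rewrite -H00 mulr0 pmulr_rle0 // subr_le0 => h2; apply: le_trans h2 _.
apply: le_trans (hN N (leqnn N)); rewrite mulr1.
by apply: (dens_tail_noninc log_tail_ge0 log_tail_noninc Hsub); lra.
Qed.

Lemma ae_AD_gt0 : {ae P, forall w, forall n, 0 < A n w /\ 0 < D n w}.
Proof.
apply: ae_foralln => n.
pose S : set ((R * R) * R) := [set p | p.1.1 <= 0] `|` [set p | p.2 <= 0].
have mS : measurable S.
  have hle (f : (R * R) * R -> R) : measurable_fun setT f -> measurable [set p | f p <= 0].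
    move=> mf; have := mf measurableT _ (measurable_itv `]-oo, 0]).
    by rewrite setTI; congr measurable; apply/seteqP; split => w /=; rewrite in_itv.
  apply: measurableU; apply: hle.
    exact: measurableT_comp measurable_fst measurable_fst.
  exact: measurable_snd.
have mT k : measurable (triple A B D k @^-1` S).
  by rewrite -[X in measurable X]setTI; exact: (measurable_triple iid k).
have P0 : pr P (triple A B D 0 @^-1` S) = 0.
  apply/eqP; rewrite eq_le pr_ge0 andbT.
  have <- : pr P set0 = 0 by rewrite /pr measure0.
  apply: ae_le_pr => //; move: AD_gt0; apply: filterS => w [a0 d0].
  by case; rewrite /= leNgt ?a0 ?d0.
exists (triple A B D n @^-1` S); split => //.
  transitivity (pr P (triple A B D n @^-1` S))%:E; first exact: esym (EFin_pr P (mT n)).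
  by rewrite (law_triple iid n mS) P0.
move=> w /= h; apply: contrapT => nS; apply: h; split; rewrite ltNge; apply/negP => h'; apply: nS.
  by left.
by right.
Qed.

Lemma integrableR_logBDp : integrableR P (fun w => logp (Num.max (B 0%N w) 0 + D 0%N w)).
Proof.
have mn : measurable_fun setT (fun w => `|Num.max (B 0%N w) 0 + D 0%N w|).
  exact: measurableT_comp mBp.
apply: (integrableR_le (g := fun w => logp `|Num.max (B 0%N w) 0 + D 0%N w|)).
- exact: measurableT_comp measurable_logp mBp.
- move=> w; rewrite ger0_norm ?logp_ge0 //; set y := _ + _.
  have [y0|y0] := leP y 0; last by rewrite gtr0_norm.
  by rewrite {1}/logp ln0 // maxxx logp_ge0.
- exact: integrableR_logp.
Qed.

Lemma integrableR_logBDm : integrableR P (fun w => logp `|B 0%N w - D 0%N w|).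
Proof. by apply: integrableR_logp => //; exact: measurableT_comp mBm. Qed.

(** Steps of the three walks as functions of (A, B, D), so that measurability, independence and
    equality in law come from the triples: Y itself, its analogue for |B - D|, and a step whose sums
    bound those of log A from below. *)
Definition phi_up g1 g2 (p : (R * R) * R) :=
  Num.max (logp (Num.max p.1.2 0 + p.2) - g2) (ln p.1.1) + g1.
Definition phi_low g1 g2 (p : (R * R) * R) :=
  Num.max (logp `|p.1.2 - p.2| - g2) (ln p.1.1) + g1.
Definition phi_log beta (p : (R * R) * R) := - ln p.1.1 - beta.

Let mp11 : measurable_fun setT (fun p : (R * R) * R => p.1.1).
Proof. exact: measurableT_comp measurable_fst measurable_fst. Qed.
Let mp12 : measurable_fun setT (fun p : (R * R) * R => p.1.2).
Proof. exact: measurableT_comp measurable_snd measurable_fst. Qed.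
Let mp2 : measurable_fun setT (fun p : (R * R) * R => p.2).
Proof. exact: measurable_snd. Qed.
Let mlnp : measurable_fun setT (fun p : (R * R) * R => ln p.1.1).
Proof. exact: measurableT_comp (@measurable_ln R) mp11. Qed.

Lemma measurable_phi_up g1 g2 : measurable_fun setT (phi_up g1 g2).
Proof.
apply: measurable_funD => //; apply: measurable_maxr => //; apply: measurable_funB => //.
apply: measurableT_comp measurable_logp _.
by apply: measurable_funD => //; exact: measurable_maxr.
Qed.

Lemma measurable_phi_low g1 g2 : measurable_fun setT (phi_low g1 g2).
Proof.
apply: measurable_funD => //; apply: measurable_maxr => //; apply: measurable_funB => //.
apply: measurableT_comp measurable_logp _.
by apply: measurableT_comp => //; exact: measurable_funB.
Qed.

Lemma measurable_phi_log beta : measurable_fun setT (phi_log beta).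
Proof. by apply: measurable_funB => //; exact: measurableT_comp mlnp. Qed.

(** As g2 >= 0, Y > s forces max(A, B^+ + D) > exp(s - g1), whose probability is asymptotically H (s
    - g1). *)
Lemma Yvar_tail_dominated g1 g2 e : 0 <= g2 -> 0 < e -> \forall s \near +oo,
  pr P [set w | s < Yvar A B D g1 g2 0 w] <= (1 + e) * H (s - g1).
Proof.
move=> g20 e0; move/cvgrPdist_le : tailp => /(_ _ e0) [x0 [_ hx0]].
exists (Num.max 0 (ln x0) + g1); split; first exact: num_real.
move=> s hs; have s0 : 0 <= s - g1.
  by have : 0 <= Num.max 0 (ln x0) by [rewrite le_max lexx]; lra.
have sx : x0 < expR (s - g1).
  have [x00|x00] := leP x0 0; first by apply: le_lt_trans (expR_gt0 _).
  rewrite -{1}(lnK (x := x0)) ?posrE // ltr_expR.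
  by have : ln x0 <= Num.max 0 (ln x0) by [rewrite le_max lexx orbT]; lra.
set y := expR (s - g1) in sx.
apply: (@le_trans _ _ (pr P [set w | y < Num.max (A 0%N w) (Num.max (B 0%N w) 0 + D 0%N w)])).
  apply: le_pr.
  - apply: measurable_gt.
    exact: (measurableT_comp (measurable_phi_up g1 g2) (measurable_triple iid 0)).
  - by apply: measurable_gt; exact: measurable_maxr.
  - move=> w; rewrite /= /Yvar -ltrBlDr !lt_max => /orP[h|h]; apply/orP.
      by right; rewrite -ltr_logp //; lra.
    by left; rewrite -ltr_expR_ln.
rewrite log_tailE // -/y.
have := hx0 y sx => /=; rewrite ler_norml => /andP[h _].
set p := pr P _ in h *; set q := pr P _ in h *.
have q1 : 0 < q by rewrite /q /y -log_tailE //; exact: log_tail_gt0.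
by rewrite -ler_pdivrMr //; lra.
Qed.

Lemma hitting_upper b : M < b * - mu ->
  \forall x \near +oo, pr P [set w | exists n, x < Zproc Psi n w] <= b * G (ln x).
Proof.
move=> hb; set m := mu in hb *; have m0 : m < 0 := mu_lt0.
have M0 := dens_total_gt0 log_tail_ge0 log_tail_noninc Hsub.
have nm0 : 0 < - m by lra.
have b0 : 0 < b by rewrite -(pmulr_lgt0 _ nm0); apply: lt_trans hb.
(* Half of the margin b * |m| - M is spent on replacing E log A by E Y. *)
pose dl := (b * - m - M) / (2 * b).
have dl0 : 0 < dl by apply: divr_gt0; lra.
have bdl : b * dl = (b * - m - M) / 2 by rewrite /dl; field; rewrite lt0r_neq0.
have [g1 [g2 [g10 g20 hE]]] := Ex_walk_step_close integrableR_logBDp (fun w => logp_ge0 _) ilnA dl0.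
rewrite -/m in hE; set EY := Ex _ _ in hE.
have EYb : M < b * - EY.
  have : b * EY <= b * (m + dl) by apply: ler_wpM2l => //; exact: ltW.
  rewrite mulrDr bdl; lra.
have nEY : 0 < - EY by rewrite -(pmulr_rgt0 _ b0); apply: lt_trans EYb.
pose b' := (b + M / - EY) / 2.
have Mb : M / - EY < b by rewrite ltr_pdivrMr.
have ME : 0 < M / - EY by exact: divr_gt0.
have b'0 : 0 < b' by rewrite /b'; lra.
have b'b : b' < b by rewrite /b'; lra.
have hb' : M < b' * - EY by rewrite -ltr_pdivrMr // /b'; lra.
have iY := integrableR_walk_step integrableR_logBDp (fun w => logp_ge0 _) ilnA g1 g2.
have EY0 : EY < 0 by lra.
have dom := fun e (e0 : 0 < e) => Yvar_tail_dominated g1 g20 e0.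
have ws := @walk_sup_bound _ _ _ P Psi A B D iid (phi_up g1 g2) (measurable_phi_up g1 g2)
  iY EY0 H log_tail_ge0 log_tail_noninc Hsub g1 dom b' hb'.
(* Offset of the level [sthr g1 g2 x] from log x; long-tailedness removes it. *)
pose C := - g2 + ln (1 - expR (- g1)).
pose e := (b - b') / b'.
have e0 : 0 < e by apply: divr_gt0 => //; lra.
have ws' := near_ln_shift C ws.
have lt' := near_ln_shift 0 (dens_long_tail log_tail_ge0 log_tail_noninc Hsub (- C) e0).
near=> x.
have x0 : 0 < x by near: x; apply: nbhs_pinfty_gt; exact: num_real.
have h1 : pr P [set w | exists j, ln x + C < \sum_(i < j) phi_up g1 g2 (triple A B D i w)]
   <= b' * G (ln x + C) by near: x.
have h2 : G (ln x + 0 - - C) <= (1 + e) * G (ln x + 0) by near: x.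
rewrite addr0 opprK in h2.
have mZ : measurable [set w | exists n, x < Zproc Psi n w].
  have -> : [set w | exists n, x < Zproc Psi n w] = \bigcup_n [set w | x < Zproc Psi n w].
    by apply/seteqP; split => [w [n hn]|w [n _ hn]]; exists n.
  by apply: bigcupT_measurable => n; apply: measurable_gt; exact: (measurable_Zproc iid contPsi).
have mW : measurable [set w | exists j, ln x + C < \sum_(i < j) phi_up g1 g2 (triple A B D i w)].
  have -> : [set w | exists j, ln x + C < \sum_(i < j) phi_up g1 g2 (triple A B D i w)] =
     \bigcup_j [set w | ln x + C < \sum_(i < j) phi_up g1 g2 (triple A B D i w)].
    by apply/seteqP; split => [w [n hn]|w [n _ hn]]; exists n.
  apply: bigcupT_measurable => j; apply: measurable_gt; apply: measurable_sum => i.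
  exact: (measurableT_comp (measurable_phi_up g1 g2) (measurable_triple iid i)).
apply: (@le_trans _ _ (b' * G (ln x + C))).
  apply: le_trans h1; apply: ae_le_pr => //.
  near=> w; move=> [n]; rewrite ltNge => /negP hn; apply: contrapT => hW; apply: hn.
  have sw : forall n z, A n w * z + B n w - D n w <= Psi n w z /\
     Psi n w z <= A n w * Num.max z 0 + Num.max (B n w) 0 + D n w by near: w.
  have ad : forall n, 0 < A n w /\ 0 < D n w by near: w; exact: ae_AD_gt0.
  apply: (@Zproc_le_walk _ _ Psi A B D w (fun k => (ad k).1) (fun k z => Psi_gt0 k w z) g1 g2) => //.
    by move=> k z; exact: (sw k z).2.
  move=> j _; rewrite leNgt; apply/negP => hj; apply: hW; exists j.
  by rewrite /C addrA.
apply: (@le_trans _ _ (b' * ((1 + e) * G (ln x)))); first by rewrite ler_pM2l.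
rewrite mulrA; apply: ler_wpM2r; first exact: ltW (dens_tail_gt0 Hsub _).
by rewrite mulrDr mulr1 /e mulrC divfK ?lt0r_neq0 //; lra.
Unshelve. all: by end_near. Qed.

Hypothesis tailm :
  asym_equiv (fun x => pr P [set w | x < Num.max (A 0%N w) (B 0%N w - D 0%N w)])
             (fun x => pr P [set w | x < Num.max (A 0%N w) (B 0%N w)]).
Hypothesis tailneg :
  little_o_infty (fun x => pr P [set w | x < A 0%N w /\ B 0%N w - D 0%N w <= - x])
                 (fun x => pr P [set w | x < Num.max (A 0%N w) (B 0%N w)]).
Hypothesis monoZ : {ae P, forall w, forall n, Zproc Psi n w <= Zproc Psi n.+1 w}.

Definition jump_set (u y : R) : set ((R * R) * R) :=
  [set p | u < Num.max p.1.1 (p.1.2 - p.2)] `\` [set p | y < p.1.1 /\ p.1.2 - p.2 <= - y].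

Lemma measurable_jump_set u y : measurable (jump_set u y).
Proof.
have hgt (f : (R * R) * R -> R) x : measurable_fun setT f -> measurable [set p | x < f p].
  move=> mf; have := mf measurableT _ (measurable_itv `]x, +oo[).
  by rewrite setTI; congr measurable; apply/seteqP; split => w /=; rewrite in_itv /= andbT.
have hle (f : (R * R) * R -> R) x : measurable_fun setT f -> measurable [set p | f p <= x].
  move=> mf; have := mf measurableT _ (measurable_itv `]-oo, x]).
  by rewrite setTI; congr measurable; apply/seteqP; split => w /=; rewrite in_itv.
have mdif : measurable_fun setT (fun p : (R * R) * R => p.1.2 - p.2) by exact: measurable_funB.
apply: measurableD; first by apply: hgt; exact: measurable_maxr.
by apply: measurableI; [exact: hgt|exact: hle].
Qed.

Lemma jump_prob c e : 0 < c -> 0 < e -> \forall u \near +oo,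
  (1 - e) * H (ln u) - e * H (ln (c * u / 2))
    <= pr P (triple A B D 0 @^-1` jump_set u (c * u / 2)).
Proof.
move=> c0 e0.
move/cvgrPdist_le : tailm => /(_ _ e0) [u1 [_ hu1]].
move/cvgrPdist_le : tailneg => /(_ _ e0) [u2 [_ hu2]].
(* The bounds by 1 keep both logarithms nonnegative, as [log_tailE] requires; the factor 2 / c
   transfers the condition on y = c * u / 2 to u. *)
exists (Num.max (Num.max u1 1) (Num.max u2 1 * (2 / c))); split; first exact: num_real.
move=> u; rewrite gt_max => /andP[]; rewrite gt_max => /andP[u1u u1'] hu.
set y := c * u / 2.
have : Num.max u2 1 < y.
  by move: hu; rewrite mulrA ltr_pdivrMr // /y ltr_pdivlMr // [u * c]mulrC.
rewrite gt_max => /andP[u2y y1].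
have lnu0 : 0 <= ln u by apply: ln_ge0; exact: ltW.
have lny0 : 0 <= ln y by apply: ln_ge0; exact: ltW.
have Hu : H (ln u) = pr P [set w | u < Num.max (A 0%N w) (B 0%N w)].
  by rewrite log_tailE // lnK // posrE; lra.
have Hy : H (ln y) = pr P [set w | y < Num.max (A 0%N w) (B 0%N w)].
  by rewrite log_tailE // lnK // posrE; lra.
have h1 := hu1 u u1u; have h2 := hu2 y u2y.
rewrite /= -Hu in h1; rewrite /= -Hy sub0r normrN in h2.
have Hu0 := log_tail_gt0 lnu0; have Hy0 := log_tail_gt0 lny0.
set p1 := pr P _ in h1; set p2 := pr P _ in h2.
have {}h1 : (1 - e) * H (ln u) <= p1.
  rewrite -ler_pdivlMr //; move: h1; rewrite ler_norml => /andP[_]; lra.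
have {}h2 : p2 <= e * H (ln y).
  rewrite -ler_pdivrMr //; exact: le_trans (ler_norm _) h2.
have mW1 : measurable [set w | u < Num.max (A 0%N w) (B 0%N w - D 0%N w)].
  by apply: measurable_gt; exact: measurable_maxr.
have mW2 : measurable [set w | y < A 0%N w /\ B 0%N w - D 0%N w <= - y].
  by apply: measurableI; [exact: measurable_gt|exact: measurable_le].
have -> : triple A B D 0 @^-1` jump_set u y =
  [set w | u < Num.max (A 0%N w) (B 0%N w - D 0%N w)] `\`
  [set w | y < A 0%N w /\ B 0%N w - D 0%N w <= - y] by [].
have := prDI P mW1 mW2; rewrite -/p1 => E.
have : pr P ([set w | u < Num.max (A 0%N w) (B 0%N w - D 0%N w)] `&`
  [set w | y < A 0%N w /\ B 0%N w - D 0%N w <= - y]) <= p2.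
  by apply: le_pr => //; exact: measurableI.
lra.
Qed.

Let mPsi n t : measurable_fun setT (fun w => Psi n w t). Proof. by case: iid. Qed.

Lemma Psi_zero_large e : 0 < e -> exists c, [/\ 0 < c, c <= 1 &
  1 - e <= pr P [set w | c < Psi 0%N w 0]].
Proof.
move=> e0; apply: contrapT => hn.
pose F n := [set w | n.+1%:R^-1 < Psi 0%N w 0].
have : pr P (\bigcup_n F n) <= 1 - e.
  apply: pr_bigcup_le.
  - by move=> n; exact: measurable_gt.
  - move=> m n mn w; apply: le_lt_trans.
    by rewrite lef_pV2 ?posrE ?ltr0n // ler_nat.
  - move=> n; rewrite leNgt; apply/negP => h; apply: hn; exists n.+1%:R^-1; split.
    + by rewrite invr_gt0 ltr0n.
    + by rewrite invf_le1 ?ltr0n // ler1n.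
    + exact: ltW.
have -> : \bigcup_n F n = setT.
  apply/seteqP; split => // w _.
  have p0 := Psi_gt0 0 w 0; exists (Num.truncn (Psi 0%N w 0)^-1) => //.
  rewrite /F /= -[ltRHS]invrK ltf_pV2 ?posrE ?invr_gt0 ?ltr0n //.
  exact: truncnS_gt.
by rewrite pr_setT; lra.
Qed.

Variables gamma1 gamma2 : R.
Hypothesis gamma10 : 0 < gamma1.
Hypothesis EYvar : Ex P (Yvar A B D gamma1 gamma2 0) < 0.
Variable m : nat.
Hypothesis m1 : (1 <= m)%N.

Definition first_passage_event n x := [set w |
  [/\ sthr gamma1 gamma2 x < Swalk A B D gamma1 gamma2 n w,
      forall k, (k < n)%N -> Swalk A B D gamma1 gamma2 k w <= sthr gamma1 gamma2 x
    & x < comp_range (fun i => Psi i w) 0 n (comp_range (fun i => Psi i w) n m 0)]].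

Let mSwalk n : measurable_fun setT (Swalk A B D gamma1 gamma2 n).
Proof.
apply: measurable_sum => i.
exact: (measurableT_comp (measurable_phi_up gamma1 gamma2) (measurable_triple iid i)).
Qed.

Lemma measurable_first_passage n x : measurable (first_passage_event n x).
Proof.
have -> : first_passage_event n x =
  [set w | sthr gamma1 gamma2 x < Swalk A B D gamma1 gamma2 n w] `&`
  (\bigcap_(k in [set k | (k < n)%N]) [set w | Swalk A B D gamma1 gamma2 k w <= sthr gamma1 gamma2 x]) `&`
  [set w | x < Zproc Psi (n + m) w].
  apply/seteqP; split => w; rewrite /first_passage_event /= -{1}[n in comp_range _ n m 0]add0n comp_rangeD.
    by case=> h1 h2 h3.
  by case=> -[h1 h2] h3.
apply: measurableI; first apply: measurableI.
- exact: measurable_gt.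
- by apply: bigcap_measurableType => k _; exact: measurable_le.
- by apply: measurable_gt; exact: (measurable_Zproc iid contPsi).
Qed.

(** The jump at index n, the event that the next map exceeds c at 0, and the first n steps are
    independent. The next map costs 1 - e, and each of the three walks removes a fraction at most
    e. *)
Lemma first_passage_lower e g1 g2 beta c K1 K2 K3 x n :
  let kap := expR (K2 + g2) * expR (- g1) / (1 - expR (- g1)) in
  let u := x * ((1 + kap) * (2 / c) * expR (K3 + 2 * `|gamma2|)) * expR (beta * n%:R) in
  0 < g1 -> 0 < c -> c <= 1 -> 1 <= x -> K1 <= sthr gamma1 gamma2 x ->
  0 < e -> e <= 1 / 18 -> 1 - e <= pr P [set w | c < Psi 0%N w 0] ->
  (forall E, cylinder_class (sigma_n Psi A B D) (fun i => (n <= i)%N) E ->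
    pr P (E `&` walk_exceeds (fun k w => phi_up gamma1 gamma2 (triple A B D k w)) 0 n K1) <= e * pr P E) ->
  (forall E, cylinder_class (sigma_n Psi A B D) (fun i => (n <= i)%N) E ->
    pr P (E `&` walk_exceeds (fun k w => phi_low g1 g2 (triple A B D k w)) 0 n K2) <= e * pr P E) ->
  (forall E, cylinder_class (sigma_n Psi A B D) (fun i => (n <= i)%N) E ->
    pr P (E `&` walk_exceeds (fun k w => phi_log beta (triple A B D k w)) 0 n K3) <= e * pr P E) ->
  (1 - 3 * e) * (1 - e) * pr P (triple A B D 0 @^-1` jump_set u (c * u / 2))
    <= pr P (first_passage_event n.+1 x).
Proof.
move=> kap u g10 c0 c1 x1 K1s e0 e18 hc h1 h2 h3.
set J := jump_set u (c * u / 2).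
have mJ : measurable J by exact: measurable_jump_set.
pose C : set R := `]c, +oo[%classic.
have mC : measurable C by exact: measurable_itv.
have EC : [set w | c < Psi 0%N w 0] = (fun w => Psi 0%N w 0) @^-1` C.
  by apply/seteqP; split => w; rewrite /C /= in_itv /= andbT.
pose E := setT `&` (triple A B D n @^-1` J) `&` ((fun w => Psi n.+1 w 0) @^-1` C).
have FJ : sigma_n Psi A B D n (triple A B D n @^-1` J) := sigma_n_triple mJ.
have FC : sigma_n Psi A B D n.+1 ((fun w => Psi n.+1 w 0) @^-1` C) := sigma_n_Psi 0 mC.
have cE1 : cylinder_class (sigma_n Psi A B D) (fun i => i == n) (setT `&` (triple A B D n @^-1` J)).
  have hh := cylinder_setI (iid_indep iid) (J := fun i => i == n)
    (cylinder_setT (sigma_n Psi A B D) (fun=> false)) FJ isT (eqxx n).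
  by have [] := hh (fun i (h : false) => False_ind _ (notF h)).
have [cE pE] : cylinder_class (sigma_n Psi A B D) (fun i => (n <= i)%N) E /\
    pr P E = pr P (setT `&` (triple A B D n @^-1` J)) * pr P ((fun w => Psi n.+1 w 0) @^-1` C).
  have nn : ~~ (n.+1 == n) by rewrite neq_ltn ltnSn orbT.
  have eqn_le i : (i == n) -> (n <= i)%N by move=> /eqP ->.
  exact: (cylinder_setI (iid_indep iid) (J := fun i => (n <= i)%N) cE1 FC nn (leqnSn n) eqn_le).
have prE : (1 - e) * pr P (triple A B D 0 @^-1` J) <= pr P E.
  rewrite pE setTI (law_triple iid n mJ) (law_Psi0 iid n.+1 mC) -EC mulrC.
  by apply: ler_wpM2l => //; exact: pr_ge0.
have mE : measurable E := cylinder_measurable (sigma_n_measurable iid) cE.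
set W1 := walk_exceeds _ _ _ K1 in h1; set W2 := walk_exceeds _ _ _ K2 in h2.
set W3 := walk_exceeds _ _ _ K3 in h3.
have mT k := measurable_triple iid k.
have mW1 : measurable W1.
  by apply: measurable_walk_exceeds => k; exact: (measurableT_comp (measurable_phi_up _ _) (mT k)).
have mW2 : measurable W2.
  by apply: measurable_walk_exceeds => k; exact: (measurableT_comp (measurable_phi_low _ _) (mT k)).
have mW3 : measurable W3.
  by apply: measurable_walk_exceeds => k; exact: (measurableT_comp (measurable_phi_log _) (mT k)).
pose W := W1 `|` W2 `|` W3.
have mW12 : measurable (W1 `|` W2) by exact: measurableU.
have mW : measurable W by exact: measurableU.
have EW : pr P (E `&` W) <= 3 * e * pr P E.
  have -> : E `&` W = (E `&` W1) `|` (E `&` W2) `|` (E `&` W3) by rewrite /W !setIUr.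
  have m1' : measurable (E `&` W1) by exact: measurableI.
  have m2' : measurable (E `&` W2) by exact: measurableI.
  have m3' : measurable (E `&` W3) by exact: measurableI.
  apply: le_trans (prU_le P (measurableU _ _ m1' m2') m3') _.
  have := prU_le P m1' m2'; have := h1 E cE; have := h2 E cE; have := h3 E cE; lra.
have ED : (1 - 3 * e) * pr P E <= pr P (E `\` W).
  by have := prDI P mE mW; lra.
apply: (@le_trans _ _ (pr P (E `\` W))).
  apply: le_trans ED; rewrite -mulrA; apply: ler_wpM2l => //; lra.
apply: ae_le_pr; [exact: measurableD|exact: measurable_first_passage|].
near=> w; move=> [[[_ Jw] Cw] nWw].
have sw : forall n z, A n w * z + B n w - D n w <= Psi n w z /\
   Psi n w z <= A n w * Num.max z 0 + Num.max (B n w) 0 + D n w by near: w.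
have ad : forall n, 0 < A n w /\ 0 < D n w by near: w; exact: ae_AD_gt0.
have mono : forall n, Zproc Psi n w <= Zproc Psi n.+1 w by near: w.
have noW (Y : nat -> T -> R) K : ~ walk_exceeds Y 0 n K w ->
    forall j, (j <= n)%N -> \sum_(i < j) Y i w <= K.
  move=> h j jn; rewrite leNgt; apply/negP => hj; apply: h; exists j => //.
  by rewrite add0n big_mkord.
have nW1 : ~ W1 w by move=> ?; apply: nWw; left; left.
have nW2 : ~ W2 w by move=> ?; apply: nWw; left; right.
have nW3 : ~ W3 w by move=> ?; apply: nWw; right.
case: Jw => /= Ju Jneg.
have Cw' : c < Psi n.+1 w 0 by move: Cw; rewrite /C /= in_itv /= andbT.
have [r1 r2 r3] := jump_pathwise (fun k => (ad k).1) (fun k => (ad k).2)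
  (fun k z => (sw k z).1) g10 gamma10 c0 c1 x1 K1s (noW _ _ nW1) (noW _ _ nW2)
  (noW _ _ nW3 n (leqnn n)) Ju Jneg Cw'.
split => //.
rewrite -{1}[n.+1]add0n comp_rangeD -/(Zproc Psi (n.+1 + m) w).
apply: (lt_le_trans r3).
(* The level is crossed at time n.+2, which is at most tau + m as m >= 1; monotonicity carries the
   crossing to time tau + m. *)
have -> : (n.+1 + m = n.+2 + m.-1)%N by move: m1; clear; lia.
elim: (m.-1) => [|k IH]; first by rewrite addn0.
by rewrite addnS; exact: le_trans IH (mono _).
Unshelve. all: by end_near. Qed.

Lemma hitting_lower b : 0 < b -> b * - mu < M ->
  \forall x \near +oo, b * G (ln x) <= pr P [set w | exists n, first_passage_event n x w].
Proof.
move=> b0 hb; set mu' := mu in hb *; have mu0 : mu' < 0 := mu_lt0.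
have M0 := dens_total_gt0 log_tail_ge0 log_tail_noninc Hsub.
(* [dl] and [e] are tuned so that b * beta = (1 - 9 * e) * M, the loss allowed by
   [lower_bound_arith]. *)
pose dl := (M - b * - mu') / (2 * b).
have dl0 : 0 < dl by apply: divr_gt0; lra.
pose beta := - mu' + dl.
have beta0 : 0 < beta by rewrite /beta; lra.
have bbeta : b * beta = (M + b * - mu') / 2.
  by rewrite /beta /dl; field; rewrite lt0r_neq0.
pose e := (M - b * - mu') / (18 * M).
have e0 : 0 < e by apply: divr_gt0; lra.
have eM : 9 * e * M = (M - b * - mu') / 2 by rewrite /e; field; rewrite lt0r_neq0.
have bmu0 : 0 < b * - mu' by apply: mulr_gt0 => //; lra.
have e18 : e <= 1 / 18 by rewrite /e ler_pdivrMr; lra.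
have eee : 0 <= (1 - 3 * e) * (1 - e) by apply: mulr_ge0; lra.
have mu20 : 0 < - mu' / 2 by lra.
have [g1 [g2 [g10 g20 hE2]]] :=
  Ex_walk_step_close integrableR_logBDm (fun w => logp_ge0 _) ilnA mu20.
have EY2 : Ex P (fun w => phi_low g1 g2 (triple A B D 0 w)) < 0.
  by apply: le_lt_trans hE2 _; rewrite -/mu'; lra.
have iY1 := integrableR_walk_step integrableR_logBDp (fun w => logp_ge0 _) ilnA gamma1 gamma2.
have iY2 := integrableR_walk_step integrableR_logBDm (fun w => logp_ge0 _) ilnA g1 g2.
have Y3E : (fun w => phi_log beta (triple A B D 0 w)) = (fun w => (-1) * ln (A 0%N w) - beta).
  by apply/funext => w; rewrite /phi_log mulN1r.
have iN : integrableR P (fun w => (-1) * ln (A 0%N w)) by exact: integrableRZ.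
have iY3 : integrableR P (fun w => phi_log beta (triple A B D 0 w)).
  by rewrite Y3E; apply: integrableRB => //; exact: integrableR_cst.
have EY3 : Ex P (fun w => phi_log beta (triple A B D 0 w)) < 0.
  rewrite Y3E (ExB iN (integrableR_cst P beta)) ExZ // Ex_cst -/mu' /beta; lra.
have [K1 K10 hK1] := tight_walk iid (measurable_phi_up gamma1 gamma2) iY1 EYvar e0.
have [K2 K20 hK2] := tight_walk iid (measurable_phi_low g1 g2) iY2 EY2 e0.
have [K3 K30 hK3] := tight_walk iid (measurable_phi_log beta) iY3 EY3 e0.
have [c [c0 c1 hc]] := Psi_zero_large e0.
pose kap := expR (K2 + g2) * expR (- g1) / (1 - expR (- g1)).
have q1 : expR (- g1) < 1 by rewrite -expR0 ltr_expR; lra.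
have kap0 : 0 <= kap by apply: divr_ge0; [apply: mulr_ge0; exact: expR_ge0|lra].
pose E := (1 + kap) * (2 / c) * expR (K3 + 2 * `|gamma2|).
have c21 : 1 <= 2 / c by rewrite ler_pdivlMr //; lra.
have k1 : 1 <= (1 + kap) * (2 / c).
  by rewrite -[leLHS]mulr1; apply: ler_pM => //; lra.
have eK1 : 1 <= expR (K3 + 2 * `|gamma2|).
  by rewrite -expR0 ler_expR; apply: addr_ge0 => //; apply: mulr_ge0.
have E1 : 1 <= E by rewrite -[leLHS]mulr1; apply: ler_pM.
have [u0 [_ hu0]] := jump_prob c0 e0.
have lt1 := near_ln_shift (ln E)
  (dens_long_tail log_tail_ge0 log_tail_noninc Hsub (ln E) e0).
(* Chosen so that s1 - beta = log x - c', where the sum over the excluded events is compared with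
   G. *)
pose c' := beta - ln E - ln (c / 2).
have lt2 := near_ln_shift 0 (dens_long_tail log_tail_ge0 log_tail_noninc Hsub c' e0).
near=> x.
have x1 : 1 <= x by near: x; apply: nbhs_pinfty_ge; exact: num_real.
have xu0 : u0 < x by near: x; apply: nbhs_pinfty_gt; exact: num_real.
have K1s : K1 <= sthr gamma1 gamma2 x.
  have : expR (K1 + gamma2 - ln (1 - expR (- gamma1))) <= x by near: x; apply: nbhs_pinfty_ge; exact: num_real.
  by rewrite -[x in _ <= x](lnK (x := x)) ?posrE ?ler_expR /sthr; lra.
have xc' : expR c' <= x by near: x; apply: nbhs_pinfty_ge; exact: num_real.
have t1 : G (ln x + ln E - ln E) <= (1 + e) * G (ln x + ln E) by near: x.
have t2 : G (ln x + 0 - c') <= (1 + e) * G (ln x + 0) by near: x.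
rewrite addrK in t1; rewrite addr0 in t2.
have x0 : 0 < x := lt_le_trans ltr01 x1.
have E0 : 0 < E := lt_le_trans ltr01 E1.
pose s0 := ln x + ln E.
pose s1 := s0 + ln (c / 2).
have s00 : 0 <= s0 by apply: addr_ge0; exact: ln_ge0.
have lnxc' : c' <= ln x by rewrite -ler_expR lnK.
have s1b : beta <= s1 by move: lnxc'; rewrite /c' /s1 /s0 !lerBlDr addrAC.
have c20 : 0 < c / 2 by apply: divr_gt0.
have per n : (1 - 3 * e) * (1 - e) * ((1 - e) * H (s0 + n%:R * beta) - e * H (s1 + n%:R * beta))
    <= pr P (first_passage_event n.+1 x).
  pose u := x * E * expR (beta * n%:R).
  have en : 1 <= expR (beta * n%:R) by rewrite -expR0 ler_expR mulr_ge0 // ltW.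
  have xE : x <= x * E by apply: ler_peMr => //; exact: ltW.
  have xEu : x * E <= u by apply: ler_peMr => //; apply: mulr_ge0; exact: ltW.
  have u_gt0 : 0 < u by apply: lt_le_trans (le_trans xE xEu).
  have lnu : ln u = s0 + n%:R * beta.
    have xE0 : 0 < x * E by exact: mulr_gt0.
    by rewrite /u lnM ?posrE ?expR_gt0 // expRK lnM ?posrE // /s0 [beta * _]mulrC.
  have lncu : ln (c * u / 2) = s1 + n%:R * beta.
    have -> : c * u / 2 = u * (c / 2) by ring.
    by rewrite lnM ?posrE // lnu /s1 addrAC.
  have hj : (1 - e) * H (ln u) - e * H (ln (c * u / 2))
      <= pr P (triple A B D 0 @^-1` jump_set u (c * u / 2)).
    by apply: hu0; apply: lt_le_trans xu0 (le_trans xE xEu).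
  rewrite lnu lncu in hj.
  apply: le_trans (first_passage_lower g10 c0 c1 x1 K1s e0 e18 hc (hK1 n) (hK2 n) (hK3 n)).
  by rewrite ler_wpM2l.
have mU : measurable [set w | exists n, first_passage_event n x w].
  have -> : [set w | exists n, first_passage_event n x w] = \bigcup_n first_passage_event n x.
    by apply/seteqP; split => [w [n hn]|w [n _ hn]]; exists n.
  by apply: bigcupT_measurable => n; exact: measurable_first_passage.
have sumle N : \sum_(n < N) pr P (first_passage_event n.+1 x) <=
    pr P [set w | exists n, first_passage_event n x w].
  apply: (@pr_sum_disjoint _ _ _ P (fun n => first_passage_event n.+1 x)) => //.
  - by move=> n; exact: measurable_first_passage.
  - by move=> n w hn; exists n.+1.
  - move=> k n kn; rewrite -subset0 => w [[h _ _] [_ h' _]].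
    by have := h' k.+1 kn; rewrite leNgt h.
have Gs0 := dens_tail_gt0 Hsub s0.
have [_ _ _ Gsm _] := dens_tail_lattice log_tail_ge0 log_tail_noninc Hsub beta0.
have eG : 0 < e * G s0 by exact: mulr_gt0.
(* N depends on x: finitely many jump times suffice once the integral beyond them is a fraction e of
   G s0. *)
have [N _ hN] := Gsm _ eG.
have GN : G (s0 + N%:R * beta) <= e * G s0.
  apply: le_trans (hN N (leqnn N)).
  by apply: (dens_tail_noninc log_tail_ge0 log_tail_noninc Hsub); rewrite lerDr.
set SH := \sum_(n < N) H (s0 + n%:R * beta).
have l1 : M * (G s0 - G (s0 + N%:R * beta)) <= beta * SH.
  exact: sum_tail_lower log_tail_ge0 log_tail_noninc Hsub _ _ _ s00 beta0.
set SH' := \sum_(n < N) H (s1 + n%:R * beta).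
have l2 : beta * SH' <= M * (G (s1 - beta) - G (s1 - beta + N%:R * beta)).
  exact: sum_tail_upper log_tail_ge0 log_tail_noninc Hsub _ _ _ s1b beta0.
have total : (1 - 3 * e) * (1 - e) * ((1 - e) * SH - e * SH') <=
    pr P [set w | exists n, first_passage_event n x w].
  apply: le_trans (sumle N); rewrite /SH /SH' !mulr_sumr -sumrB mulr_sumr.
  by apply: ler_sum => n _; exact: per.
have s1E : s1 - beta = ln x - c' by rewrite /s1 /s0 /c'; ring.
rewrite s1E in l2.
have bbeta' : b * beta = (1 - 9 * e) * M by rewrite bbeta mulrBl mul1r eM; field.
exact: (lower_bound_arith e0 e18 M0 beta0 bbeta' (dens_tail_gt0 Hsub _)
  (ltW (dens_tail_gt0 Hsub _)) t1 t2 GN l1 l2 total).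
Unshelve. all: by end_near. Qed.

End Model.

(** * Comparison of the two bounds *)

Theorem theorem3 (R : realType) (d : measure_display) (T : measurableType d)
  (P : probability T R) (Psi : nat -> T -> R -> R) (A B D : nat -> T -> R)
  (gamma1 gamma2 : R) (M : nat) :
  (* (Psi_n, A_n, B_n, D_n)_n i.i.d.; Psi n stands for the paper's Psi_{n+1} *)
  iid_seq P Psi A B D ->
  (* each Psi_n is a random Lipschitz function R -> (0, oo) *)
  (forall n w t, 0 < Psi n w t) ->
  (forall n w, lipschitz (Psi n w)) ->
  (* a.s. sandwich bounds *)
  {ae P, forall w, forall n z,
      A n w * z + B n w - D n w <= Psi n w z /\
      Psi n w z <= A n w * Num.max z 0 + Num.max (B n w) 0 + D n w} ->
  (* Assumption 2: Z^(n) nondecreasing a.s. *)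
  {ae P, forall w, forall n, Zproc Psi n w <= Zproc Psi n.+1 w} ->
  (* (a) *)
  {ae P, forall w, 0 < A 0%N w /\ 0 < D 0%N w} ->
  (-oo < \int[P]_w (ln (A 0%N w))%:E)%E ->
  (\int[P]_w maxe (elog (Lip (Psi 0%N w))) 0%E < +oo)%E ->
  (\int[P]_w elog (Lip (Psi 0%N w)) < 0)%E ->
  (\int[P]_w (logp `|Num.max (B 0%N w) 0 + D 0%N w|)%:E < +oo)%E ->
  (\int[P]_w (logp `|B 0%N w - D 0%N w|)%:E < +oo)%E ->
  (* (b) *)
  (exists eta : R, 0 < eta /\
     (\int[P]_w ((logp (Num.max (A 0%N w) (B 0%N w))) `^ (1 + eta))%:E < +oo)%E) ->
  (* (c) *)
  asym_equiv (fun x => pr P [set w | x < Num.max (A 0%N w) (Num.max (B 0%N w) 0 + D 0%N w)])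
             (fun x => pr P [set w | x < Num.max (A 0%N w) (B 0%N w)]) ->
  asym_equiv (fun x => pr P [set w | x < Num.max (A 0%N w) (B 0%N w - D 0%N w)])
             (fun x => pr P [set w | x < Num.max (A 0%N w) (B 0%N w)]) ->
  little_o_infty (fun x => pr P [set w | x < A 0%N w /\ B 0%N w - D 0%N w <= - x])
                 (fun x => pr P [set w | x < Num.max (A 0%N w) (B 0%N w)]) ->
  (* the integrated tail of log max(A_1, B_1) is subexponential *)
  subexp_tail_law (fun s => pr P [set w | s < ln (Num.max (A 0%N w) (B 0%N w))]) ->
  (* gamma *)
  0 < gamma1 ->
  (\int[P]_w (Yvar A B D gamma1 gamma2 0%N w)%:E < 0)%E ->
  (1 <= M)%N ->
  (* liminf_{x -> oo} P(tau_gamma(x) < oo, Psi_{1:tau}(Z'^(M)) > x) / P(T(x) < oo) >= 1 *)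
  forall eps : R, 0 < eps ->
  \forall x \near +oo,
    (1 - eps) * pr P [set w | exists n, x < Zproc Psi n w]
    <= pr P [set w | exists n,
           (* tau_gamma(x) = n *)
           sthr gamma1 gamma2 x < Swalk A B D gamma1 gamma2 n w /\
           (forall m, (m < n)%N -> Swalk A B D gamma1 gamma2 m w <= sthr gamma1 gamma2 x) /\
           (* Psi_{1:n}(Psi_{n+1:n+M}(0)) > x *)
           x < comp_range (fun i => Psi i w) 0 n (comp_range (fun i => Psi i w) n M 0)].
Proof.
move=> iid Psi0 lipPsi sandwich monoZ AD0 lnA0 _ _ logBDp logBDm [eta [eta0 hmom]]
  tailp tailm tailneg Hsub gamma10 EY M1 eps eps0.
have contPsi n w : continuous (Psi n w) := lipschitz_fun_continuous (lipPsi n w).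
have [_ [mA [mB [mD _]]]] := iid.
have ilnA := integrableR_ln (mA 0%N) (mB 0%N) lnA0 eta0 hmom.
have iBDp := integrableR_logBDp iid logBDp.
have iY := integrableR_walk_step iBDp (fun w => logp_ge0 _) ilnA gamma1 gamma2.
have EY0 : Ex P (Yvar A B D gamma1 gamma2 0) < 0 by rewrite -lte_fin EFin_Ex.
have mu0 : Ex P (fun w => ln (A 0%N w)) < 0.
  apply: le_lt_trans EY0; apply: le_Ex => // w.
  rewrite /Yvar -[leLHS]addr0; apply: lerD; last exact: ltW.
  by rewrite le_max lexx orbT.
set mu := Ex _ _ in mu0.
have HE : (fun s => pr P [set w | s < ln (Num.max (A 0%N w) (B 0%N w))]) = log_tail P A B by [].
rewrite HE in Hsub.
have H0 := log_tail_ge0 P A B; have Hm := log_tail_noninc iid.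
have M0 := dens_total_gt0 H0 Hm Hsub.
set M' := dens_total _ in M0.
have [eps1|eps1] := leP 1 eps.
  near=> x; apply: (@le_trans _ _ 0); last exact: pr_ge0.
  by apply: mulr_le0_ge0; [lra|exact: pr_ge0].
have nmu : 0 < - mu by lra.
have Mmu : 0 < M' / - mu by exact: divr_gt0.
(* [b2] and [b1] lie on either side of M' / |mu|, with b2 = (1 - eps) * b1, so that the two bounds
   combine to the claim. *)
pose b2 : R := (1 - eps / 2) * (M' / - mu).
have b20 : 0 < b2 by apply: mulr_gt0 => //; lra.
have b2M : b2 * - mu < M'.
  by rewrite /b2 -mulrA divfK ?lt0r_neq0 // gtr_pMl //; lra.
have e1n : 1 - eps != 0 by rewrite subr_eq0 gt_eqF.
pose b1 : R := b2 / (1 - eps).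
have b1E : (1 - eps) * b1 = b2 by rewrite /b1 mulrC divfK.
have b1M : M' < b1 * - mu.
  have -> : b1 * - mu = (1 - eps / 2) / (1 - eps) * M'.
    have zE : M' / - mu * - mu = M' by rewrite divfK // lt0r_neq0.
    by rewrite -[in RHS]zE /b1 /b2; set z := M' / - mu; ring.
  by rewrite ltr_pMl // ltr_pdivlMr; lra.
have up := hitting_upper iid Psi0 contPsi sandwich AD0 ilnA logBDp tailp Hsub mu0 b1M.
have low := hitting_lower iid Psi0 contPsi sandwich AD0 ilnA logBDp logBDm Hsub mu0
  tailm tailneg monoZ gamma10 EY0 M1 b20 b2M.
near=> x.
have hup : pr P [set w | exists n, x < Zproc Psi n w] <= b1 * dens_tail (log_tail P A B) (ln x).
  by near: x.
have hlow : b2 * dens_tail (log_tail P A B) (ln x) <=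
    pr P [set w | exists n, first_passage_event Psi A B D gamma1 gamma2 M n x w] by near: x.
rewrite [X in _ <= pr P X](_ : _ =
    [set w | exists n, first_passage_event Psi A B D gamma1 gamma2 M n x w]); last first.
  by apply/seteqP; split => w [n]; [move=> [h1 [h2 h3]]|move=> [h1 h2 h3]]; exists n.
apply: le_trans hlow; rewrite -b1E -mulrA.
by apply: ler_wpM2l => //; lra.
Unshelve. all: by end_near. Qed.
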